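(* Fix $\alpha>0$ and, for each $n\ge 1$, let $\beta=\beta_n=2\alpha/n$ (i.e. $n\beta=2\alpha$). Let $L_{n,\beta}=\frac1n\sum_{j=1}^n\delta_{\lambda_j}$ be the empirical distribution of the eigenvalues $\lambda_1,\dots,\lambda_n$ of the random matrix $T_{n,\beta}$. Let $f:\mathbb R\to\mathbb R$ be a continuously differentiable function whose derivative has polynomial growth, i.e. $|f'(x)|\le P(x)$ for all $x\in\mathbb R$ for some polynomial $P$. Then there is a constant $\sigma_f^2\ge 0$ such that, as $n\to\infty$ with $n\beta=2\alpha$, $$\sqrt n\,\big(\langle L_{n,\beta},f\rangle-\mathbb E[\langle L_{n,\beta},f\rangle]\big)\longrightarrow \mathcal N(0,\sigma_f^2)\quad\text{in distribution.}$$
   Context: For $k>0$, $\tilde\chi_k$ denotes the law of the square root of a $\mathrm{Gamma}(k/2,1)$ random variable (shape $k/2$, scale $1$). For $n\ge1$, $\beta>0$, $T_{n,\beta}$ is the $n\times n$ random symmetric tridiagonal matrix with independent entries (up to symmetry): diagonal entries $a_1,\dots,a_n\sim\mathcal N(0,1)$ and subdiagonal entries $b_i\sim\tilde\chi_{(n-i)\beta}$, $i=1,\dots,n-1$ (so $b_i^2\sim\mathrm{Gamma}((n-i)\beta/2,1)$). Its eigenvalues (in exchangeable random order) have joint density proportional to $\prod_{i<j}|\lambda_j-\lambda_i|^\beta e^{-\frac12(\lambda_1^2+\cdots+\lambda_n^2)}$ on $\mathbb R^n$ (Gaussian beta ensemble). Notation: $\langle\mu,f\rangle=\int f\,d\mu$.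 $\mathcal N(0,0)$ is interpreted as the Dirac mass at $0$. *)

(* Defs.v *)
From HB Require Import structures.
From mathcomp Require Export all_boot all_order all_algebra.
From mathcomp Require Export all_classical all_reals all_analysis.
Export Order.TTheory GRing.Theory Num.Theory.
Export numFieldNormedType.Exports.

Set Implicit Arguments.
Unset Strict Implicit.
Unset Printing Implicit Defensive.

Local Open Scope classical_set_scope.
Local Open Scope ring_scope.

(* [normal_prob m 0] is the uniform law on [0, 1], hence the case split. *)
Definition gaussian_law (R : realType) (s2 : R) :
    probability (measurableTypeR R) R :=
  if s2 == 0 then \d_(0 : measurableTypeR R) : probability (measurableTypeR R) R
  else normal_prob 0 (Num.sqrt s2) : probability (measurableTypeR R) R.

Definition Gamma (R : realType) (k : R) : R :=
  \int[lebesgue_measure]_(x in `]0, +oo[) (x `^ (k - 1) * expR (- x)).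

Definition gamma_pdf (R : realType) (k x : R) : R :=
  if 0 < x then x `^ (k - 1) * expR (- x) / Gamma k else 0.

Definition gamma_law (R : realType) (k : R) (A : set R) : \bar R :=
  (\int[lebesgue_measure]_(x in A) (gamma_pdf k x)%:E)%E.

Definition tchi_law (R : realType) (k : R) : set R -> \bar R :=
  pushforward (gamma_law (k / 2)) (fun x : R => Num.sqrt x).

Definition has_law d (T : measurableType d) (R : realType)
    (P : probability T R) (X : {RV P >-> R}) (nu : set R -> \bar R) : Prop :=
  forall A : set R, measurable A -> distribution P X A = nu A.

Definition mutually_independent d (T : measurableType d) (R : realType)
    (P : probability T R) (I : finType) (X : I -> {RV P >-> R}) : Prop :=
  forall (J : {set I}) (A : I -> set R),
    (forall i, i \in J -> measurable (A i)) ->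
    P (\bigcap_(i in [set` J]) X i @^-1` A i) =
    (\prod_(i in J) P (X i @^-1` A i))%E.

(* Indices start at 0: [a i] and [b i] stand for the entries a_{i+1} and
   b_{i+1}; only [a 0], ..., [a (n - 1)] and [b 0], ..., [b (n - 2)] occur. *)
Definition tridiag (R : realType) (n : nat) (a b : nat -> R) : 'M[R]_n :=
  \matrix_(i < n, j < n)
    if i == j :> nat then a i
    else if i == j.+1 :> nat then b j
    else if j == i.+1 :> nat then b i
    else 0.

Record gbe_entries d (T : measurableType d) (R : realType)
    (P : probability T R) (n : nat) (beta : R)
    (a b : nat -> {RV P >-> R}) : Prop := GbeEntries {
  gbe_diag : forall i : 'I_n, has_law (a i) (gaussian_law 1);
  gbe_subdiag : forall i : 'I_n.-1,
    has_law (b i) (tchi_law ((n - i.+1)%:R * beta));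
  gbe_indep : mutually_independent
    (fun k : 'I_n + 'I_n.-1 =>
       match k with inl i => a i | inr i => b i end)
}.

(* The eigenvalues with multiplicity, in nondecreasing order; the default
   value is never used when [A] is symmetric. *)
Definition eigenvalues (R : realType) (n : nat) (A : 'M[R]_n) : seq R :=
  xget [::] [set s : seq R |
    sorted <=%R s /\ char_poly A = \prod_(x <- s) ('X - x%:P)].

Definition empirical_distribution (R : realType) (s : seq R) :
    {measure set R -> \bar R} :=
  mscale ((size s)%:R^-1)%:nng (msum (fun i => \d_(s`_i)) (size s)).

(* The linear statistic <L, f> of the n x n random matrix, as a function of
   the sample point. *)
Definition linear_statistic d (T : measurableType d) (R : realType)
    (P : probability T R) (n : nat) (a b : nat -> {RV P >-> R})
    (f : R -> R) (w : T) : R :=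
  \int[empirical_distribution
         (eigenvalues (tridiag n (fun i => a i w) (fun i => b i w)))]_x f x.

Definition cvg_in_distribution (R : realType) (d : nat -> measure_display)
    (T : forall n, measurableType (d n)) (P : forall n, probability (T n) R)
    (X : forall n, T n -> R) (nu : probability (measurableTypeR R) R) : Prop :=
  (forall n, measurable_fun [set: T n] (X n)) /\
  forall g : R -> R, continuous g -> (exists M, forall x, `|g x| <= M) ->
    'E_(P n)[g \o X n]%E @[n --> \oo] --> (\int[nu]_x (g x)%:E)%E.

(* Main.v *)
Require Import Defs.
From HB Require Import structures.
From mathcomp.real_closed Require complex.
From mathcomp Require Import measurable_realfun simple_functions ring lra zify.

(** Read site by site, the entries of the matrix are independent, with laws that
    vary slowly: around site u n they are N(0,1) on the diagonal and chi laws of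
    shape close to alpha (1 - u) off it. A linear statistic tr f(T) is almost
    additive over disjoint stretches of sites, so that it obeys a central limit
    theorem like a sum of independent variables.

    The heart is the cost of a cut ([moments_jdefect]): erasing one off-diagonal
    entry b changes tr f(T) by a variable whose moments are bounded uniformly in
    the size. A polynomial bound on the derivative of f gives increments
    dominated by those of phi(x) = c (x + x^r) with r odd. Let T0 be the matrix
    with b erased, and C the matrix T0 with |b| added to the two diagonal
    entries that b coupled. As a quadratic form, C dominates both T and T0, and
    eigenvalues are monotone ([trf_monotone]), whence
    |tr f(C) - tr f(T)| <= tr phi(C) - tr phi(T), and the same with T0. On the
    right are traces of powers of tridiagonal matrices that differ at one
    coupling; their difference is a sum of boundedly many products of nearby
    entries.

    Cut now a matrix of size 2^k m into blocks of size m by successive halving.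
    The errors made in the two halves are independent, so that their variances
    add, and the total error has a deviation of order sqrt (2^k)
    ([var_block_error]). After division by sqrt n, the statistic is therefore
    within O(1 / sqrt m) in L2 of a sum of independent block statistics,
    uniformly in n ([block_approximation]).

    For fixed m, the replacement argument of Lindeberg compares the block sum
    with a Gaussian variable of the same variance ([lindeberg]). That variance
    converges as n grows: it is a Riemann sum ([riemann_cvg]) of variances of
    blocks, and these depend continuously on the laws of their entries
    ([block_variance_cvg], [gbe_law_cvg]). Letting n and then m go to infinity,
    the standard deviation of the statistic converges ([std_dev_cvg]), and then
    its law ([clt_stat_cvg]). Convergence in distribution is tested on
    polynomials in the logistic function, which are smooth enough for the
    replacement argument and dense enough to determine the limit
    ([cvg_gaussian_criterion]). *)

Set Implicit Arguments.
Unset Strict Implicit.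
Unset Printing Implicit Defensive.

Local Open Scope classical_set_scope.
Local Open Scope ring_scope.

(** * The spectral theorem for real symmetric matrices *)

Section Complexified.
Import complex.
Open Scope sesquilinear_scope.
Variable (R : realType).
Local Notation C := (complex R).
Local Notation toC := (real_complex R).
Local Notation cplx := (map_mx toC).

Lemma cplx_real m n (A : 'M[R]_(m, n)) : cplx A \is a mxOver Num.real.
Proof.
by apply/mxOverP => i j; rewrite mxE; apply/complex_realP; exists (A i j).
Qed.

(** Hermitian matrices over the complex numbers are unitarily diagonalizable
    with real eigenvalues. The eigenvectors are left complex: only the
    eigenvalues matter for traces of functions, and they are real. *)
Lemma symmetric_spectral n (A : 'M[R]_n) : A^T = A ->
  exists (P : 'M[C]_n) (d : 'rV[R]_n), P \is unitarymx /\
    cplx A = P ^t* *m diag_mx (cplx d) *m P.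
Proof.
move=> symA.
have hA : cplx A \is hermsymmx.
  apply: realsym_hermsym (cplx_real A).
  by apply/is_hermitianmxP; rewrite expr0 scale1r map_mx_id// map_trmx symA.
have [P [D [uP Dr AE]]] : exists P D, [/\ P \is unitarymx,
    D \is a mxOver Num.real & cplx A = invmx P *m diag_mx D *m P].
  exists (spectralmx (cplx A)), (spectral_diag (cplx A)).
  split; [exact: spectral_unitarymx|exact: hermitian_spectral_diag_real|].
  exact/orthomx_spectralP/hermitian_normalmx.
have DE : cplx (map_mx (@complex.Re R) D) = D.
  by apply/matrixP => i j; rewrite !mxE RRe_real//; move/mxOverP : Dr; exact.
exists P, (map_mx (@complex.Re R) D); split; first exact: uP.
rewrite DE -(invmx_unitary uP); exact: AE.
Qed.

Section Diagonalized.
Variables (n : nat) (A : 'M[R]_n) (P : 'M[C]_n) (d : 'rV[R]_n).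
Hypotheses (uP : P \is unitarymx)
  (AE : cplx A = P ^t* *m diag_mx (cplx d) *m P).

Let PP : P *m P ^t* = 1%:M.
Proof. exact/unitarymxP. Qed.

Let PP' : P ^t* *m P = 1%:M.
Proof. exact: mulmx1C PP. Qed.

Lemma char_poly_diagonalized : char_poly A = \prod_i ('X - (d 0 i)%:P).
Proof.
apply: (@map_poly_inj _ _ toC).
rewrite map_char_poly AE rmorph_prod/=.
transitivity (char_poly (diag_mx (cplx d))).
  rewrite /char_poly /char_poly_mx !map_mxM.
  have {1}-> : ('X%:M : 'M[{poly C}]_n) =
      map_mx polyC (P ^t*) *m 'X%:M *m map_mx polyC P.
    by rewrite scalar_mxC -mulmxA -map_mxM PP' map_mx1 mulmx1.
  rewrite -mulmxBl -mulmxBr !det_mulmx mulrC mulrA -det_mulmx -map_mxM PP.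
  by rewrite map_mx1 det1 mul1r.
rewrite char_poly_trig ?diag_mx_is_trig//.
apply: eq_bigr => i _.
by rewrite !mxE eqxx mulr1n/= rmorphB/= map_polyX map_polyC.
Qed.

Lemma expr_diagonalized k : cplx (A ^+ k) =
  P ^t* *m diag_mx (\row_i (toC (d 0 i)) ^+ k) *m P.
Proof.
elim: k => [|k IH].
  rewrite (_ : diag_mx _ = 1%:M) ?mulmx1 ?PP' ?map_mx1//.
  by apply/matrixP => i j; rewrite !mxE expr0.
rewrite exprS map_mxM IH AE -!mulmxA (mulmxA P) PP mul1mx; congr (_ *m _).
rewrite mulmxA mulmx_diag; congr (diag_mx _ *m _).
by apply/rowP => i; rewrite !mxE exprS.
Qed.

Lemma mxtrace_expr_diagonalized k : \tr (A ^+ k) = \sum_i (d 0 i) ^+ k.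
Proof.
apply: (@complexI R).
rewrite -trace_map_mx expr_diagonalized mxtrace_mulC mulmxA PP mul1mx.
rewrite mxtrace_diag rmorph_sum/=; apply: eq_bigr => i _.
by rewrite mxE rmorphXn.
Qed.

Lemma qform_diagonalized (v : 'rV[C]_n) : (v *m cplx A *m v ^t*) 0 0 =
  \sum_i toC (d 0 i) * `|(v *m P ^t*) 0 i| ^+ 2.
Proof.
rewrite AE !mulmxA -mulmxA.
have -> : P *m v ^t* = (v *m P ^t*) ^t* by rewrite trmx_mul map_mxM trmxCK.
rewrite mxE; apply: eq_bigr => i _.
by rewrite mul_mx_diag !mxE normCK [_ * toC _]mulrC mulrA.
Qed.

Lemma norm_diagonalized (v : 'rV[C]_n) : (v *m v ^t*) 0 0 =
  \sum_i `|(v *m P ^t*) 0 i| ^+ 2.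
Proof.
have -> : v *m v ^t* = v *m P ^t* *m (v *m P ^t*) ^t*.
  by rewrite trmx_mul map_mxM trmxCK mulmxA -(mulmxA v) PP' mulmx1.
by rewrite mxE; apply: eq_bigr => i _; rewrite !mxE normCK.
Qed.

End Diagonalized.

(** The key to the monotonicity of eigenvalues. If [A] had more eigenvalues
    above [x] than [B], a dimension count would give a nonzero vector spanned by
    the corresponding eigenvectors of [A] and orthogonal to those of [B]; on it
    the form of [A] exceeds [x] times the square norm, and that of [B] does
    not. *)
Lemma count_eig_le n (A B : 'M[R]_n) (P Q : 'M[C]_n) (d e : 'rV[R]_n) (x : R) :
  P \is unitarymx -> cplx A = P ^t* *m diag_mx (cplx d) *m P ->
  Q \is unitarymx -> cplx B = Q ^t* *m diag_mx (cplx e) *m Q ->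
  (forall v : 'rV[C]_n, (v *m cplx A *m v ^t*) 0 0 <= (v *m cplx B *m v ^t*) 0 0) ->
  (#|[pred i | (x < d 0 i)%R]| <= #|[pred i | (x < e 0 i)%R]|)%N.
Proof.
move=> uP AE uQ BE AB; rewrite leqNgt; apply/negP => ltcard.
set S := [pred i | (x < d 0 i)%R] in ltcard *; set U := [pred i | (x < e 0 i)%R] in ltcard *.
pose PS : 'M[C]_(#|S|, n) := rowsub (fun k => enum_val k) P.
pose QU : 'M[C]_(n, #|U|) := colsub (fun k => enum_val k) (Q ^t*).
(* The vector v = c *m PS lies in the span of the eigenvectors of A above x,
   and c in the kernel makes it orthogonal to those of B. *)
have : \rank (kermx (PS *m QU)) != 0%N.
  by rewrite mxrank_ker -lt0n subn_gt0 (leq_ltn_trans (rank_leq_col _)).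
rewrite mxrank_eq0 => /rowV0Pn[c /sub_kermxP]; rewrite mulmxA => cPQ c0.
have PSP : PS *m P ^t* = \matrix_(k, i) (enum_val k == i)%:R.
  rewrite /PS mul_rowsub_mx (unitarymxP uP).
  by apply/matrixP => k i; rewrite !mxE.
pose v := c *m PS.
have vP i : (v *m P ^t*) 0 i = \sum_k c 0 k * (enum_val k == i)%:R.
  by rewrite /v -mulmxA PSP mxE; apply: eq_bigr => k _; rewrite !mxE.
have vPS k : (v *m P ^t*) 0 (enum_val k) = c 0 k.
  rewrite vP (bigD1 k)//= eqxx mulr1 big1 ?addr0// => l lk.
  by rewrite (inj_eq enum_val_inj) (negbTE lk) mulr0.
have vPNS i : i \notin S -> (v *m P ^t*) 0 i = 0.
  move=> iS; rewrite vP big1// => k _; case: eqP => [ki|]; last by rewrite mulr0.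
  by rewrite -ki enum_valP in iS.
have vQU i : i \in U -> (v *m Q ^t*) 0 i = 0.
  move=> iU; move/rowP: cPQ => /(_ (enum_rank_in iU i)).
  rewrite /v /QU mulmx_colsub !mxE => H.
  by move: H; rewrite enum_rankK_in.
have := AB v; rewrite (qform_diagonalized AE) (qform_diagonalized BE).
apply/negP; rewrite lt_geF//.
apply: (@le_lt_trans _ _ (toC x * (v *m v ^t*) 0 0)).
  rewrite (norm_diagonalized uQ) mulr_sumr; apply: ler_sum => i _.
  have [iU|] := boolP (i \in U).
    by rewrite vQU// normr0 expr0n/= !mulr0.
  by rewrite inE -leNgt => ex; rewrite ler_wpM2r ?exprn_ge0// lecR.
rewrite (norm_diagonalized uP) mulr_sumr.
have [k ck] : exists k, c 0 k != 0 by apply/rV0Pn.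
have SP i : i \in S -> toC x <= toC (d 0 i) by rewrite inE lecR => /ltW.
rewrite (bigD1 (enum_val k))//= [ltRHS](bigD1 (enum_val k))//=.
rewrite ltr_leD//.
  rewrite ltr_pM2r; last by rewrite exprn_gt0// normr_gt0 vPS.
  by rewrite ltcR; have := enum_valP k; rewrite inE.
apply: ler_sum => i _; have [iS|iS] := boolP (i \in S).
  by rewrite ler_wpM2r ?exprn_ge0//; exact: SP.
by rewrite vPNS// normr0 expr0n/= !mulr0.
Qed.

End Complexified.

(** * Spectral sums and their monotonicity *)

Section TraceFunction.
Import complex.
Open Scope sesquilinear_scope.
Variable (R : realType).
Implicit Types (f g : R -> R).
Local Notation C := (complex R).
Local Notation toC := (real_complex R).
Local Notation cplx := (map_mx toC).

(** The trace of [f A], for symmetric [A]. *)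
Definition trf f n (A : 'M[R]_n) : R := \sum_(x <- eigenvalues A) f x.

Lemma eigenvaluesP n (A : 'M[R]_n) (s : seq R) :
  char_poly A = \prod_(x <- s) ('X - x%:P) ->
  sorted <=%R (eigenvalues A) /\
  char_poly A = \prod_(x <- eigenvalues A) ('X - x%:P).
Proof.
move=> As; rewrite /eigenvalues; case: xgetP => //= /(_ (sort <=%R s))[].
split; first exact: sort_le_sorted.
by rewrite As; apply: perm_big; rewrite perm_sym perm_sort.
Qed.

Lemma eigenvalues_perm n (A : 'M[R]_n) (s : seq R) :
  char_poly A = \prod_(x <- s) ('X - x%:P) -> perm_eq (eigenvalues A) s.
Proof.
by move=> As; apply: prod_XsubC_eq; rewrite -As; have [_ <-] := eigenvaluesP As.
Qed.

Lemma trfE f n (A : 'M[R]_n) (s : seq R) :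
  char_poly A = \prod_(x <- s) ('X - x%:P) -> trf f A = \sum_(x <- s) f x.
Proof. by move=> As; exact/perm_big/eigenvalues_perm. Qed.

Lemma char_poly_seq n (A : 'M[R]_n) (d : 'rV[R]_n) :
  char_poly A = \prod_i ('X - (d 0 i)%:P) ->
  char_poly A = \prod_(x <- [seq d 0 i | i <- enum 'I_n]) ('X - x%:P).
Proof. by rewrite big_map big_enum. Qed.

Lemma symmetric_char_poly n (A : 'M[R]_n) : A^T = A ->
  char_poly A = \prod_(x <- eigenvalues A) ('X - x%:P).
Proof.
move=> /symmetric_spectral[P [d [uP AE]]].
by have [] := eigenvaluesP (char_poly_seq (char_poly_diagonalized uP AE)).
Qed.

Lemma symmetric_eigenvalues_sorted n (A : 'M[R]_n) : A^T = A ->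
  sorted <=%R (eigenvalues A).
Proof.
move=> /symmetric_spectral[P [d [uP AE]]].
by have [] := eigenvaluesP (char_poly_seq (char_poly_diagonalized uP AE)).
Qed.

Lemma size_eigenvalues n (A : 'M[R]_n) : A^T = A -> size (eigenvalues A) = n.
Proof.
move=> sA; have := size_char_poly A; rewrite symmetric_char_poly//.
by rewrite size_prod_XsubC => -[].
Qed.

Lemma trf_expr n (A : 'M[R]_n) k : A^T = A ->
  trf (fun x => x ^+ k) A = \tr (A ^+ k).
Proof.
move=> /symmetric_spectral[P [d [uP AE]]].
rewrite (trfE _ (char_poly_seq (char_poly_diagonalized uP AE))).
by rewrite (mxtrace_expr_diagonalized uP AE) big_map big_enum.
Qed.

Lemma trfD f g n (A : 'M[R]_n) : trf (fun x => f x + g x) A = trf f A + trf g A.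
Proof. exact: big_split. Qed.

Lemma trfZ (c : R) f n (A : 'M[R]_n) : trf (fun x => c * f x) A = c * trf f A.
Proof. by rewrite /trf mulr_sumr. Qed.

Lemma trfN f n (A : 'M[R]_n) : trf (fun x => - f x) A = - trf f A.
Proof. by rewrite /trf sumrN. Qed.

Lemma trf_horner n (A : 'M[R]_n) (p : {poly R}) : A^T = A ->
  trf (fun x => p.[x]) A = \sum_(i < size p) p`_i * \tr (A ^+ i).
Proof.
move=> sA; rewrite /trf; under eq_bigr do rewrite horner_coef.
rewrite exchange_big/=; apply: eq_bigr => i _.
by rewrite -mulr_sumr -trf_expr.
Qed.

(** A real positive semidefinite form stays so on complex vectors, because the
    cross terms of the real and imaginary parts cancel by symmetry. *)
Lemma psd_complex n (M : 'M[R]_n) : M^T = M ->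
  (forall v : 'rV[R]_n, 0 <= (v *m M *m v^T) 0 0) ->
  forall v : 'rV[C]_n, 0 <= (v *m cplx M *m v ^t*) 0 0.
Proof.
move=> sM psdM v.
pose x : 'rV[R]_n := map_mx (@complex.Re R) v.
pose y : 'rV[R]_n := map_mx (@complex.Im R) v.
suff -> : (v *m cplx M *m v ^t*) 0 0 =
    toC ((x *m M *m x^T) 0 0 + (y *m M *m y^T) 0 0).
  by rewrite ler0c addr_ge0.
have E (S : comNzRingType) (u w : 'rV[S]_n) (N : 'M[S]_n) :
    (u *m N *m w^T) 0 0 = \sum_i \sum_j N i j * (u 0 i * w 0 j).
  rewrite mxE exchange_big/=; apply: eq_bigr => j _.
  rewrite !mxE mulr_suml; apply: eq_bigr => i _.
  by rewrite mulrA (mulrC (N i j)).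
rewrite -map_trmx !E -big_split rmorph_sum/=.
have two : (2 : C) != 0 by rewrite pnatr_eq0.
apply: (mulfI two); rewrite !mulr_sumr.
under [RHS]eq_bigr do rewrite -big_split/= rmorph_sum/= mulr_sumr.
under [LHS]eq_bigr do rewrite mulr_sumr.
transitivity (\sum_i \sum_j cplx M i j *
   (v 0 i * (v 0 j)^* + v 0 j * (v 0 i)^*)).
  under [RHS]eq_bigr do
    (under eq_bigr do rewrite mulrDr; rewrite big_split/=).
  rewrite big_split/= [X in _ + X]exchange_big/= -big_split/=.
  apply: eq_bigr => i _; rewrite -big_split/=; apply: eq_bigr => j _.
  have -> : cplx M j i = cplx M i j by rewrite !mxE -[in LHS]sM mxE.
  by rewrite !mxE mulr_natl mulr2n.
apply: eq_bigr => i _; apply: eq_bigr => j _.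
rewrite !mxE; case: (v 0 i) => a b; case: (v 0 j) => c d /=.
by apply/eqP; rewrite eq_complex; apply/andP; split => /=; apply/eqP; ring.
Qed.

(** Order statistics are compared by counting: the [j]-th term exceeds [x]
    exactly when enough terms do. *)
Lemma nth_sorted_le_count (s t : seq R) :
  sorted <=%R s -> sorted <=%R t -> size s = size t ->
  (forall x, (count (fun y => (x < y)%R) s <= count (fun y => (x < y)%R) t)%N) ->
  forall j, (j < size s)%N -> s`_j <= t`_j.
Proof.
move=> ss st sz cnt j js; rewrite leNgt; apply/negP => tsj.
have := cnt t`_j; rewrite leqNgt => /negP; apply.
apply: (@leq_ltn_trans (size t - j.+1)%N); last first.
  rewrite -{1}(cat_take_drop j s) count_cat.
  rewrite (@leq_trans (count (fun y => t`_j < y) (drop j s)))// ?leq_addl//.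
  have /eqP -> : (count (fun y => t`_j < y) (drop j s) == size (drop j s)).
    rewrite -all_count; apply/(all_nthP 0) => i; rewrite size_drop nth_drop => ij.
    apply: (lt_le_trans tsj).
    by apply: (sorted_leq_nth le_trans le_refl) => //; rewrite ?inE ?leq_addr// -ltn_subRL.
  by rewrite size_drop -sz ltn_sub2l.
rewrite -[X in count _ X](cat_take_drop j.+1 t) count_cat.
rewrite [X in (X + _)%N](_ : _ = 0%N); last first.
  apply/eqP; rewrite -leqn0 leqNgt -has_count; apply/negP => /(has_nthP 0)[k].
  rewrite size_take_min leq_min => /andP[kj kt]; rewrite nth_take//.
  rewrite ltNge => /negP; apply.
  by apply: (sorted_leq_nth le_trans le_refl) => //; rewrite inE -sz.
by rewrite add0n (leq_trans (count_size _ _))// size_drop.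
Qed.

Lemma count_eigenvalues n (A : 'M[R]_n) (d : 'rV[R]_n) (p : pred R) :
  char_poly A = \prod_i ('X - (d 0 i)%:P) ->
  count p (eigenvalues A) = #|[pred i | p (d 0 i)]|.
Proof.
move=> /char_poly_seq/eigenvalues_perm/permP ->.
by rewrite count_map -size_filter cardE enumT.
Qed.

(** Monotonicity of eigenvalues, due to Weyl: a larger quadratic form has, above
    any level, at least as many eigenvalues, so that the eigenvalues in
    nondecreasing order are larger term by term. *)
Lemma trf_monotone g n (A B : 'M[R]_n) : A^T = A -> B^T = B ->
  (forall v : 'rV[R]_n, 0 <= (v *m (B - A) *m v^T) 0 0) ->
  {homo g : x y / x <= y} -> trf g A <= trf g B.
Proof.
move=> sA sB AB gm.
have [P [d [uP AE]]] := symmetric_spectral sA.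
have [Q [e [uQ BE]]] := symmetric_spectral sB.
have sz : size (eigenvalues A) = size (eigenvalues B).
  by rewrite !size_eigenvalues.
have ABC (v : 'rV[C]_n) :
    (v *m cplx A *m v ^t*) 0 0 <= (v *m cplx B *m v ^t*) 0 0.
  rewrite -subr_ge0; have := psd_complex _ AB v.
  rewrite [(B - A)^T]linearB/= sA sB => /(_ erefl).
  by rewrite map_mxB mulmxBr mulmxBl !mxE.
have nth_le := nth_sorted_le_count (symmetric_eigenvalues_sorted sA)
  (symmetric_eigenvalues_sorted sB) sz.
rewrite /trf (big_nth 0) [leRHS](big_nth 0) sz big_nat_cond [leRHS]big_nat_cond.
apply: ler_sum => i; rewrite andbT => /andP[_ iB]; apply: gm.
apply: nth_le; last by rewrite sz.
move=> x.
rewrite (count_eigenvalues _ (char_poly_diagonalized uP AE)).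
rewrite (count_eigenvalues _ (char_poly_diagonalized uQ BE)).
exact: count_eig_le uP AE uQ BE ABC.
Qed.

Lemma trf_block f m n (A : 'M[R]_m) (B : 'M[R]_n) : A^T = A -> B^T = B ->
  trf f (block_mx A 0 0 B) = trf f A + trf f B.
Proof.
move=> sA sB; rewrite -[RHS]big_cat; apply: trfE.
rewrite big_cat/= -!symmetric_char_poly// /char_poly /char_poly_mx.
rewrite map_block_mx !raddf0 scalar_mx_block opp_block_mx add_block_mx.
by rewrite !oppr0 !addr0 det_ublock.
Qed.

Lemma tridiag_sym n (a b : nat -> R) : (tridiag n a b)^T = tridiag n a b.
Proof.
apply/matrixP => i j; rewrite !mxE eq_sym.
by case: eqP => [->//|_]; do 2 case: eqP => //; lia.
Qed.

Lemma tridiag_block m n (a b : nat -> R) :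
  (forall i, i.+1 = m -> b i = 0) ->
  tridiag (m + n) a b =
  block_mx (tridiag m a b) 0 0
    (tridiag n (fun i => a (m + i)%N) (fun i => b (m + i)%N)).
Proof.
move=> b0; rewrite -[LHS]submxK; congr block_mx;
  apply/matrixP => i j; rewrite !mxE/=.
- by [].
- have im := ltn_ord i; case: eqP => [|_]; first lia.
  case: eqP => [|_]; first lia.
  by case: eqP => // mj; rewrite b0//; lia.
- have jm := ltn_ord j; case: eqP => [|_]; first lia.
  case: eqP => [mi|_]; first by rewrite b0//; lia.
  by case: eqP => //; lia.
- by rewrite eqn_add2l -!addnS !eqn_add2l.
Qed.

(** A vanishing off-diagonal entry makes the statistic exactly additive. *)
Lemma trf_tridiag_split f m n (a b : nat -> R) :
  (forall i, i.+1 = m -> b i = 0) ->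
  trf f (tridiag (m + n) a b) = trf f (tridiag m a b) +
    trf f (tridiag n (fun i => a (m + i)%N) (fun i => b (m + i)%N)).
Proof. by move=> b0; rewrite tridiag_block// trf_block// tridiag_sym. Qed.

End TraceFunction.

(** * Perturbation at a single coupling *)

Section Perturbation.
Variable (R : realType).
Implicit Types (f g : R -> R).

(** Both [phi + f] and [phi - f] are nondecreasing. This holds for an
    antiderivative [phi] of any bound on the derivative of [f], and it passes to
    traces by monotonicity. *)
Definition dominated_increments f (phi : R -> R) :=
  forall x y, x <= y -> `|f y - f x| <= phi y - phi x.

(** Monotonicity applied to [phi + f] and [phi - f]: a perturbation of definite
    sign moves the statistic of [f] by no more than that of [phi]. *)
Lemma trf_increment_le f phi n (A B : 'M[R]_n) : A^T = A -> B^T = B ->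
  (forall v : 'rV[R]_n, 0 <= (v *m (B - A) *m v^T) 0 0) ->
  dominated_increments f phi ->
  `|trf f B - trf f A| <= trf phi B - trf phi A.
Proof.
move=> sA sB AB fphi; rewrite ler_norml; apply/andP; split.
  have : trf (fun x => phi x + f x) A <= trf (fun x => phi x + f x) B.
    apply: trf_monotone => // x y /fphi; rewrite ler_norml; lra.
  by rewrite !trfD; move: (trf _ A) (trf _ B) (trf _ A) (trf _ B) => *; lra.
have : trf (fun x => phi x + - f x) A <= trf (fun x => phi x + - f x) B.
  apply: trf_monotone => // x y /fphi; rewrite ler_norml; lra.
by rewrite !trfD !trfN; move: (trf _ A) (trf _ B) (trf _ A) (trf _ B) => *; lra.
Qed.

Lemma mxtrace_exprB n (C X : 'M[R]_n) r :
  \tr (C ^+ r) - \tr (X ^+ r) =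
  \sum_(l < r) \tr ((C - X) *m (X ^+ l *m C ^+ (r - l.+1))).
Proof.
rewrite -raddfB/=.
have -> : C ^+ r - X ^+ r =
    \sum_(l < r) C ^+ (r - l.+1) *m (C - X) *m X ^+ l.
  elim: r => [|r IH]; first by rewrite big_ord0 subrr.
  rewrite big_ord_recr/= subnn expr0 mul1mx.
  have -> : C ^+ r.+1 - X ^+ r.+1 = C *m (C ^+ r - X ^+ r) + (C - X) *m X ^+ r.
    by rewrite !exprS mulmxBr mulmxBl addrA subrK.
  rewrite IH mulmx_sumr; congr (_ + _); apply: eq_bigr => l _.
  by rewrite !mulmxA subSn// exprS.
rewrite raddf_sum/=; apply: eq_bigr => l _.
by rewrite -mulmxA mxtrace_mulC mulmxA.
Qed.

(** Perturbations that act on two sites only. *)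
Definition coupling n (p q : 'I_n) (s t : R) : 'M[R]_n :=
  s *: (delta_mx p p + delta_mx q q) + t *: (delta_mx p q + delta_mx q p).

Lemma mxtrace_delta_mul n (p q : 'I_n) (M : 'M[R]_n) :
  \tr (delta_mx p q *m M) = M q p.
Proof.
rewrite /mxtrace (bigD1 p)//= big1 ?addr0.
  rewrite mxE (bigD1 q)//= big1 ?addr0 ?mxE ?eqxx ?mul1r// => j jq.
  by rewrite mxE (negbTE jq) andbF mul0r.
move=> i ip; rewrite mxE big1// => j _.
by rewrite mxE (negbTE ip) mul0r.
Qed.

Lemma mxtrace_coupling n (p q : 'I_n) (s t : R) (M : 'M[R]_n) :
  \tr (coupling p q s t *m M) = s * (M p p + M q q) + t * (M q p + M p q).
Proof.
by rewrite mulmxDl -!scalemxAl !mulmxDl mxtraceD !mxtraceZ !mxtraceD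
  !mxtrace_delta_mul.
Qed.

Lemma qform_delta n (p q : 'I_n) (v : 'rV[R]_n) :
  (v *m delta_mx p q *m v^T) 0 0 = v 0 p * v 0 q.
Proof.
rewrite mxE (bigD1 q)//= big1 ?addr0.
  rewrite !mxE (bigD1 p)//= big1 ?addr0 ?mxE ?eqxx ?mulr1//.
  by move=> j jp; rewrite mxE (negbTE jp) mulr0.
by move=> j jq; rewrite !mxE big1 ?mul0r// => i _; rewrite mxE (negbTE jq) andbF mulr0.
Qed.

Lemma coupling_psd n (p q : 'I_n) (s t : R) : `|t| <= s ->
  forall v : 'rV[R]_n, 0 <= (v *m coupling p q s t *m v^T) 0 0.
Proof.
move=> ts v.
rewrite mulmxDr mulmxDl -!scalemxAr -!scalemxAl !mulmxDr !mulmxDl.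
rewrite mxE [X in X + _]mxE [X in _ + X]mxE.
rewrite [in X in s * X]mxE [in X in t * X]mxE !qform_delta.
move: ts; rewrite ler_norml => /andP[t1 t2].
have [h|h] := lerP 0 (v 0 p * v 0 q).
  have : - s * (v 0 p * v 0 q) <= t * (v 0 p * v 0 q) by rewrite ler_wpM2r.
  have := mulr_ge0 (le_trans (normr_ge0 t) _) (sqr_ge0 (v 0 p - v 0 q)).
  move=> /(_ s); rewrite ler_norml t1 t2 => /(_ isT); lra.
have : s * (v 0 p * v 0 q) <= t * (v 0 p * v 0 q) by rewrite ler_wnM2r// ltW.
have := mulr_ge0 (le_trans (normr_ge0 t) _) (sqr_ge0 (v 0 p + v 0 q)).
move=> /(_ s); rewrite ler_norml t1 t2 => /(_ isT); lra.
Qed.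

(** [cut] erases the off-diagonal entry between the sites p and p + 1; this has
    no sign as a perturbation. Raising in addition the two diagonal entries by
    the absolute value of what was erased gives a matrix that dominates both the
    original one and the cut one. *)
Definition cut p (b : nat -> R) i := if i == p then 0 else b i.
Definition raise p (b a : nat -> R) i :=
  if (i == p) || (i == p.+1) then a i + `|b p| else a i.

Section Cut.
Variables (n : nat) (a b : nat -> R) (p : nat) (pn : (p.+1 < n)%N).
Let T := tridiag n a b.
Let T0 := tridiag n a (cut p b).
Let C := tridiag n (raise p b a) (cut p b).
Let P := Ordinal (ltnW pn).
Let Q := Ordinal pn.

Let pp1 : (p == p.+1) = false. Proof. by rewrite ltn_eqF. Qed.
Let p1p : (p.+1 == p) = false. Proof. by rewrite gtn_eqF. Qed.

Lemma raise_subE : C - T = coupling P Q `|b p| (- b p).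
Proof.
apply/matrixP => i j; rewrite !mxE /raise /cut -!val_eqE/=.
move: (nat_of_ord i) (nat_of_ord j) => {}i {}j.
have [<-{j}|ij] := eqVneq i j.
  have [->|ip] /= := eqVneq i p; first by rewrite pp1/=; ring.
  by have [->|iq] /= := eqVneq i p.+1; ring.
have [->{i ij}|ij1] := eqVneq i j.+1.
  rewrite eqSS; have [->|jp] /= := eqVneq j p; first by rewrite ?eqxx ?p1p ?pp1/=; ring.
  rewrite andbF (_ : (j.+1 == p) && (j == p.+1) = false)/=; first by ring.
  by apply/negP => /andP[/eqP <-]; rewrite ltn_eqF.
have [->{j ij ij1}|ji1] := eqVneq j i.+1.
  rewrite eqSS; have [->|ip] /= := eqVneq i p; first by rewrite ?eqxx ?p1p ?pp1/=; ring.
  rewrite andbF (_ : (i == p.+1) && (i.+1 == p) = false)/=; first by ring.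
  by apply/negP => /andP[/[swap]/eqP <-]; rewrite ltn_eqF.
rewrite (_ : (i == p) && (j == p) = false); last first.
  by apply/negP => /andP[/eqP ip /eqP jp]; rewrite ip jp eqxx in ij.
rewrite (_ : (i == p.+1) && (j == p.+1) = false); last first.
  by apply/negP => /andP[/eqP ip /eqP jp]; rewrite ip jp eqxx in ij.
rewrite (_ : (i == p) && (j == p.+1) = false); last first.
  by apply/negP => /andP[/eqP ip /eqP jp]; rewrite ip jp eqxx in ji1.
rewrite (_ : (i == p.+1) && (j == p) = false); last first.
  by apply/negP => /andP[/eqP ip /eqP jp]; rewrite ip jp eqxx in ij1.
by rewrite /=; ring.
Qed.

Lemma raise_sub_cutE : C - T0 = coupling P Q `|b p| 0.
Proof.
apply/matrixP => i j; rewrite !mxE /raise /cut -!val_eqE/=.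
move: (nat_of_ord i) (nat_of_ord j) => {}i {}j.
have [<-{j}|ij] := eqVneq i j.
  have [->|ip] /= := eqVneq i p; first by rewrite pp1/=; ring.
  by have [->|iq] /= := eqVneq i p.+1; ring.
rewrite (_ : (i == p) && (j == p) = false); last first.
  by apply/negP => /andP[/eqP ip /eqP jp]; rewrite ip jp eqxx in ij.
rewrite (_ : (i == p.+1) && (j == p.+1) = false); last first.
  by apply/negP => /andP[/eqP ip /eqP jp]; rewrite ip jp eqxx in ij.
by rewrite /=; ring.
Qed.

(** [C] dominates [T] and [T0], hence the statistics of both are close to that
    of [C] in terms of traces of powers, which are polynomials in the entries. *)
Lemma trf_cut_le f c r : dominated_increments f (fun x => c * (x + x ^+ r)) ->
  `|trf f T - trf f T0| <=
   c * ((\tr C - \tr T) + (\tr (C ^+ r) - \tr (T ^+ r)) +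
        ((\tr C - \tr T0) + (\tr (C ^+ r) - \tr (T0 ^+ r)))).
Proof.
move=> fphi.
have trphi (M : 'M[R]_n) : M^T = M ->
    trf (fun x => c * (x + x ^+ r)) M = c * (\tr M + \tr (M ^+ r)).
  move=> sM; rewrite trfZ trfD (trf_expr r sM).
  congr (_ * (_ + _)); rewrite -[in RHS](expr1 M) -(trf_expr 1 sM).
  by apply: eq_bigr => x _; rewrite expr1.
have := trf_increment_le (tridiag_sym n a b)
  (tridiag_sym n (raise p b a) (cut p b)) _ fphi.
rewrite -/T -/C raise_subE => /(_ (@coupling_psd _ _ _ _ _ _)).
rewrite normrN lexx => /(_ isT).
have := trf_increment_le (tridiag_sym n a (cut p b))
  (tridiag_sym n (raise p b a) (cut p b)) _ fphi.
rewrite -/T0 -/C raise_sub_cutE => /(_ (@coupling_psd _ _ _ _ _ _)).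
rewrite normr0 normr_ge0 => /(_ isT).
rewrite !trphi ?tridiag_sym//.
move: (trf f C) (trf f T) (trf f T0) => x y z h1 h2.
rewrite (le_trans (ler_distD x y z))// distrC; lra.
Qed.

End Cut.

(** The eigenvalues are bounded by the Hilbert-Schmidt norm. *)
Lemma trf_growth f c k n (A : 'M[R]_n) : A^T = A ->
  (forall x, `|f x| <= c * (1 + x ^+ (2 * k))) -> 0 <= c ->
  `|trf f A| <= c * n%:R * (1 + (\sum_i \sum_j A i j ^+ 2) ^+ k).
Proof.
move=> sA fk c0; apply: le_trans (ler_norm_sum _ _ _) _.
have tr2 : \sum_(x <- eigenvalues A) x ^+ 2 = \sum_i \sum_j A i j ^+ 2.
  have := trf_expr 2 sA; rewrite /trf => ->.
  rewrite /mxtrace; apply: eq_bigr => i _; rewrite expr2 mxE.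
  by apply: eq_bigr => j _; rewrite -[in X in _ * X]sA mxE.
have -> : c * n%:R * (1 + (\sum_i \sum_j A i j ^+ 2) ^+ k) =
    \sum_(x <- eigenvalues A) c * (1 + (\sum_i \sum_j A i j ^+ 2) ^+ k).
  by rewrite big_const_seq count_predT size_eigenvalues// iter_addr_0 -mulr_natr; ring.
rewrite big_seq [leRHS]big_seq; apply: ler_sum => x xA.
apply: le_trans (fk x) _; rewrite ler_wpM2l// lerD2l exprM.
apply: lerXn2r; rewrite ?nnegrE ?sqr_ge0//.
  by apply: sumr_ge0 => i _; apply: sumr_ge0 => j _; exact: sqr_ge0.
rewrite -tr2 (big_rem x)//= lerDl.
by apply: sumr_ge0 => y _; exact: sqr_ge0.
Qed.

End Perturbation.

(** * Uniform control of all moments *)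

Section Moments.
Context d (T : measurableType d) (R : realType) (P : probability T R).
Implicit Types (X Y : T -> R) (C D : nat -> R).

Definition Ex X : R := \int[P]_w X w.

(** Bounds on all absolute moments at once. The sequence [C] is kept explicit,
    rather than hidden under an existential, because the point of the estimates
    below is that it does not depend on the size of the matrix. *)
Definition moments_le C X := measurable_fun setT X /\
  forall r, (\int[P]_w (`|X w| ^+ r)%:E <= (C r)%:E)%E.

Lemma measurable_abs_expr X r : measurable_fun setT X ->
  measurable_fun setT (fun w => (`|X w| ^+ r : R)%:E).
Proof.
move=> mX; apply/measurable_EFinP; apply: measurable_funX.
exact: measurableT_comp.
Qed.

Lemma moments_le_integrable C X : moments_le C X -> P.-integrable setT (EFin \o X).
Proof.
move=> [mX CX]; apply/integrableP; split; first exact/measurable_EFinP.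
apply: le_lt_trans (ltry (C 1%N)); apply: le_trans (CX 1%N).
by under [leRHS]eq_integral do rewrite expr1.
Qed.

Lemma moments_le_ge0 C X r : moments_le C X -> 0 <= C r.
Proof.
move=> [mX CX]; rewrite -lee_fin; apply: le_trans (CX r).
by apply: integral_ge0 => w _; rewrite lee_fin exprn_ge0.
Qed.

Lemma moments_le_norm C X Y : measurable_fun setT X ->
  (forall w, `|X w| <= `|Y w|) -> moments_le C Y -> moments_le C X.
Proof.
move=> mX XY [mY CY]; split => // r; apply: le_trans (CY r).
apply: ge0_le_integral => //; try by move=> w _; rewrite lee_fin exprn_ge0.
- exact: measurable_abs_expr.
- exact: measurable_abs_expr.
- by move=> w _; rewrite lee_fin lerXn2r ?nnegrE.
Qed.

(** The next operations on sequences of bounds mirror the sum, the product and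
    the constants; the product costs moments of twice the order, by the
    inequality between the arithmetic and the geometric mean. *)
Definition addC C D r : R := 2 ^+ r * (C r + D r).
Definition mulC C D r : R := C (2 * r)%N + D (2 * r)%N.
Definition cstC (c : R) (r : nat) : R := `|c| ^+ r.

Lemma moments_le_cst (c : R) : moments_le (cstC c) (fun=> c).
Proof.
split=> // r; rewrite integral_cst//.
apply: (@le_trans _ _ ((`|c| ^+ r)%:E * 1)%E); last by rewrite mule1.
by apply: lee_wpmul2l; [rewrite lee_fin exprn_ge0|exact: probability_le1].
Qed.

Lemma normD_expr_le (x y : R) r :
  `|x + y| ^+ r <= 2 ^+ r * (`|x| ^+ r + `|y| ^+ r).
Proof.
have le (u v : R) : `|u| <= `|v| -> `|u + v| ^+ r <= 2 ^+ r * `|v| ^+ r.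
  move=> uv; rewrite -exprMn lerXn2r ?nnegrE// ?mulr_ge0//.
  by rewrite (le_trans (ler_normD _ _))//; lra.
have [xy|yx] := leP `|x| `|y|.
  by apply: le_trans (le _ _ xy) _; rewrite ler_wpM2l ?exprn_ge0// lerDr exprn_ge0.
rewrite addrC; apply: le_trans (le _ _ (ltW yx)) _.
by rewrite ler_wpM2l ?exprn_ge0// lerDl exprn_ge0.
Qed.

Lemma moments_leD C D X Y : moments_le C X -> moments_le D Y ->
  moments_le (addC C D) (fun w => X w + Y w).
Proof.
move=> [mX CX] [mY CY]; split; first exact: measurable_funD.
move=> r; rewrite /addC EFinM EFinD.
apply: (@le_trans _ _ (\int[P]_w ((2 ^+ r)%:E * ((`|X w| ^+ r)%:E + (`|Y w| ^+ r)%:E)))%E).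
  apply: ge0_le_integral => //; try by move=> w _; rewrite lee_fin exprn_ge0.
  - by apply: measurable_abs_expr; exact: measurable_funD.
  - by apply: measurable_funeM; apply: emeasurable_funD; exact: measurable_abs_expr.
  - by move=> w _; rewrite -EFinD -EFinM lee_fin normD_expr_le.
rewrite ge0_integralZl//;
  try by [apply: emeasurable_funD; exact: measurable_abs_expr
         |move=> w _; rewrite adde_ge0// lee_fin exprn_ge0
         |rewrite lee_fin exprn_ge0].
rewrite lee_wpmul2l ?lee_fin ?exprn_ge0//.
rewrite ge0_integralD//; first exact: leeD;
  by [exact: measurable_abs_expr|move=> w _; rewrite lee_fin exprn_ge0].
Qed.

Lemma moments_leM C D X Y : moments_le C X -> moments_le D Y ->
  moments_le (mulC C D) (fun w => X w * Y w).
Proof.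
move=> [mX CX] [mY CY]; split; first exact: measurable_funM.
move=> r; rewrite /mulC EFinD.
apply: (@le_trans _ _ (\int[P]_w ((`|X w| ^+ (2 * r))%:E + (`|Y w| ^+ (2 * r))%:E))%E).
  apply: ge0_le_integral => //; try by move=> w _; rewrite lee_fin exprn_ge0.
  - by apply: measurable_abs_expr; exact: measurable_funM.
  - by apply: emeasurable_funD; exact: measurable_abs_expr.
  - move=> w _; rewrite -EFinD lee_fin normrM exprMn mulnC !exprM.
    have := sqr_ge0 (`|X w| ^+ r - `|Y w| ^+ r).
    have : 0 <= `|X w| ^+ r * `|Y w| ^+ r by rewrite mulr_ge0 ?exprn_ge0.
    by move: (`|X w| ^+ r) (`|Y w| ^+ r) => u v; nra.
rewrite ge0_integralD//; first exact: leeD;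
  by [exact: measurable_abs_expr|move=> w _; rewrite lee_fin exprn_ge0].
Qed.

Lemma moments_leN C X : moments_le C X -> moments_le C (fun w => - X w).
Proof.
move=> CX; apply: moments_le_norm (CX); last by move=> w; rewrite normrN.
by apply: measurableT_comp => //; case: CX.
Qed.

Lemma moments_leW C D X : moments_le C X -> (forall r, C r <= D r) ->
  moments_le D X.
Proof.
by move=> [mX CX] CD; split => // r; rewrite (le_trans (CX r))// lee_fin.
Qed.

(** When the bounds are irrelevant: an algebra of variables on which the
    expectation is linear without side conditions on integrability. *)
Definition all_moments X := exists C, moments_le C X.

Lemma amI C X : moments_le C X -> all_moments X. Proof. by exists C. Qed.

Lemma amD X Y : all_moments X -> all_moments Y -> all_moments (fun w => X w + Y w).
Proof. by move=> [C XC] [D YD]; eexists; exact: moments_leD XC YD. Qed.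

Lemma amM X Y : all_moments X -> all_moments Y -> all_moments (fun w => X w * Y w).
Proof. by move=> [C XC] [D YD]; eexists; exact: moments_leM XC YD. Qed.

Lemma amN X : all_moments X -> all_moments (fun w => - X w).
Proof. by move=> [C XC]; eexists; exact: moments_leN XC. Qed.

Lemma amB X Y : all_moments X -> all_moments Y -> all_moments (fun w => X w - Y w).
Proof. by move=> X1 X2; apply: amD => //; exact: amN. Qed.

Lemma am_cst (c : R) : all_moments (fun=> c).
Proof. by eexists; exact: moments_le_cst. Qed.

Lemma amX X k : all_moments X -> all_moments (fun w => X w ^+ k).
Proof.
move=> X1; elim: k => [|k IH]; first exact: am_cst.
by under eq_fun do rewrite exprS; exact: amM.
Qed.

Lemma sum_cons_fun (I : Type) (i : I) s (p : pred I) (F : I -> T -> R) :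
  (fun w => \sum_(j <- i :: s | p j) F j w) =
  if p i then (fun w => F i w + \sum_(j <- s | p j) F j w)
  else (fun w => \sum_(j <- s | p j) F j w).
Proof. by apply/funext => w; rewrite big_cons; case: ifP. Qed.

Lemma am_sum (I : Type) (s : seq I) (p : pred I) (F : I -> T -> R) :
  (forall i, p i -> all_moments (F i)) -> all_moments (fun w => \sum_(i <- s | p i) F i w).
Proof.
move=> H; elim: s => [|i s IH].
  by under eq_fun do rewrite big_nil; exact: am_cst.
rewrite sum_cons_fun; case: ifPn => pi; last exact: IH.
by apply: amD => //; exact: H.
Qed.

Lemma am_norm X : all_moments X -> all_moments (fun w => `|X w|).
Proof.
move=> [C XC]; exists C; apply: moments_le_norm (XC) => [|w]; last by rewrite normr_id.
by apply: measurableT_comp => //; case: XC.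
Qed.

Lemma am_bounded X M : measurable_fun setT X -> (forall w, `|X w| <= M) ->
  all_moments X.
Proof.
move=> mX XM; exists (cstC M); apply: (moments_le_norm mX _ (moments_le_cst M)).
by move=> w; rewrite (le_trans (XM w)) ?ler_norm.
Qed.

Lemma am_measurable X : all_moments X -> measurable_fun setT X.
Proof. by move=> [C []]. Qed.

Lemma am_integrable X : all_moments X -> P.-integrable setT (EFin \o X).
Proof. by move=> [C]; exact: moments_le_integrable. Qed.

Lemma ExD X Y : all_moments X -> all_moments Y ->
  Ex (fun w => X w + Y w) = Ex X + Ex Y.
Proof. by move=> *; apply: RintegralD => //; exact: am_integrable. Qed.

Lemma ExB X Y : all_moments X -> all_moments Y ->
  Ex (fun w => X w - Y w) = Ex X - Ex Y.
Proof. by move=> *; apply: RintegralB => //; exact: am_integrable. Qed.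

Lemma ExZ (c : R) X : all_moments X -> Ex (fun w => c * X w) = c * Ex X.
Proof. by move=> *; apply: RintegralZl => //; exact: am_integrable. Qed.

Lemma Ex_cst (c : R) : Ex (fun=> c) = c.
Proof. rewrite /Ex Rintegral_cst//; transitivity (c * fine (1 : \bar R)); last by rewrite mulr1.
by congr (c * fine _); exact: probability_setT. Qed.

Lemma Ex_sum (I : Type) (s : seq I) (p : pred I) (F : I -> T -> R) :
  (forall i, p i -> all_moments (F i)) ->
  Ex (fun w => \sum_(i <- s | p i) F i w) = \sum_(i <- s | p i) Ex (F i).
Proof.
move=> H; elim: s => [|i s IH].
  by under [in LHS]eq_fun do rewrite big_nil; rewrite big_nil Ex_cst.
rewrite sum_cons_fun big_cons; case: ifPn => pi //.
by rewrite ExD ?IH//; [exact: H|exact: am_sum].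
Qed.

Lemma le_Ex X Y : all_moments X -> all_moments Y -> (forall w, X w <= Y w) ->
  Ex X <= Ex Y.
Proof. by move=> *; apply: le_Rintegral => //; exact: am_integrable. Qed.

Lemma Ex_ge0 X : (forall w, 0 <= X w) -> 0 <= Ex X.
Proof. by move=> X0; apply: Rintegral_ge0. Qed.

Lemma norm_Ex X : all_moments X -> `|Ex X| <= Ex (fun w => `|X w|).
Proof. by move=> *; apply: le_normr_Rintegral => //; exact: am_integrable. Qed.

Lemma eq_Ex X Y : X =1 Y -> Ex X = Ex Y.
Proof. by move=> XY; apply: eq_Rintegral => w _. Qed.

Lemma moments_le_Ex C X r : moments_le C X -> Ex (fun w => `|X w| ^+ r) <= C r.
Proof.
move=> CX; have [mX XC] := CX.
rewrite -lee_fin /Ex /Rintegral fineK ?XC//.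
have : all_moments (fun w => `|X w| ^+ r) by apply/amX/am_norm/amI/CX.
by move=> /am_integrable/integrable_fin_num => /(_ measurableT).
Qed.

Lemma Ex_EFin X : all_moments X -> (\int[P]_w (X w)%:E = (Ex X)%:E)%E.
Proof.
move=> aX; rewrite /Ex /Rintegral fineK//.
by have /integrable_fin_num := am_integrable aX => /(_ measurableT).
Qed.

(** The triangle inequality in L2: the weights 1 + y / x and 1 + x / y are those
    for which the pointwise convexity bound is sharp at the given norms. *)
Lemma L2_add X Y (x y : R) : all_moments X -> all_moments Y ->
  0 < x -> 0 < y ->
  Ex (fun w => X w ^+ 2) <= x ^+ 2 -> Ex (fun w => Y w ^+ 2) <= y ^+ 2 ->
  Ex (fun w => (X w + Y w) ^+ 2) <= (x + y) ^+ 2.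
Proof.
move=> aX aY x0 y0 Xx Yy.
have aX2 := amX 2 aX. have aY2 := amX 2 aY.
apply: (@le_trans _ _ ((1 + y / x) * Ex (fun w => X w ^+ 2) +
                       (1 + x / y) * Ex (fun w => Y w ^+ 2))).
  rewrite -!ExZ// -ExD//; [|exact: amM (am_cst _) _..].
  apply: le_Ex.
  - by apply: amX; exact: amD.
  - by apply: amD; apply: amM => //; exact: am_cst.
  - move=> w; rewrite -subr_ge0.
    have -> : (1 + y / x) * X w ^+ 2 + (1 + x / y) * Y w ^+ 2 - (X w + Y w) ^+ 2 =
      (y * X w - x * Y w) ^+ 2 / (x * y) by field; rewrite ?gt_eqF.
    by rewrite divr_ge0 ?sqr_ge0// mulr_ge0 ?ltW.
have -> : (x + y) ^+ 2 = (1 + y / x) * x ^+ 2 + (1 + x / y) * y ^+ 2.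
  by field; rewrite ?gt_eqF.
by apply: lerD; rewrite ler_wpM2l// addr_ge0// divr_ge0 ?ltW.
Qed.

Lemma Ex_norm_le X (x : R) : all_moments X -> 0 < x ->
  Ex (fun w => X w ^+ 2) <= x ^+ 2 -> Ex (fun w => `|X w|) <= x.
Proof.
move=> aX x0 Xx.
have aX2 := amX 2 aX.
apply: (@le_trans _ _ (Ex (fun w => x / 2 + (2 * x)^-1 * X w ^+ 2))).
  apply: le_Ex; [exact: am_norm|by apply: amD; [exact: am_cst|exact: amM (am_cst _) _]|].
  move=> w; rewrite -subr_ge0 -[X w ^+ 2]real_normK ?num_real//.
  have -> : x / 2 + (2 * x)^-1 * `|X w| ^+ 2 - `|X w| =
    (`|X w| - x) ^+ 2 / (2 * x) by field; rewrite ?gt_eqF.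
  by rewrite divr_ge0 ?sqr_ge0// mulr_ge0 ?ltW.
rewrite ExD; [|exact: am_cst|exact: amM (am_cst _) aX2].
rewrite Ex_cst ExZ//.
rewrite -lerBrDl; apply: (@le_trans _ _ ((2 * x)^-1 * x ^+ 2)).
  by rewrite ler_wpM2l// invr_ge0 mulr_ge0 ?ltW.
by rewrite le_eqVlt; apply/orP; left; apply/eqP; field; rewrite ?gt_eqF.
Qed.

End Moments.

(** * Weierstrass approximation *)

Section Weierstrass.
Variable R : realType.
Implicit Types (f g : R -> R) (h : nat -> R).

Lemma segment_unif_continuous f (a b e : R) : continuous f -> 0 < e ->
  exists2 d, 0 < d & forall x y, a <= x <= b -> `|y - x| < d -> `|f y - f x| < e.
Proof.
move=> cf e0.
have /compact_near_coveringP cov := @segment_compact R a b.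
pose Pr (d x : R) := forall y, `|y - x| < d -> `|f y - f x| < e.
have : \forall d \near 0^'+, `[a, b] `<=` Pr d.
  apply: cov => x _.
  have /cvgrPdist_lt/(_ (e / 2)) := cf x; rewrite divr_gt0// => /(_ isT).
  move=> [d /= d0 dP].
  exists (ball x (d / 2), [set r : R | r < d / 2]).
    split => /=; first by apply: nbhsx_ballx; rewrite divr_gt0.
    by apply: nbhs_right_lt; rewrite divr_gt0.
  move=> [x' r] /= [xx' rd] y yx'.
  have fx' : `|f x - f x'| < e / 2.
    by apply: dP => /=; apply: lt_trans xx' _; lra.
  have fy : `|f x - f y| < e / 2.
    apply: dP => /=; rewrite (le_lt_trans (ler_distD x' _ _))//.
    by rewrite (distrC x' y); move: xx' => /=; rewrite /ball/=; lra.
  by rewrite (le_lt_trans (ler_distD (f x) _ _))// distrC; lra.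
move=> [d /= d0 dP]; exists (d / 2); first by rewrite divr_gt0.
move=> x y xab yx.
apply: (dP (d / 2)) => //=; rewrite ?divr_gt0//.
by rewrite sub0r normrN gtr0_norm ?divr_gt0//; lra.
Qed.

Lemma segment_bounded f (a b : R) : continuous f ->
  exists M, forall x, a <= x <= b -> `|f x| <= M.
Proof.
move=> cf; have [ab|ba] := leP a b; last first.
  by exists 0 => x /andP[ax xb]; have := le_trans ax xb; rewrite leNgt ba.
have [c _ cP] : exists2 c, c \in `[a, b] & forall t, t \in `[a, b] -> `|f t| <= `|f c|.
  apply: (@EVT_max R (fun x => `|f x|)) => //.
  apply: continuous_subspaceT => x.
  by apply: cvg_norm; exact: cf.
by exists `|f c| => x xab; apply: cP; rewrite in_itv.
Qed.

(** For [s] = 0, the Bernstein polynomial of [h]: the mean of [h] at the end of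
    a walk from [s] whose [n] independent steps are 1 with probability the
    indeterminate and 0 otherwise. The recursion on the first step makes
    positivity and the second moment immediate inductions. *)
Fixpoint bernstein_walk (h : nat -> R) (n s : nat) : {poly R} :=
  if n is m.+1 then 'X * bernstein_walk h m s.+1 + (1 - 'X) * bernstein_walk h m s
  else (h s)%:P.

Let bw := bernstein_walk.

Lemma bernstein_walkS h n s x : (bw h n.+1 s).[x] =
  x * (bw h n s.+1).[x] + (1 - x) * (bw h n s).[x].
Proof. by rewrite /= !hornerE. Qed.

Lemma bernstein_walk_le h1 h2 n s x : 0 <= x <= 1 -> (forall k, h1 k <= h2 k) ->
  (bw h1 n s).[x] <= (bw h2 n s).[x].
Proof.
move=> /andP[x0 x1] h12; elim: n s => [|n IH] s; first by rewrite /= !hornerC.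
by rewrite !bernstein_walkS lerD// ler_wpM2l// subr_ge0.
Qed.

Lemma bernstein_walk_lin h1 h2 c n s x :
  (bw (fun k => h1 k + c * h2 k) n s).[x] = (bw h1 n s).[x] + c * (bw h2 n s).[x].
Proof.
elim: n s => [|n IH] s; first by rewrite /= !hornerC.
by rewrite !bernstein_walkS !IH; ring.
Qed.

Lemma bernstein_walk_cst c n s x : (bw (fun=> c) n s).[x] = c.
Proof.
elim: n s => [|n IH] s; first by rewrite /= hornerC.
by rewrite !bernstein_walkS !IH; ring.
Qed.

Lemma bernstein_walk_variance c n s x :
  (bw (fun k => (k%:R - c) ^+ 2) n s).[x] =
  (s%:R + n%:R * x - c) ^+ 2 + n%:R * x * (1 - x).
Proof.
elim: n s => [|n IH] s; first by rewrite /= hornerC; ring.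
by rewrite bernstein_walkS !IH -!natr1; ring.
Qed.

(** The quadratic majorant of the oscillation of [g] is averaged by the walk,
    whose variance is of order 1 / n after rescaling. The function is constant
    outside the unit interval so that it has global bounds. *)
Lemma bernstein_approximation g (e : R) : continuous g -> 0 < e ->
  (forall x, x <= 0 -> g x = g 0) -> (forall x, 1 <= x -> g x = g 1) ->
  exists p : {poly R}, forall x, 0 <= x <= 1 -> `|g x - p.[x]| <= e.
Proof.
move=> cg e0 gl gr.
have e20 : 0 < e / 2 by rewrite divr_gt0.
have [d d0 gd] := segment_unif_continuous 0 1 cg e20.
have [M gM] := segment_bounded 0 1 cg.
have {}gM x : `|g x| <= M.
  have [x0|x0] := leP x 0; first by rewrite gl// gM// lexx ler01.
  have [x1|x1] := leP 1 x; first by rewrite gr// gM// lexx ler01.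
  by rewrite gM// !ltW.
have M0 : 0 <= M := le_trans (normr_ge0 _) (gM 0).
pose c := 2 * M / d ^+ 2.
have c0 : 0 <= c by rewrite divr_ge0 ?sqr_ge0// mulr_ge0.
have gc x y : 0 <= x <= 1 -> `|g y - g x| <= e / 2 + c * (y - x) ^+ 2.
  move=> x01; have [yx|yx] := ltP `|y - x| d.
    by rewrite (le_trans (ltW (gd _ _ x01 yx)))// lerDl mulr_ge0// sqr_ge0.
  rewrite (@le_trans _ _ (2 * M))//.
    by rewrite (le_trans (ler_normB _ _))//; have := gM x; have := gM y; lra.
  rewrite ler_wpDl//; first exact: ltW.
  have -> : c * (y - x) ^+ 2 = 2 * M * ((y - x) ^+ 2 / d ^+ 2) by rewrite /c; ring.
  rewrite ler_peMr ?mulr_ge0// ler_pdivlMr ?exprn_gt0// mul1r.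
  by rewrite -[leRHS]real_normK ?num_real// lerXn2r ?nnegrE//; exact: ltW.
pose n := (Num.truncn (c / (e / 2))).+1.
have n0 : 0 < n%:R :> R by rewrite ltr0n.
have nc : c / n%:R <= e / 2.
  rewrite ler_pdivrMr// mulrC -ler_pdivrMr//.
  by have /andP[_ /ltW] := truncn_itv (divr_ge0 c0 (ltW e20)).
exists (bw (fun k => g (k%:R / n%:R)) n 0) => x x01.
have main s : s = 1 \/ s = -1 ->
    s * ((bw (fun k => g (k%:R / n%:R)) n 0).[x] - g x) <= e.
  move=> s1.
  have -> : s * ((bw (fun k => g (k%:R / n%:R)) n 0).[x] - g x) =
      (bw (fun k => - s * g x + s * g (k%:R / n%:R)) n 0).[x].
    by rewrite bernstein_walk_lin bernstein_walk_cst; ring.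
  apply: (@le_trans _ _
     (bw (fun k => e / 2 + (c / n%:R ^+ 2) * (k%:R - n%:R * x) ^+ 2) n 0).[x]).
    apply: bernstein_walk_le => // k.
    apply: (@le_trans _ _ `|g (k%:R / n%:R) - g x|).
      have -> : - s * g x + s * g (k%:R / n%:R) = s * (g (k%:R / n%:R) - g x) by ring.
      by case: s1 => ->; rewrite ?mul1r ?ler_norm// mulN1r -normrN ler_norm.
    apply: le_trans (gc _ _ x01) _; rewrite lerD2l.
    rewrite le_eqVlt; apply/orP; left; apply/eqP; field; exact: lt0r_neq0.
  rewrite bernstein_walk_lin bernstein_walk_cst bernstein_walk_variance add0r subrr.
  have : c / n%:R ^+ 2 * (n%:R * x * (1 - x)) <= c / n%:R.
    have -> : c / n%:R ^+ 2 * (n%:R * x * (1 - x)) = c / n%:R * (x * (1 - x)).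
      by field; exact: lt0r_neq0.
    by rewrite ler_piMr//; [exact: divr_ge0 (ltW n0)|case/andP: x01 => *; nra].
  rewrite expr0n/= add0r; lra.
rewrite distrC ler_norml; apply/andP; split.
  by have := main (-1) (or_intror erefl); lra.
by have := main 1 (or_introl erefl); lra.
Qed.

(** Weierstrass approximation, after clamping the function outside the segment
    and rescaling it to the unit interval. *)
Lemma weierstrass f (m e : R) : continuous f -> 0 < m -> 0 < e ->
  exists p : {poly R}, forall x, `|x| <= m -> `|f x - p.[x]| <= e.
Proof.
move=> cf m0 e0.
pose clamp (t : R) := Num.min (Num.max t 0) 1.
pose g t := f (- m + 2 * m * clamp t).
have cc : continuous clamp.
  move=> t; apply: (@continuous_min _ _ (fun t : R => Num.max t 0) (fun=> 1)).
    apply: (@continuous_max _ _ (fun t : R => t) (fun=> 0)); first exact: cvg_id.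
    exact: cvg_cst.
  exact: cvg_cst.
have cg : continuous g.
  move=> t; apply: (@continuous_comp _ _ _ (fun t => - m + 2 * m * clamp t) f).
    by apply: cvgD; [exact: cvg_cst|apply: cvgM; [exact: cvg_cst|exact: cc]].
  exact: cf.
have [||p pP] := bernstein_approximation cg e0.
- move=> x x0; rewrite /g /clamp; congr (f (_ + _ * Num.min _ _)).
  by rewrite maxxx; apply/max_idPr.
- move=> x x1; rewrite /g /clamp; congr (f (_ + _ * _)).
  have -> : Num.max x 0 = x by apply/max_idPl; lra.
  have -> : Num.max 1 0 = 1 :> R by apply/max_idPl; lra.
  by rewrite minxx; apply/min_idPr.
exists (p \Po ((2 * m)^-1%:P * ('X + m%:P))) => x xm.
have := pP ((2 * m)^-1 * (x + m)).
rewrite horner_comp !hornerE.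
have x01 : 0 <= (2 * m)^-1 * (x + m) <= 1.
  move: xm; rewrite ler_norml => /andP[x1 x2].
  rewrite mulrC divr_ge0/=; [|lra|by rewrite mulr_ge0// ltW].
  by rewrite ler_pdivrMr ?mulr_gt0//; lra.
move=> /(_ x01); rewrite /g /clamp.
case/andP: x01 => x1 x2.
have -> : Num.max ((2 * m)^-1 * (x + m)) 0 = (2 * m)^-1 * (x + m) by apply/max_idPl.
have -> : Num.min ((2 * m)^-1 * (x + m)) 1 = (2 * m)^-1 * (x + m) by apply/min_idPl.
have -> // : - m + 2 * m * ((2 * m)^-1 * (x + m)) = x.
by field; exact: lt0r_neq0.
Qed.

End Weierstrass.

(** * Statistics of Jacobi matrices *)

Section MeasurableTrace.
Context d (T : measurableType d) (R : realType).

Definition measurable_mx m n (A : T -> 'M[R]_(m, n)) :=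
  forall i j, measurable_fun setT (fun w => A w i j).

Lemma measurable_mx_expr n (A : T -> 'M[R]_n) k :
  measurable_mx A -> measurable_mx (fun w => A w ^+ k).
Proof.
move=> mA; elim: k => [|k IH] i j.
  by under eq_fun do rewrite mxE; exact: measurable_cst.
under eq_fun do rewrite exprS mxE.
by apply: measurable_sum => l; exact: measurable_funM.
Qed.

Lemma measurable_trf_horner n (A : T -> 'M[R]_n) (p : {poly R}) :
  measurable_mx A -> (forall w, (A w)^T = A w) ->
  measurable_fun setT (fun w => trf (fun x => p.[x]) (A w)).
Proof.
move=> mA sA; under eq_fun do rewrite trf_horner//.
apply: measurable_sum => i; apply: measurable_funM => //.
by apply: measurable_sum => l; exact: measurable_mx_expr.
Qed.

(** Eigenvalues are only chosen, but traces of polynomials are polynomials in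
    the entries; a continuous function is a limit of polynomials on the spectrum
    at each sample point. *)
Lemma measurable_trf n (A : T -> 'M[R]_n) (f : R -> R) : continuous f ->
  measurable_mx A -> (forall w, (A w)^T = A w) ->
  measurable_fun setT (fun w => trf f (A w)).
Proof.
move=> cf mA sA.
have appr (m : nat) : exists p : {poly R},
    forall x, `|x| <= m.+1%:R -> `|f x - p.[x]| <= m.+1%:R^-1.
  by apply: weierstrass => //; rewrite ?invr_gt0 ltr0n.
have [p pP] := choice appr.
apply: (@measurable_fun_cvg _ _ _ setT (fun m w => trf (fun x => (p m).[x]) (A w))) => //.
  by move=> m; exact: measurable_trf_horner.
move=> w _; apply/cvgrPdist_le => e e0.
pose s := eigenvalues (A w).
have : \forall m \near \oo, forall x, x \in s -> `|x| <= m.+1%:R.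
  near=> m => x xs.
  apply: (@le_trans _ _ (\sum_(y <- s) `|y|)).
    by rewrite (big_rem x)//= lerDl sumr_ge0.
  near: m; have [N _ NP] := nbhs_infty_ger (\sum_(y <- s) `|y|).
  by exists N => // m mN; apply: le_trans (NP m mN) _; rewrite ler_nat.
have : \forall m \near \oo, n%:R * m.+1%:R^-1 <= e.
  near=> m.
  rewrite ler_pdivrMr ?ltr0n// -ler_pdivrMl//.
  near: m; have [N _ NP] := nbhs_infty_ger (e^-1 * n%:R).
  by exists N => // m mN; apply: le_trans (NP m mN) _; rewrite ler_nat.
apply: filterS2 => m me ms.
apply: le_trans me.
rewrite /trf -sumrB (le_trans (ler_norm_sum _ _ _))//.
have -> : n%:R * m.+1%:R^-1 = \sum_(x <- s) m.+1%:R^-1 :> R.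
  by rewrite big_const_seq count_predT size_eigenvalues// iter_addr_0 mulr_natl.
rewrite big_seq [leRHS]big_seq; apply: ler_sum => x xs.
by apply: pP; exact: ms.
Unshelve. all: by end_near.
Qed.

(** The sequence [x] lists the entries of a Jacobi matrix site by site, so that
    a stretch of sites is a stretch of the sequence: [x (2 * i)] is the diagonal
    entry of site [i], and [x (2 * i + 1)] couples site [i] with site [i + 1]. *)
Definition jacobi n (x : nat -> R) : 'M[R]_n :=
  tridiag n (fun i => x (2 * i)%N) (fun i => x (2 * i).+1).

Definition jstat f n (x : nat -> R) : R := trf f (jacobi n x).

Lemma measurable_tridiag n (a b : nat -> T -> R) :
  (forall i, measurable_fun setT (a i)) -> (forall i, measurable_fun setT (b i)) ->
  measurable_mx (fun w => tridiag n (a^~ w) (b^~ w)).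
Proof.
move=> ma mb i j; under eq_fun do rewrite mxE.
case: (i == j :> nat); first exact: ma.
case: (i == j.+1 :> nat); first exact: mb.
by case: (j == i.+1 :> nat); [exact: mb|exact: measurable_cst].
Qed.

Lemma measurable_jstat f n (X : nat -> T -> R) : continuous f ->
  (forall i, measurable_fun setT (X i)) ->
  measurable_fun setT (fun w => jstat f n (X^~ w)).
Proof.
move=> cf mX; apply: measurable_trf => // [|w]; last exact: tridiag_sym.
by apply: (@measurable_tridiag _ (fun i => X (2 * i)%N) (fun i => X (2 * i).+1)).
Qed.

End MeasurableTrace.

(** * Size-free bounds on the cost of a cut *)

Section LocalMoments.
Context d (T : measurableType d) (R : realType) (P : probability T R).
Implicit Types (C D : nat -> R).

Definition moments_mx_le C m n (A : T -> 'M[R]_(m, n)) :=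
  forall i j, moments_le P C (fun w => A w i j).

(** Three terms, whatever the size: this is where the tridiagonal shape makes
    moment bounds free of the size. The factors 0 and 1 and the default indices
    take care of the two ends. *)
Lemma tridiag_mulE n (a b : nat -> R) m (M : 'M[R]_(n, m)) i j :
  (tridiag n a b *m M) i j = a i * M i j +
    ((0 < i)%N%:R * b i.-1) * M (insubd i i.-1) j +
    ((i.+1 < n)%N%:R * b i) * M (insubd i i.+1) j.
Proof.
rewrite mxE.
have E (k : 'I_n) : tridiag n a b i k * M k j =
    (k == i)%:R * (a i * M i j) +
    (k == insubd i i.-1)%:R * (((0 < i)%N%:R * b i.-1) * M (insubd i i.-1) j) +
    (k == insubd i i.+1)%:R * (((i.+1 < n)%N%:R * b i) * M (insubd i i.+1) j).
  have pn : (i.-1 < n)%N by rewrite (leq_ltn_trans (leq_pred _)).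
  have e1 : (k == insubd i i.-1) = (k == i.-1 :> nat).
    by rewrite -val_eqE val_insubd pn.
  have e2 : (k == insubd i i.+1) = (k == (if (i.+1 < n)%N then i.+1 else i) :> nat).
    by rewrite -val_eqE val_insubd.
  rewrite mxE; move: e1 e2; have [->|ki] := eqVneq k i => e1 e2.
    rewrite eqxx mul1r e1 e2.
    have -> : (i == i.-1 :> nat)%:R * ((0 < i)%N%:R * b i.-1 * M (insubd i i.-1) j) = 0.
      have [i0|] := posnP i; first by rewrite i0 !mul0r mulr0.
      by move=> i0; rewrite (_ : (i == i.-1 :> nat) = false) ?mul0r//; lia.
    rewrite addr0; case: ifP => _; last by rewrite !mul0r mulr0 addr0.
    by rewrite ltn_eqF// mul0r addr0.
  have nki : (i == k :> nat) = false by rewrite eq_sym val_eqE (negbTE ki).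
  rewrite nki mul0r add0r.
  have [ik|ik] := eqVneq (i : nat) k.+1.
    have ek : k = insubd i i.-1 by apply/eqP; rewrite e1 ik.
    rewrite -ek eqxx ik/= !mul1r (_ : (k == insubd i k.+2) = false) ?mul0r ?addr0//.
    by rewrite -val_eqE val_insubd; case: ifP => _ /=; apply/eqP; lia.
  rewrite (_ : (k == insubd i i.-1)%:R * _ = 0); last first.
    have [i0|i0] := boolP (0 < i)%N; last by rewrite !mul0r mulr0.
    by rewrite e1 (_ : (k == i.-1 :> nat) = false) ?mul0r//; lia.
  rewrite add0r; have [ki1|ki1] := eqVneq (k : nat) i.+1.
    have ek : k = insubd i i.+1 by apply/eqP; rewrite e2 ki1 ifT// -ki1.
    by rewrite -ek eqxx -ki1 ltn_ord !mul1r.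
  rewrite mul0r e2; case: ifP => _; first by rewrite (negbTE ki1) mul0r.
  by rewrite !mul0r mulr0.
under eq_bigr do rewrite E; rewrite !big_split/=.
have one (l : 'I_n) (x : R) : \sum_k (k == l)%:R * x = x.
  by rewrite (bigD1 l)//= eqxx mul1r big1 ?addr0// => k /negbTE ->; rewrite mul0r.
by rewrite !one.
Qed.

Definition triC C D : nat -> R := addC (addC (mulC C D) (mulC C D)) (mulC C D).

Lemma moments_tridiag_mul C D n (a b : nat -> T -> R) m (M : T -> 'M[R]_(n, m)) :
  (forall i, moments_le P C (a i)) -> (forall i, moments_le P C (b i)) ->
  moments_mx_le D M ->
  moments_mx_le (triC C D) (fun w => tridiag n (a^~ w) (b^~ w) *m M w).
Proof.
move=> Ca Cb DM i j; under eq_fun do rewrite tridiag_mulE.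
have Cbb (v : bool) k : moments_le P C (fun w => v%:R * b k w).
  apply: moments_le_norm (Cb k).
    by apply: measurable_funM => //; case: (Cb k).
  by move=> w; rewrite normrM normr_nat; case: v; rewrite ?mul1r ?mul0r.
by apply: moments_leD; [apply: moments_leD|]; apply: moments_leM => //; exact: Cbb.
Qed.

Lemma moments_tridiag_expr_mul C D n (a b : nat -> T -> R) l (M : T -> 'M[R]_n) :
  (forall i, moments_le P C (a i)) -> (forall i, moments_le P C (b i)) ->
  moments_mx_le D M ->
  moments_mx_le (iter l (triC C) D) (fun w => tridiag n (a^~ w) (b^~ w) ^+ l *m M w).
Proof.
move=> Ca Cb DM; elim: l => [|l IH] i j.
  by under eq_fun do rewrite expr0 mul1mx; exact: DM.
under eq_fun do rewrite exprS -mulmxA.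
exact: (moments_tridiag_mul Ca Cb IH).
Qed.

Lemma moments_tridiag_expr C n (a b : nat -> T -> R) l :
  (forall i, moments_le P C (a i)) -> (forall i, moments_le P C (b i)) ->
  moments_mx_le (iter l (triC C) (cstC 1)) (fun w => tridiag n (a^~ w) (b^~ w) ^+ l).
Proof.
move=> Ca Cb i j.
under eq_fun do rewrite -[_ ^+ l]mulmx1.
apply: (moments_tridiag_expr_mul (M := fun=> 1%:M) l Ca Cb) => {}i {}j.
apply: moments_le_norm (moments_le_cst P 1) => // w.
by rewrite mxE normr_nat normr1; case: (i == j).
Qed.

Definition sumC (F : nat -> nat -> R) r : nat -> R :=
  iteri r (fun l acc => addC acc (F l)) (cstC 0).

Lemma moments_le_sum (F : nat -> T -> R) (C : nat -> nat -> R) r :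
  (forall l, (l < r)%N -> moments_le P (C l) (F l)) ->
  moments_le P (sumC C r) (fun w => \sum_(l < r) F l w).
Proof.
elim: r => [|r IH] H.
  by under eq_fun do rewrite big_ord0; exact: moments_le_cst.
under eq_fun do rewrite big_ord_recr/=.
by apply: moments_leD; [apply: IH => l lr; apply: H; exact: ltnW|exact: H].
Qed.

Definition exprdiffC C r : nat -> R :=
  sumC (fun l =>
    let W := iter l (triC C) (iter (r - l.+1) (triC C) (cstC 1)) in
    addC (mulC C (addC W W)) (mulC C (addC W W))) r.

(** The traces of powers of two tridiagonal matrices that differ at a single
    coupling differ by boundedly many entries of products of tridiagonal
    matrices, whence bounds that do not depend on the size. *)
Lemma moments_mxtrace_exprB C n (a b a' b' : nat -> T -> R) (s t : T -> R)
    (p q : 'I_n) r :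
  (forall i, moments_le P C (a i)) -> (forall i, moments_le P C (b i)) ->
  (forall i, moments_le P C (a' i)) -> (forall i, moments_le P C (b' i)) ->
  moments_le P C s -> moments_le P C t ->
  (forall w, tridiag n (a'^~ w) (b'^~ w) - tridiag n (a^~ w) (b^~ w) =
     coupling p q (s w) (t w)) ->
  moments_le P (exprdiffC C r) (fun w =>
    \tr (tridiag n (a'^~ w) (b'^~ w) ^+ r) - \tr (tridiag n (a^~ w) (b^~ w) ^+ r)).
Proof.
move=> Ca Cb Ca' Cb' Cs Ct st.
under eq_fun do rewrite mxtrace_exprB st.
apply: (moments_le_sum (F := fun l w => \tr (coupling p q (s w) (t w) *m
  (tridiag n (a^~ w) (b^~ w) ^+ l *m tridiag n (a'^~ w) (b'^~ w) ^+ (r - l.+1))))).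
move=> l _ /=; under eq_fun do rewrite mxtrace_coupling.
have W := moments_tridiag_expr_mul l Ca Cb
  (@moments_tridiag_expr _ n _ _ (r - l.+1) Ca' Cb').
by apply: moments_leD; apply: moments_leM => //; exact: moments_leD (W _ _) (W _ _).
Qed.

Lemma tridiag_ext n (a b a' b' : nat -> R) :
  (forall i, (i < n)%N -> a i = a' i) ->
  (forall i, (i.+1 < n)%N -> b i = b' i) ->
  tridiag n a b = tridiag n a' b'.
Proof.
move=> aa bb; apply/matrixP => i j; rewrite !mxE.
case: eqP => _; first exact: aa.
case: eqP => [ij|_]; first by apply: bb; rewrite -ij.
by case: eqP => [ji|//]; apply: bb; rewrite -ji.
Qed.

(** The defect of additivity of the statistic. *)
Definition jdefect (f : R -> R) m n (x : nat -> R) : R :=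
  jstat f (m + n) x - (jstat f m x + jstat f n (fun j => x (2 * m + j)%N)).

Lemma jdefect_cut f m n x : (0 < n)%N -> jdefect f m.+1 n x =
  trf f (tridiag (m.+1 + n) (fun i => x (2 * i)%N) (fun i => x (2 * i).+1)) -
  trf f (tridiag (m.+1 + n) (fun i => x (2 * i)%N) (cut m (fun i => x (2 * i).+1))).
Proof.
move=> n0; rewrite /jdefect /jstat /jacobi.
set a := fun i => x (2 * i)%N; set b := fun i => x (2 * i).+1.
rewrite [X in _ = _ - X]trf_tridiag_split; last by move=> i [->]; rewrite /cut eqxx.
have -> : tridiag m.+1 a (cut m b) = tridiag m.+1 a b.
  by apply: tridiag_ext => // i im; rewrite /cut ltn_eqF.
have -> : tridiag n (fun i => a (m.+1 + i)%N) (fun i => cut m b (m.+1 + i)) =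
    tridiag n (fun i => x (2 * m.+1 + 2 * i)%N) (fun i => x (2 * m.+1 + (2 * i).+1)%N).
  apply: tridiag_ext => i _; first by rewrite /a mulnDr.
  by rewrite /cut gtn_eqF ?addSn ?ltnS ?leq_addr// /b mulnDr addnS.
by [].
Qed.

Lemma jdefect0l f n x : jdefect f 0 n x = 0.
Proof.
rewrite /jdefect add0n /jstat.
rewrite (_ : trf f (jacobi 0 x) = 0); last first.
  by rewrite /trf (size0nil (size_eigenvalues (tridiag_sym 0 _ _))) big_nil.
by rewrite add0r (_ : (fun j => _) = x) ?subrr//; apply/funext => j; congr x; lia.
Qed.

Lemma jdefect0r f m x : jdefect f m 0 x = 0.
Proof.
rewrite /jdefect addn0 /jstat.
rewrite (_ : trf f (jacobi 0 _) = 0) ?addr0 ?subrr//.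
by rewrite /trf (size0nil (size_eigenvalues (tridiag_sym 0 _ _))) big_nil.
Qed.

Definition jdefectC C c r : nat -> R :=
  let E k := exprdiffC (addC C C) k in
  mulC (cstC c) (addC (addC (E 1%N) (E r)) (addC (E 1%N) (E r))).

(** The estimate that the limit theorem rests on: cutting a Jacobi matrix costs
    an amount bounded in all moments, uniformly over the sizes [m] and [n] of
    the two pieces. By [trf_cut_le] the cost is dominated by differences of
    traces of powers of matrices that differ at a single coupling. *)
Lemma moments_jdefect C f c r (X : nat -> T -> R) m n : continuous f ->
  dominated_increments f (fun x => c * (x + x ^+ r)) ->
  (forall j, moments_le P C (X j)) ->
  moments_le P (jdefectC C c r) (fun w => jdefect f m n (X^~ w)).
Proof.
move=> cf fc CX.
have mX j : measurable_fun setT (X j) by case: (CX j).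
have C0 k : 0 <= C k by exact: moments_le_ge0 (CX 0%N).
have CC k : C k <= addC C C k.
  rewrite /addC -mulr2n -[C k *+ 2]mulr_natl mulrA ler_peMl//.
  by rewrite -exprSr exprn_ege1// ler1n.
have CX2 j : moments_le P (addC C C) (X j) by apply: moments_leW (CX j) CC.
have mD m' n' : measurable_fun setT (fun w => jdefect f m' n' (X^~ w)).
  apply: measurable_funB; first exact: measurable_jstat.
  apply: measurable_funD; first exact: measurable_jstat.
  exact: (measurable_jstat n' (X := fun j => X (2 * m' + j)%N)).
have main p q : moments_le P (jdefectC C c r) (fun w => jdefect f p.+1 q.+1 (X^~ w)).
  pose N := (p.+1 + q.+1)%N.
  have pN : (p.+1 < N)%N by rewrite /N; lia.
  pose a i w := X (2 * i)%N w; pose b i w := X (2 * i).+1 w.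
  pose b' i w := cut p (b^~ w) i; pose a' i w := raise p (b^~ w) (a^~ w) i.
  have Cb' i : moments_le P (addC C C) (b' i).
    rewrite /b' /cut; case: (i == p); last exact: CX2.
    by apply: moments_le_norm (CX2 0%N) => // w; rewrite normr0.
  have Cnb : moments_le P C (fun w => `|b p w|).
    apply: moments_le_norm (CX (2 * p).+1) => [|w]; last by rewrite normr_id.
    by apply: measurableT_comp => //; exact: mX.
  have Ca' i : moments_le P (addC C C) (a' i).
    rewrite /a' /raise; case: ((i == p) || (i == p.+1)); last exact: CX2.
    exact: moments_leD (CX (2 * i)%N) Cnb.
  have Cnb2 := moments_leW Cnb CC.
  have Cz : moments_le P (addC C C) (fun=> 0).
    by apply: moments_le_norm (CX2 0%N) => // w; rewrite normr0.
  have E1 k := moments_mxtrace_exprB k (fun i => CX2 (2 * i)%N)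
    (fun i => CX2 (2 * i).+1) Ca' Cb' Cnb2 (moments_leN (CX2 (2 * p).+1))
    (fun w => raise_subE (a^~ w) (b^~ w) pN).
  have E2 k := moments_mxtrace_exprB k (fun i => CX2 (2 * i)%N)
    Cb' Ca' Cb' Cnb2 Cz
    (fun w => raise_sub_cutE (a^~ w) (b^~ w) pN).
  apply: moments_le_norm (moments_leM (moments_le_cst P c)
    (moments_leD (moments_leD (E1 1%N) (E1 r)) (moments_leD (E2 1%N) (E2 r)))) => //.
  move=> w; rewrite jdefect_cut//.
  rewrite [leRHS]ger0_norm.
    exact: (trf_cut_le (a^~ w) (b^~ w) pN fc).
  exact: le_trans (normr_ge0 _) (trf_cut_le (a^~ w) (b^~ w) pN fc).
case: m => [|m].
  apply: moments_le_norm (main 0%N 0%N) => // w.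
  by rewrite jdefect0l normr0.
case: n => [|n]; last exact: main.
apply: moments_le_norm (main 0%N 0%N) => // w.
by rewrite jdefect0r normr0.
Qed.

Definition powC C k (r : nat) : R := C (k * r)%N.

Lemma moments_leX C X k : moments_le P C X -> moments_le P (powC C k) (fun w => X w ^+ k).
Proof.
move=> [mX CX]; split; first exact: measurable_funX.
move=> r; under eq_integral do rewrite normrX -exprM.
exact: CX.
Qed.

Definition growthC C c k := mulC (cstC c) (addC (cstC 1) (powC C (2 * k))).

Lemma moments_growth C (f : R -> R) c k X : continuous f -> 0 <= c ->
  (forall x, `|f x| <= c * (1 + x ^+ (2 * k))) ->
  moments_le P C X -> moments_le P (growthC C c k) (f \o X).
Proof.
move=> cf c0 fc CX.
apply: moments_le_norm (moments_leM (moments_le_cst P c)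
  (moments_leD (moments_le_cst P 1) (moments_leX (2 * k) CX))).
  apply: measurableT_comp; last by case: CX.
  exact: continuous_measurable_fun.
move=> w /=; apply: le_trans (fc _) _.
by rewrite ger0_norm// mulr_ge0// addr_ge0// exprM exprn_ge0// sqr_ge0.
Qed.

Fixpoint jstatC C c r c' k n : nat -> R :=
  if n is n'.+1 then addC (jdefectC C c r) (addC (growthC C c' k) (jstatC C c r c' k n'))
  else cstC 0.

Lemma jstat1 (f : R -> R) (x : nat -> R) : jstat f 1 x = f (x 0%N).
Proof.
rewrite /jstat (@trfE _ f 1 _ [:: x 0%N]) ?big_seq1// /char_poly det_mx11 !mxE.
by rewrite eqxx mulr1n.
Qed.

Lemma jstat0 (f : R -> R) (x : nat -> R) : jstat f 0 x = 0.
Proof.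
by rewrite /jstat /trf (size0nil (size_eigenvalues (tridiag_sym 0 _ _))) big_nil.
Qed.

(** Splitting off one site at a time; here the bounds grow with the size, which
    is harmless for blocks of fixed size. *)
Lemma moments_jstat C f c r c' k (X : nat -> T -> R) n : continuous f ->
  dominated_increments f (fun x => c * (x + x ^+ r)) -> 0 <= c' ->
  (forall x, `|f x| <= c' * (1 + x ^+ (2 * k))) ->
  (forall j, moments_le P C (X j)) ->
  moments_le P (jstatC C c r c' k n) (fun w => jstat f n (X^~ w)).
Proof.
move=> cf fc c0 fk; elim: n X => [|n IH] X CX.
  by under eq_fun do rewrite jstat0; exact: moments_le_cst.
have E w : jstat f n.+1 (X^~ w) = jdefect f 1 n (X^~ w) +
    (f (X 0%N w) + jstat f n (fun j => X (2 * 1 + j)%N w)).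
    by rewrite /jdefect jstat1 subrK.
under eq_fun do rewrite E.
apply: moments_leD; first exact: moments_jdefect.
apply: moments_leD; first exact: (moments_growth cf c0 fk (CX 0%N)).
exact: (IH (fun j => X (2 * 1 + j)%N)).
Qed.

End LocalMoments.

(** * Independent sequences and their windows *)

Definition rv_of d d' (T : measurableType d) (T' : measurableType d') (X : T -> T')
    (mX : measurable_fun setT X) : {mfun T >-> T'} :=
  MeasurableFun.Pack (MeasurableFun.Class (isMeasurableFun.Build _ _ _ _ _ mX)).

Section Boxes.
Context d (E : measurableType d) (R : realType).

Definition box (A : nat -> set E) L : set (L.-tuple E) :=
  [set t | forall j : 'I_L, A j (tnth t j)].

Arguments box A L : clear implicits.

Lemma boxE A L : box A L = \bigcap_(j : 'I_L) ((fun t : L.-tuple E => tnth t j) @^-1` A j).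
Proof. by apply/seteqP; split => t //= H j; [move=> _|]; exact: H. Qed.

Lemma measurable_box A L : (forall j, measurable (A j)) -> measurable (box A L).
Proof.
move=> mA; rewrite boxE; apply: fin_bigcap_measurable => // j _.
by rewrite -[_ @^-1` _]setTI; exact: measurable_tnth.
Qed.

Definition boxes L : set (set (L.-tuple E)) :=
  [set box A L | A in [set A : nat -> set E | forall j, measurable (A j)]].

Arguments boxes L : clear implicits.

Lemma measurable_tuple_boxes L :
  (measurable : set (set (L.-tuple E))) = <<s boxes L >>.
Proof.
apply/seteqP; split; last first.
  apply: smallest_sub; first exact: sigma_algebra_measurable.
  by move=> _ [A mA <-]; exact: measurable_box.
apply: smallest_sub; first exact: smallest_sigma_algebra.
rewrite -bigcup_seq; apply: bigcup_sub => i _ _ [B mB <-].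
apply: sub_sigma_algebra.
exists (fun j => if j == i :> nat then B else setT) => [j|].
  by case: ifP.
rewrite setTI; apply/seteqP; split => t /=.
  by move=> /(_ i); rewrite eqxx.
by move=> Bt j; case: eqP => // /val_inj ->.
Qed.

(** The pi-lambda theorem for boxes. *)
Lemma measure_tuple_unique L (m1 m2 : {measure set (L.-tuple E) -> \bar R}) :
  (m1 setT < +oo)%E ->
  (forall A, (forall j, measurable (A j)) -> m1 (box A L) = m2 (box A L)) ->
  forall B, measurable B -> m1 B = m2 B.
Proof.
move=> m1y m12 B mB.
have Tbox : [set: L.-tuple E] = box (fun=> setT) L by apply/seteqP; split.
apply: (measure_unique (boxes L) (fun=> setT)) => //.
- exact: measurable_tuple_boxes.
- move=> _ _ [A mA <-] [A' mA' <-]; exists (fun j => A j `&` A' j).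
    by move=> j; exact: measurableI.
  by apply/seteqP; split => t /=; [move=> H; split => j; case: (H j)|
     move=> [H1 H2] j; split].
- by move=> _; exists (fun=> setT).
- by apply/seteqP; split => // t _; exists 0%N.
- by move=> _ [A mA <-]; exact: m12.
Qed.

End Boxes.
Arguments box {d E} A L.
Arguments boxes {d E} L.

Section ProductLaw.
Context d (E : measurableType d) (R : realType).

Lemma measurable_tuple_cons L :
  measurable_fun setT (fun z : E * L.-tuple E => [the L.+1.-tuple E of z.1 :: z.2]).
Proof. by apply: measurable_cons. Qed.

Fixpoint product_law (nu : nat -> probability E R) L : probability (L.-tuple E) R :=
  if L is L'.+1 then
    distribution (nu 0%N \x product_law (fun j => nu j.+1) L')%E
      (rv_of (@measurable_tuple_cons L'))
  else \d_([tuple] : 0.-tuple E).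

Lemma product_law_box (nu : nat -> probability E R) L A :
  (forall j, measurable (A j)) ->
  product_law nu L (box A L) = (\prod_(j < L) nu j (A j))%E.
Proof.
elim: L nu A => [|L IH] nu A mA.
  rewrite big_ord0 /= diracE mem_set//=; by case.
rewrite big_ord_recl/= -(IH (fun j => nu j.+1) (fun j => A j.+1))//.
rewrite -product_measure1E//; last exact: measurable_box.
rewrite /distribution /pushforward/=; congr (_ _).
apply/seteqP; split => -[x t] /=.
  move=> H; split; first exact: (H ord0).
  by move=> j; have := H (lift ord0 j); rewrite tnthS.
by move=> [Ax Bt] j; case: (unliftP ord0 j) => [k|] ->//; rewrite tnthS; exact: Bt.
Qed.

End ProductLaw.

Section Independence.
Context d (T : measurableType d) (d' : measure_display) (E : measurableType d')
  (R : realType) (P : probability T R).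
Implicit Types (X : nat -> T -> E) (nu : nat -> probability E R).

(** Independence and the marginal laws in one product formula over initial
    segments. *)
Definition independent_with_laws X nu :=
  (forall j, measurable_fun setT (X j)) /\
  forall N A, (forall j, measurable (A j)) ->
    P [set w | forall j, (j < N)%N -> A j (X j w)] = (\prod_(j < N) nu j (A j))%E.

Definition window X i L w : L.-tuple E := [tuple X (i + j)%N w | j < L].

Lemma measurable_window X nu i L : independent_with_laws X nu ->
  measurable_fun setT (window X i L).
Proof.
move=> [mX _]; apply/measurable_fun_tnthP => j.
rewrite (_ : _ \o _ = X (i + j)%N)//.
by apply/funext => w /=; rewrite tnth_mktuple.
Qed.

Arguments measurable_window [X nu] i L _.

Lemma window_box_prob X nu i L A : independent_with_laws X nu ->
  (forall j, measurable (A j)) ->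
  P (window X i L @^-1` box A L) = (\prod_(j < L) nu (i + j)%N (A j))%E.
Proof.
move=> [_ Xnu] mA.
pose A' j := if (i <= j)%N then A (j - i)%N else setT.
have -> : window X i L @^-1` box A L =
    [set w | forall j, (j < i + L)%N -> A' j (X j w)].
  apply/seteqP; split => w /= H j.
    move=> jL; rewrite /A'; have [ij|//] := leqP i j.
    have ji : (j - i < L)%N by lia.
    by have := H (Ordinal ji); rewrite tnth_mktuple/= subnKC.
  have := H (i + j)%N; rewrite ltn_add2l ltn_ord /A' leq_addr tnth_mktuple addKn.
  exact.
rewrite Xnu; last by move=> j; rewrite /A'; case: ifP.
rewrite big_split_ord/= big1 ?mul1e.
  by apply: eq_bigr => j _; rewrite /A' leq_addr addKn.
by move=> j _; rewrite /A' leqNgt ltn_ord/= probability_setT.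
Qed.

Arguments window_box_prob [X nu] i L [A] _ _.

(** A window of an independent sequence has a law that depends only on the
    marginal laws: it can be replaced by any other realization. *)
Lemma window_law X nu i L : independent_with_laws X nu ->
  forall B, measurable B ->
  P (window X i L @^-1` B) = product_law (fun j => nu (i + j)%N) L B.
Proof.
move=> Xnu B mB; have mW := measurable_window i L Xnu.
rewrite -[LHS]/(distribution P (rv_of mW) B).
apply: measure_tuple_unique => // [|A mA].
  by rewrite -ge0_fin_numE// fin_num_measure.
transitivity (P (window X i L @^-1` box A L)); first by [].
rewrite (window_box_prob i L Xnu mA).
exact/esym/(@product_law_box _ E R (fun j => nu (i + j)%N)).
Qed.

Lemma window_indep_box X nu i L M A B : independent_with_laws X nu ->
  (forall j, measurable (A j)) -> (forall j, measurable (B j)) ->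
  P (window X i L @^-1` box A L `&` window X (i + L) M @^-1` box B M) =
  (P (window X i L @^-1` box A L) * P (window X (i + L) M @^-1` box B M))%E.
Proof.
move=> Xnu mA mB.
pose AB j := if (j < L)%N then A j else B (j - L)%N.
have mAB j : measurable (AB j) by rewrite /AB; case: ifP.
have -> : window X i L @^-1` box A L `&` window X (i + L) M @^-1` box B M =
    window X i (L + M) @^-1` box AB (L + M).
  apply/seteqP; split => w /=.
    move=> [HA HB] j; rewrite tnth_mktuple /AB; case: ltnP => jL.
      by have := HA (Ordinal jL); rewrite tnth_mktuple.
    have jM : (j - L < M)%N by have := ltn_ord j; lia.
    by have := HB (Ordinal jM); rewrite tnth_mktuple/= -addnA subnKC.
  move=> H; split => j.
    by have := H (lshift M j); rewrite !tnth_mktuple/= /AB ltn_ord.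
  have := H (rshift L j); rewrite !tnth_mktuple/= /AB ltnNge leq_addr/= addKn.
  by rewrite addnA.
rewrite !(window_box_prob _ _ Xnu)//.
rewrite big_split_ord/=; congr (_ * _)%E; apply: eq_bigr => j _.
  by rewrite /AB ltn_ord.
by rewrite /AB ltnNge leq_addr/= addKn addnA.
Qed.

Arguments window_indep_box [X nu] i L [M A B] _ _ _.

(** The two measurable sets are released from being boxes one after the other,
    by [measure_tuple_unique] applied first to the law of the second window
    restricted to an event of the first, then conversely. *)
Lemma window_indep X nu i L M A B : independent_with_laws X nu ->
  measurable A -> measurable B ->
  P (window X i L @^-1` A `&` window X (i + L) M @^-1` B) =
  (P (window X i L @^-1` A) * P (window X (i + L) M @^-1` B))%E.
Proof.
move=> Xnu mA mB.
have mW1 := measurable_window i L Xnu; have mW2 := measurable_window (i + L) M Xnu.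
have pre d1 (T1 : measurableType d1) (W : T -> T1) (C : set T1) :
    measurable_fun setT W -> measurable C -> measurable (W @^-1` C).
  by move=> mW mC; rewrite -[_ @^-1` _]setTI; exact: mW.
have step1 A' B' : (forall j, measurable (A' j)) -> measurable B' ->
    P (window X i L @^-1` box A' L `&` window X (i + L) M @^-1` B') =
    (P (window X i L @^-1` box A' L) * P (window X (i + L) M @^-1` B'))%E.
  move=> mA' mB'.
  have mE := pre _ _ _ _ mW1 (measurable_box mA').
  set Ev := window X i L @^-1` box A' L in mE *.
  have fE : P Ev \is a fin_num by exact: fin_num_measure.
  pose m1 := pushforward (mrestr P mE) (rv_of mW2).
  pose m2 := mscale (NngNum (fine_ge0 (measure_ge0 P Ev))) (distribution P (rv_of mW2)).
  have m12 : m1 B' = m2 B'.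
    apply: measure_tuple_unique => // [|C mC].
      by rewrite -[X in (X < _)%E]/(P (setT `&` Ev)) setTI -ge0_fin_numE.
    transitivity (P (window X (i + L) M @^-1` box C M `&` Ev)); first by [].
    by rewrite setIC (window_indep_box i L Xnu)// /= /mscale/= fineK.
  transitivity (m1 B'); first by rewrite setIC.
  by rewrite m12 /m2 /mscale/= fineK.
have mE := pre _ _ _ _ mW2 mB.
set Ev := window X (i + L) M @^-1` B in mE *.
have fE : P Ev \is a fin_num by exact: fin_num_measure.
pose m1 := pushforward (mrestr P mE) (rv_of mW1).
pose m2 := mscale (NngNum (fine_ge0 (measure_ge0 P Ev))) (distribution P (rv_of mW1)).
have m12 : m1 A = m2 A.
  apply: measure_tuple_unique => // [|C mC].
    by rewrite -[X in (X < _)%E]/(P (setT `&` Ev)) setTI -ge0_fin_numE.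
  transitivity (P (window X i L @^-1` box C L `&` Ev)); first by [].
  by rewrite step1// muleC /= /mscale/= fineK.
transitivity (m1 A); first by [].
by rewrite m12 /m2 /mscale/= fineK// muleC.
Qed.

End Independence.

Section IndependentProduct.
Context d (T : measurableType d) (R : realType) (P : probability T R).

(** The joint law is the product law, and Fubini applies. *)
Lemma Ex_indepM (U V : T -> R) : all_moments P U -> all_moments P V ->
  (forall A B, measurable A -> measurable B ->
    P (U @^-1` A `&` V @^-1` B) = (P (U @^-1` A) * P (V @^-1` B))%E) ->
  Ex P (fun w => U w * V w) = Ex P U * Ex P V.
Proof.
move=> aU aV UV.
have mU := am_measurable aU; have mV := am_measurable aV.
pose m1 := [the probability _ _ of distribution P (rv_of mU)].
pose m2 := [the probability _ _ of distribution P (rv_of mV)].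
have mUV : measurable_fun setT (fun w => (U w, V w)) by exact: measurable_fun_pair.
pose m := [the probability _ _ of
  distribution P (rv_of mUV)].
have mm X : measurable X -> (m1 \x m2)%E X = m X.
  by apply: product_measure_unique => A B mA mB; exact: UV.
have mprod : measurable_fun setT (fun z : R * R => (z.1 * z.2)%:E).
  apply/measurable_EFinP; apply: measurable_funM.
    exact: measurable_fst.
  exact: measurable_snd.
have int12 : (m1 \x m2)%E.-integrable setT (fun z : R * R => (z.1 * z.2)%:E).
  have : m.-integrable setT (fun z : R * R => (z.1 * z.2)%:E).
    apply: (@integrable_pushforward _ _ _ _ _ _ mUV) => //.
    exact: am_integrable (amM aU aV).
  move=> /integrableP[_ H]; apply/integrableP; split => //.
  by rewrite (eq_measure_integral m)// => X mX _; exact: mm.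
have E12 : (\int[P]_w (U w * V w)%:E = \int[m1]_x \int[m2]_y (x * y)%:E)%E.
  rewrite (@integral12_prod_meas1 _ _ _ _ _ m1 m2 (fun z => (z.1 * z.2)%:E))//.
  rewrite (eq_measure_integral m); last by move=> X mX _; exact: mm.
  rewrite (@integral_pushforward _ _ _ _ _ _ mUV)//.
  exact: am_integrable (amM aU aV).
have mid : measurable_fun setT (fun y : R => y%:E).
  exact/(@measurable_EFinP _ _ _ setT id)/measurable_id.
have iV : m2.-integrable setT (fun y : R => y%:E).
  apply: (@integrable_pushforward _ _ _ _ _ _ mV) => //.
  exact: am_integrable aV.
have iU : m1.-integrable setT (fun y : R => y%:E).
  apply: (@integrable_pushforward _ _ _ _ _ _ mU) => //.
  exact: am_integrable aU.
have EV : (\int[m2]_y y%:E = (Ex P V)%:E)%E.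
  rewrite (@integral_pushforward _ _ _ _ _ _ mV)//; last exact: am_integrable aV.
  by rewrite /Ex /Rintegral fineK//; exact: integrable_fin_num (am_integrable aV).
have EU : (\int[m1]_y y%:E = (Ex P U)%:E)%E.
  rewrite (@integral_pushforward _ _ _ _ _ _ mU)//; last exact: am_integrable aU.
  by rewrite /Ex /Rintegral fineK//; exact: integrable_fin_num (am_integrable aU).
rewrite {1}/Ex /Rintegral E12.
under eq_integral do (under eq_integral do rewrite EFinM; rewrite integralZl// EV).
by rewrite integralZr// EU -EFinM.
Qed.

End IndependentProduct.

(** * Local functionals and the dyadic argument *)

Section Variance.
Context d (T : measurableType d) (R : realType) (P : probability T R).
Implicit Types (U V : T -> R).

Definition cen U w := U w - Ex P U.
Definition var U := Ex P (fun w => cen U w ^+ 2).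

Lemma am_cen U : all_moments P U -> all_moments P (cen U).
Proof. by move=> aU; apply: amB => //; exact: am_cst. Qed.

Lemma Ex_cen U : all_moments P U -> Ex P (cen U) = 0.
Proof. by move=> aU; rewrite /cen ExB ?Ex_cst ?subrr//; exact: am_cst. Qed.

Lemma cenD U V : all_moments P U -> all_moments P V ->
  cen (fun w => U w + V w) = fun w => cen U w + cen V w.
Proof. by move=> aU aV; apply/funext => w; rewrite /cen ExD//; ring. Qed.

Lemma var_le U : all_moments P U -> var U <= Ex P (fun w => U w ^+ 2).
Proof.
move=> aU; rewrite /var /cen.
have aU2 : all_moments P (fun w => U w ^+ 2) by exact: amX.
have -> : (fun w => (U w - Ex P U) ^+ 2) =
    (fun w => (U w ^+ 2 - (2 * Ex P U) * U w) + Ex P U ^+ 2).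
  by apply/funext => w; ring.
rewrite ExD ?ExB ?ExZ ?Ex_cst//; try exact: am_cst.
- by have := sqr_ge0 (Ex P U); lra.
- by apply: amM => //; exact: am_cst.
- by apply: amB => //; apply: amM => //; exact: am_cst.
Qed.

Lemma varE U : all_moments P U -> var U = Ex P (fun w => U w ^+ 2) - Ex P U ^+ 2.
Proof.
move=> aU; rewrite /var /cen.
have aU2 : all_moments P (fun w => U w ^+ 2) by exact: amX.
have -> : (fun w => (U w - Ex P U) ^+ 2) =
    (fun w => (U w ^+ 2 - (2 * Ex P U) * U w) + Ex P U ^+ 2).
  by apply/funext => w; ring.
rewrite ExD ?ExB ?ExZ ?Ex_cst//; try exact: am_cst.
- by ring.
- by apply: amM => //; exact: am_cst.
- by apply: amB => //; apply: amM => //; exact: am_cst.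
Qed.

Definition indep2 U V := forall A B, measurable A -> measurable B ->
    P (U @^-1` A `&` V @^-1` B) = (P (U @^-1` A) * P (V @^-1` B))%E.

Lemma Ex_indep2 U V (g h : R -> R) : indep2 U V ->
  measurable_fun setT g -> measurable_fun setT h ->
  all_moments P (g \o U) -> all_moments P (h \o V) ->
  Ex P (fun w => g (U w) * h (V w)) = Ex P (g \o U) * Ex P (h \o V).
Proof.
move=> UV mg mh aU aV.
apply: (@Ex_indepM _ _ _ P (g \o U) (h \o V)) => // A B mA mB.
apply: (UV (g @^-1` A) (h @^-1` B)).
  by rewrite -[_ @^-1` _]setTI; exact: mg.
by rewrite -[_ @^-1` _]setTI; exact: mh.
Qed.

Lemma var_indepD U V : all_moments P U -> all_moments P V -> indep2 U V ->
  var (fun w => U w + V w) = var U + var V.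
Proof.
move=> aU aV UV; rewrite /var cenD//.
have acU := am_cen aU; have acV := am_cen aV.
have -> : (fun w => (cen U w + cen V w) ^+ 2) =
    (fun w => (cen U w ^+ 2 + cen V w ^+ 2) + 2 * (cen U w * cen V w)).
  by apply/funext => w; ring.
have mcen (c : R) : measurable_fun setT (fun x : R => x - c).
  by apply: measurable_funB => //; exact: measurable_id.
have E0 : Ex P (fun w => cen U w * cen V w) = 0.
  have := Ex_indep2 UV (mcen (Ex P U)) (mcen (Ex P V)).
  move=> /(_ acU acV) E; transitivity (Ex P (cen U) * Ex P (cen V)); first exact: E.
  by rewrite !Ex_cen// mul0r.
have a1 : all_moments P (fun w => cen U w ^+ 2) by exact: amX.
have a2 : all_moments P (fun w => cen V w ^+ 2) by exact: amX.
have a3 : all_moments P (fun w => cen U w * cen V w) by exact: amM.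
rewrite ExD; [|exact: amD|by apply: amM => //; exact: am_cst].
by rewrite ExZ// E0 mulr0 addr0 ExD.
Qed.

End Variance.

Section LocalFunctionals.
Context d (T : measurableType d) (R : realType) (P : probability T R).
Implicit Types (X : nat -> T -> R) (nu : nat -> probability R R) (G H : (nat -> R) -> R).

(** Measurability is asked of the functional on tuples: the space of all
    sequences then needs no sigma-algebra, and independence of windows applies
    directly. *)
Definition local N G :=
  (forall x y, (forall j, (j < N)%N -> x j = y j) -> G x = G y) /\
  measurable_fun setT (fun t : N.-tuple R => G (nth 0 t)).

Definition shift i (x : nat -> R) : nat -> R := fun j => x (i + j)%N.

Lemma shift_shift i j x : shift i (shift j x) = shift (j + i) x.
Proof. by apply/funext => k; rewrite /shift addnA. Qed.

Lemma measurable_nth N j :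
  measurable_fun setT (fun t : N.-tuple R => nth 0 t j).
Proof.
have [jN|Nj] := ltnP j N.
  have -> : (fun t : N.-tuple R => nth 0 t j) = (fun t => tnth t (Ordinal jN)).
    by apply/funext => t; rewrite (tnth_nth 0).
  exact: measurable_tnth.
under eq_fun do rewrite nth_default ?size_tuple//.
exact: measurable_cst.
Qed.

Lemma local_window N G X i w : local N G ->
  G (shift i (X^~ w)) = G (nth 0 (window X i N w)).
Proof.
move=> [GN _]; apply: GN => j jN.
by rewrite -[j]/(nat_of_ord (Ordinal jN)) -tnth_nth tnth_mktuple.
Qed.

(** Functionals that read disjoint stretches of an independent sequence are
    independent. *)
Lemma local_indep X nu N M G H i : independent_with_laws P X nu ->
  local N G -> local M H ->
  indep2 P (fun w => G (shift i (X^~ w))) (fun w => H (shift (i + N) (X^~ w))).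
Proof.
move=> Xnu lG lH A B mA mB.
have E K L' (lK : local L' K) l C : (fun w => K (shift l (X^~ w))) @^-1` C =
    window X l L' @^-1` ((fun t => K (nth 0 (tval t))) @^-1` C).
  apply/seteqP; split => w /=; by rewrite (local_window _ _ _ lK).
rewrite (E _ _ lG) (E _ _ lH); apply: (@window_indep _ _ _ _ _ P X nu i N M _ _ Xnu).
  by rewrite -[_ @^-1` _]setTI; case: lG => _; exact.
by rewrite -[_ @^-1` _]setTI; case: lH => _; exact.
Qed.

Lemma localW N M G : (N <= M)%N -> local N G -> local M G.
Proof.
move=> NM [GN mG]; split.
  by move=> x y xy; apply: GN => j jN; apply: xy; exact: leq_trans NM.
pose tr (t : M.-tuple R) : N.-tuple R := [tuple nth 0 t j | j < N].
have -> : (fun t : M.-tuple R => G (nth 0 t)) = (fun t : N.-tuple R => G (nth 0 t)) \o tr.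
  apply/funext => t /=; apply: GN => j jN.
  by rewrite /tr -[j in RHS]/(nat_of_ord (Ordinal jN)) nth_mktuple.
apply: measurableT_comp => //; apply/measurable_fun_tnthP => j.
rewrite (_ : _ \o _ = fun t : M.-tuple R => nth 0 t j); first exact: measurable_nth.
by apply/funext => t /=; rewrite tnth_mktuple.
Qed.

Lemma localD N G H : local N G -> local N H -> local N (fun x => G x + H x).
Proof.
move=> [G1 mG] [H1 mH]; split; last exact: measurable_funD.
by move=> x y xy; rewrite (G1 x y)// (H1 x y).
Qed.

Lemma localN N G : local N G -> local N (fun x => - G x).
Proof.
move=> [G1 mG]; split; last exact: measurableT_comp.
by move=> x y xy; rewrite (G1 x y).
Qed.

Lemma local_cst N (c : R) : local N (fun=> c).
Proof. by split => //; exact: measurable_cst. Qed.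

Lemma local_shift N i G : local N G -> local (i + N) (fun x => G (shift i x)).
Proof.
move=> [GN mG]; split.
  by move=> x y xy; apply: GN => j jN; apply: xy; rewrite ltn_add2l.
pose tr (t : (i + N).-tuple R) : N.-tuple R := [tuple nth 0 t (i + j) | j < N].
have -> : (fun t : (i + N).-tuple R => G (shift i (nth 0 t))) =
    (fun t : N.-tuple R => G (nth 0 t)) \o tr.
  apply/funext => t /=; apply: GN => j jN.
  by rewrite /tr -[j in RHS]/(nat_of_ord (Ordinal jN)) nth_mktuple.
apply: measurableT_comp => //; apply/measurable_fun_tnthP => j.
rewrite (_ : _ \o _ = fun t : (i + N).-tuple R => nth 0 t (i + j)); first exact: measurable_nth.
by apply/funext => t /=; rewrite tnth_mktuple.
Qed.

Lemma local_sum (I : Type) (s : seq I) (F : I -> (nat -> R) -> R) N :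
  (forall i, local N (F i)) -> local N (fun x => \sum_(i <- s) F i x).
Proof.
move=> lF; elim: s => [|i s IH].
  rewrite (_ : (fun x => _) = fun=> 0); first exact: local_cst.
  by apply/funext => x; rewrite big_nil.
rewrite (_ : (fun x => _) = fun x => F i x + \sum_(j <- s) F j x).
  exact: localD.
by apply/funext => x; rewrite big_cons.
Qed.

Lemma local_jstat f n : continuous f -> local (2 * n) (@jstat R f n).
Proof.
move=> cf; split.
  move=> x y xy; rewrite /jstat /jacobi; congr (trf f _).
  by apply: tridiag_ext => i ni; apply: xy; lia.
apply: (measurable_jstat n (X := fun j (t : (2 * n).-tuple R) => nth 0 t j)) => // j.
exact: measurable_nth.
Qed.

End LocalFunctionals.

Section DyadicBlocks.
Context d (T : measurableType d) (R : realType) (P : probability T R).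
Variables (X : nat -> T -> R) (nu : nat -> probability R R) (f : R -> R).
Hypotheses (Xnu : independent_with_laws P X nu) (cf : continuous f).
Variables (C : nat -> R) (c : R) (r : nat).
Hypotheses (CX : forall j, moments_le P C (X j))
  (fphi : dominated_increments f (fun x => c * (x + x ^+ r))).
Hypothesis am_jstat : forall n i, all_moments P (fun w => jstat f n (shift i (X^~ w))).

(** The defect of additivity over [2 ^ k] blocks. It is cut in halves rather
    than block by block, because the errors of the two halves are independent. *)
Definition block_error m k (x : nat -> R) : R :=
  jstat f (2 ^ k * m) x - \sum_(j < 2 ^ k) jstat f m (shift (2 * (j * m)) x).

Lemma block_errorS m k x : block_error m k.+1 x =
  block_error m k x + block_error m k (shift (2 * (2 ^ k * m)) x) +
  jdefect f (2 ^ k * m) (2 ^ k * m) x.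
Proof.
rewrite /block_error /jdefect.
have -> : (2 ^ k.+1 = 2 ^ k + 2 ^ k)%N by rewrite expnS mul2n addnn.
rewrite big_split_ord/=.
under [X in _ - (_ + X)]eq_bigr => j _ do
  rewrite mulnDl mulnDr -shift_shift.
rewrite mulnDl.
rewrite -/(shift (2 * (2 ^ k * m)) x).
have alg (u v w p q : R) : u - (p + q) = ((v - p) + (w - q)) + (u - (v + w)) by ring.
exact: alg.
Qed.

Lemma local_block_error m k : local (2 * (2 ^ k * m)) (block_error m k).
Proof.
apply: localD; first exact: local_jstat.
apply/localN/local_sum => j.
apply: (@localW _ (2 * (j * m) + 2 * m)).
  by rewrite -mulnDr leq_mul2l -mulSnr leq_mul2r ltn_ord orbT.
exact/local_shift/local_jstat.
Qed.

Lemma am_block_error m k i :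
  all_moments P (fun w => block_error m k (shift i (X^~ w))).
Proof.
apply: amB; first exact: am_jstat.
by apply: am_sum => j _; under eq_fun do rewrite shift_shift; exact: am_jstat.
Qed.

(** The deviation obeys x' <= sqrt 2 * x + s: the variances of the two halves
    add by independence, and the middle cut costs at most [s] by
    [moments_jdefect]. So it grows like sqrt (2 ^ k), with a constant that
    involves neither [m] nor the number of blocks; bounding the cuts one by one
    would only give 2 ^ k. The term -3 makes the induction close, as
    4 <= 3 * sqrt 2. *)
Lemma var_block_error (s : R) m k i : 0 < s -> jdefectC C c r 2 <= s ^+ 2 ->
  var P (fun w => block_error m k (shift i (X^~ w))) <=
  (s * (4 * Num.sqrt 2 ^+ k - 3)) ^+ 2.
Proof.
move=> s0 Cs; elim: k i => [|k IH] i.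
  rewrite (_ : (fun w => _) = fun=> 0).
    apply: le_trans (var_le (am_cst P 0)) _.
    by rewrite [leLHS](Ex_cst P (0 ^+ 2)) expr0n/= sqr_ge0.
  apply/funext => w; rewrite /block_error big_ord1 mul0n muln0 expn0 mul1n.
  by rewrite (_ : shift 0 _ = shift i (X^~ w)) ?subrr.
have s2 : 1 <= Num.sqrt 2 :> R by rewrite -{1}[1]sqrtr1 ler_wsqrtr// ler1n.
have sk : 1 <= Num.sqrt 2 ^+ k :> R by rewrite exprn_ege1.
have sq2 : Num.sqrt 2 ^+ 2 = 2 :> R by rewrite sqr_sqrtr.
set U := fun w => block_error m k (shift i (X^~ w)).
set V := fun w => block_error m k (shift (i + 2 * (2 ^ k * m)) (X^~ w)).
set D := fun w => jdefect f (2 ^ k * m) (2 ^ k * m) (shift i (X^~ w)).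
have -> : (fun w => block_error m k.+1 (shift i (X^~ w))) =
    (fun w => (U w + V w) + D w).
  by apply/funext => w; rewrite block_errorS shift_shift.
have aU : all_moments P U by exact: am_block_error.
have aV : all_moments P V by exact: am_block_error.
have mD : moments_le P (jdefectC C c r) D.
  exact: (moments_jdefect _ _ cf fphi (fun j => CX (i + j))).
have aD : all_moments P D by exact: amI mD.
have UV : indep2 P U V by exact: (local_indep i Xnu (local_block_error m k) (local_block_error m k)).
rewrite /var cenD//; last exact: amD.
have varD : Ex P (fun w => cen P D w ^+ 2) <= s ^+ 2.
  apply: le_trans (var_le aD) _; apply: le_trans Cs.
  apply: le_trans (moments_le_Ex 2 mD).
  by rewrite le_eqVlt; apply/orP; left; apply/eqP/eq_Ex => w; rewrite real_normK ?num_real.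
have varUV : Ex P (fun w => cen P (fun w => U w + V w) w ^+ 2) <=
    (Num.sqrt 2 * (s * (4 * Num.sqrt 2 ^+ k - 3))) ^+ 2.
  rewrite [leLHS](var_indepD aU aV UV) exprMn sq2.
  have hU : var P U <= (s * (4 * Num.sqrt 2 ^+ k - 3)) ^+ 2 := IH i.
  have hV : var P V <= (s * (4 * Num.sqrt 2 ^+ k - 3)) ^+ 2 := IH _.
  move: (var P U) (var P V) (_ ^+ 2) hU hV => u v q hU hV.
  by rewrite mulr_natl mulr2n lerD.
apply: le_trans (L2_add _ _ _ s0 varUV varD) _.
- by apply/am_cen/amD.
- exact: am_cen.
- by rewrite !mulr_gt0//; nra.
have h : 4 / 3 <= Num.sqrt 2 :> R.
  by rewrite -[leLHS]ger0_norm// -sqrtr_sqr ler_wsqrtr//; lra.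
rewrite lerXn2r ?nnegrE//.
- by rewrite addr_ge0 ?ltW// !mulr_gt0//; nra.
- by rewrite mulr_ge0 ?ltW// exprS; nra.
by rewrite exprS; nra.
Qed.

End DyadicBlocks.

(** * Gaussian densities *)

Section Density.
Context d (T : measurableType d) (R : realType).
Variables (mu nu : {measure set T -> \bar R}) (p : T -> R).
Hypotheses (mp : measurable_fun setT p) (p0 : forall x, 0 <= p x)
  (nuE : forall A, measurable A -> nu A = (\int[mu]_(x in A) (p x)%:E)%E).

Import HBNNSimple.

Let density_nnsfun (h : {nnsfun T >-> R}) :
  (\int[nu]_x (h x)%:E = \int[mu]_x ((h x)%:E * (p x)%:E))%E.
Proof.
under [LHS]eq_integral do rewrite fimfunE -fsumEFin//.
rewrite [LHS]ge0_integral_fsum//; last 2 first.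
  - by move=> r; exact/measurable_EFinP/measurableT_comp.
  - by move=> n x _; rewrite EFinM nnfun_muleindic_ge0.
under [RHS]eq_integral.
  move=> x xD; rewrite fimfunE -fsumEFin// ge0_mule_fsuml; last first.
    by move=> r; rewrite EFinM nnfun_muleindic_ge0.
  over.
rewrite [RHS]ge0_integral_fsum//; last 2 first.
  - move=> r; apply: emeasurable_funM; last exact/measurable_EFinP.
    by apply/measurable_EFinP; apply: measurableT_comp.
  - move=> n x _; apply: mule_ge0; last by rewrite lee_fin.
    by rewrite EFinM nnfun_muleindic_ge0.
apply: eq_fsbigr => r rh.
have mr : measurable (h @^-1` [set r]) by exact: measurable_sfunP.
rewrite !integralZl_indic_nnsfun//= integral_indic//= setIT nuE//.
have r0 : 0 <= r.
  by move: rh; rewrite inE => -[x _ <-].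
rewrite integral_mkcond -ge0_integralZl//; last 2 first.
- by apply/(measurable_restrictT _ mr); exact/measurable_funTS/measurable_EFinP.
- by move=> x _; rewrite patchE; case: ifP; rewrite ?lee_fin.
apply: eq_integral => x _; rewrite patchE indicE.
by case: ifP => _; rewrite ?mulr1 ?mulr0 ?mul0e ?mule0.
Qed.

(** Integration against a density, first for simple functions, then by monotone
    convergence. *)
Lemma ge0_integral_density (f : T -> \bar R) :
  measurable_fun setT f -> (forall x, 0 <= f x)%E ->
  (\int[nu]_x f x = \int[mu]_x (f x * (p x)%:E))%E.
Proof.
move=> mf f0; pose f_ := nnsfun_approx measurableT mf.
transitivity (lim (\int[nu]_x (f_ n x)%:E @[n --> \oo])%E).
  rewrite -monotone_convergence//=.
  - apply: eq_integral => ? /[!inE] xD; apply/esym/cvg_lim => //=.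
    exact: cvg_nnsfun_approx.
  - by move=> n; exact/measurable_EFinP/measurable_funTS.
  - by move=> n ? _; rewrite lee_fin.
  - by move=> ? _ ? ? mn; rewrite lee_fin; exact/lefP/nd_nnsfun_approx.
transitivity (lim (\int[mu]_x ((f_ n x)%:E * (p x)%:E) @[n --> \oo])%E).
  by apply: congr_lim; apply/funext => n; exact: density_nnsfun.
rewrite -monotone_convergence//=.
- apply: eq_integral => x _; apply/cvg_lim => //.
  by apply: cvgeZr => //; exact: cvg_nnsfun_approx.
- move=> n; apply: emeasurable_funM; last exact/measurable_EFinP.
  exact/measurable_EFinP/measurable_funTS.
- by move=> n x _; rewrite mule_ge0 ?lee_fin.
- move=> x _ a b ab; rewrite lee_wpmul2r ?lee_fin//.
  exact/lefP/nd_nnsfun_approx.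
Qed.

End Density.

Section Normal.
Variable R : realType.
Notation mu := (@lebesgue_measure R).
Implicit Types (h : R -> R) (s t v x y : R).

Lemma ge0_integral_normal s h : measurable_fun setT h -> (forall x, 0 <= h x) ->
  (\int[normal_prob 0 s]_x (h x)%:E = \int[mu]_x (h x * normal_pdf 0 s x)%:E)%E.
Proof.
move=> mh h0.
rewrite (@ge0_integral_density _ _ _ mu (normal_prob 0 s) (normal_pdf 0 s))//.
- exact: measurable_normal_pdf.
- exact: normal_pdf_ge0.
- exact/measurable_EFinP.
Qed.

Lemma derive1_affine s y : derive1 (fun x => (x + y) * s) = cst s :> (R -> R).
Proof.
apply/funext => x; rewrite derive1E deriveM// deriveD// !derive_cst derive_id.
by rewrite scaler0 addr0 add0r scaler1.
Qed.

Lemma ge0_integral_affine h s y : continuous h -> (forall x, 0 <= h x) -> 0 < s ->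
  (\int[mu]_x (h x)%:E = \int[mu]_x (s * h ((x + y) * s))%:E)%E.
Proof.
move=> ch h0 s0.
rewrite (@increasing_ge0_integration_by_substitutionT _ (fun x => (x + y) * s) h)//.
- by apply: eq_integral => x _; rewrite derive1_affine/= mulrC.
- by move=> u v uv; rewrite ltr_pM2r// ltrD2r.
- by rewrite derive1_affine => x; exact: cvg_cst.
- by rewrite derive1_affine; exact: is_cvg_cst.
- by rewrite derive1_affine; exact: is_cvg_cst.
- by apply/gt0_cvgMlNy => //; exact: cvg_addrr_Ny.
- by apply/gt0_cvgMly => //; exact: cvg_addrr.
Qed.

Lemma normal_pdfE0 s x : 0 < s -> normal_pdf 0 s x =
  (s * Num.sqrt (pi *+ 2))^-1 * expR (- x ^+ 2 / (s ^+ 2 *+ 2)).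
Proof.
move=> s0; rewrite normal_pdfE ?gt_eqF// /normal_peak /normal_fun subr0.
congr (_^-1 * _); rewrite -mulrnAr sqrtrM ?sqr_ge0// sqrtr_sqr gtr0_norm//.
Qed.

Lemma normal_scale s h : 0 < s -> continuous h -> (forall x, 0 <= h x) ->
  (\int[normal_prob 0 s]_x (h x)%:E = \int[normal_prob 0 1]_x (h (x * s))%:E)%E.
Proof.
move=> s0 ch h0.
have chs : continuous (fun x => h (x * s)).
  move=> x; apply: (@continuous_comp _ _ _ (fun x => x * s) h); last exact: ch.
  by apply: cvgM; [exact: cvg_id|exact: cvg_cst].
apply: etrans (ge0_integral_normal s (continuous_measurable_fun ch) h0) _.
apply/esym; apply: etrans.
  by apply: (ge0_integral_normal 1 (continuous_measurable_fun chs)).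
apply/esym.
rewrite (@ge0_integral_affine _ s 0)//.
- apply: eq_integral => x _; congr (_%:E); rewrite addr0 !normal_pdfE0// mul1r.
  rewrite exprMn expr1n.
  have -> : - (x ^+ 2 * s ^+ 2) / (s ^+ 2 *+ 2) = - x ^+ 2 / (1 *+ 2).
    by field; rewrite gt_eqF.
  have pi0 : Num.sqrt (pi *+ 2) != 0 :> R.
    by rewrite gt_eqF// sqrtr_gt0 mulrn_wgt0// pi_gt0.
  by field; rewrite pi0 gt_eqF.
- move=> x; apply: cvgM; first exact: ch.
  by apply: continuous_normal_pdf; rewrite gt_eqF.
- by move=> x; rewrite mulr_ge0// normal_pdf_ge0.
Qed.

(** Completing the square: the joint density of [y] and [x], for [x] the sum of
    independent centred Gaussian variables of which [y] is the first, is the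
    density of [x] times a Gaussian density in [y]. *)
Lemma normal_pdf_mul s t x y : 0 < s -> 0 < t ->
  let r := Num.sqrt (s ^+ 2 + t ^+ 2) in
  normal_pdf 0 s y * normal_pdf 0 t (x - y) =
  normal_pdf 0 r x * normal_pdf (x * s ^+ 2 / r ^+ 2) (s * t / r) y.
Proof.
move=> s0 t0 r.
have r0 : 0 < r by rewrite sqrtr_gt0 addr_gt0// exprn_gt0.
have r2 : r ^+ 2 = s ^+ 2 + t ^+ 2 by rewrite sqr_sqrtr// addr_ge0// sqr_ge0.
have st0 : 0 < s * t / r by rewrite divr_gt0// mulr_gt0.
rewrite !normal_pdfE0// [normal_pdf _ (s * t / r)]normal_pdfE ?gt_eqF//.
rewrite /normal_peak /normal_fun -[(s * t / r) ^+ 2 * pi *+ 2]mulrnAr.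
rewrite sqrtrM ?sqr_ge0// sqrtr_sqr gtr0_norm//.
have pi0 : Num.sqrt (pi *+ 2) != 0 :> R.
  by rewrite gt_eqF// sqrtr_gt0 mulrn_wgt0// pi_gt0.
rewrite mulrACA -expRD [RHS]mulrACA -expRD; congr (_ * expR _).
  by field; rewrite pi0 !gt_eqF.
have st2 : s ^+ 2 + t ^+ 2 != 0 by rewrite -r2 gt_eqF// exprn_gt0.
rewrite !expr_div_n !r2.
by field; rewrite st2 !gt_eqF.
Qed.

(** By Tonelli and [normal_pdf_mul], where the density in [y] integrates to 1. *)
Lemma normal_convolution s t h : 0 < s -> 0 < t -> continuous h ->
  (forall x, 0 <= h x) ->
  (\int[normal_prob 0 s]_y \int[normal_prob 0 t]_z (h (y + z))%:E =
   \int[normal_prob 0 (Num.sqrt (s ^+ 2 + t ^+ 2))]_x (h x)%:E)%E.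
Proof.
move=> s0 t0 ch h0.
set r := Num.sqrt _.
have r0 : 0 < r by rewrite sqrtr_gt0 addr_gt0// exprn_gt0.
have chy y : continuous (fun z => h (y + z)).
  move=> x; apply: (@continuous_comp _ _ _ (fun z => y + z) h); last exact: ch.
  by apply: cvgD; [exact: cvg_cst|exact: cvg_id].
have inner y : (\int[normal_prob 0 t]_z (h (y + z))%:E =
    \int[mu]_x (h x * normal_pdf 0 t (x - y))%:E)%E.
  apply: etrans.
    by apply: (ge0_integral_normal t (continuous_measurable_fun (chy y))).
  rewrite (@ge0_integral_affine _ 1 (- y))//.
  - by apply: eq_integral => x _; rewrite !mulr1 mul1r addrC subrK.
  - move=> x; apply: cvgM; first exact: chy.
    by apply: continuous_normal_pdf; rewrite gt_eqF.
  - by move=> x; rewrite mulr_ge0// normal_pdf_ge0.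
pose F (z : R * R) := normal_pdf 0 s z.1 * (h z.2 * normal_pdf 0 t (z.2 - z.1)).
have mF : measurable_fun setT (EFin \o F).
  apply/measurable_EFinP; apply: measurable_funM.
    apply: (@measurableT_comp _ _ _ _ _ _ (normal_pdf 0 s)); first exact: measurable_normal_pdf.
    exact: measurable_fst.
  apply: measurable_funM.
    apply: (@measurableT_comp _ _ _ _ _ _ h); first exact: continuous_measurable_fun.
    exact: measurable_snd.
  apply: (@measurableT_comp _ _ _ _ _ _ (normal_pdf 0 t)); first exact: measurable_normal_pdf.
  by apply: measurable_funB; [exact: measurable_snd|exact: measurable_fst].
have F0 z : (0 <= (EFin \o F) z)%E.
  by rewrite /= lee_fin /F !mulr_ge0 ?normal_pdf_ge0.
under eq_integral do rewrite inner.
have mG : measurable_fun setT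
    (fun y => \int[mu]_x (h x * normal_pdf 0 t (x - y))%:E)%E.
  pose G (z : R * R) := h z.2 * normal_pdf 0 t (z.2 - z.1).
  apply: (@measurable_fun_fubini_tonelli_F _ _ _ _ _ mu (EFin \o G)).
    apply/measurable_EFinP; apply: measurable_funM.
      apply: (@measurableT_comp _ _ _ _ _ _ h); first exact: continuous_measurable_fun.
      exact: measurable_snd.
    apply: (@measurableT_comp _ _ _ _ _ _ (normal_pdf 0 t)); first exact: measurable_normal_pdf.
    by apply: measurable_funB; [exact: measurable_snd|exact: measurable_fst].
  by move=> z /=; rewrite lee_fin mulr_ge0 ?normal_pdf_ge0.
have mhp y : measurable_fun setT (fun x => (h x * normal_pdf 0 t (x - y))%:E).
  apply/measurable_EFinP; apply: measurable_funM; first exact: continuous_measurable_fun.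
  apply: measurableT_comp; first exact: measurable_normal_pdf.
  by apply: measurable_funB => //; exact: measurable_id.
transitivity (\int[mu]_y \int[mu]_x (F (y, x))%:E)%E.
  apply: etrans.
    apply: (@ge0_integral_density _ _ _ mu (normal_prob 0 s) (normal_pdf 0 s)) => //.
    - exact: measurable_normal_pdf.
    - exact: normal_pdf_ge0.
    - move=> y; apply: integral_ge0 => x _.
      by rewrite lee_fin mulr_ge0// normal_pdf_ge0.
  apply: eq_integral => y _; rewrite muleC -ge0_integralZl//.
  - exact: mhp.
  - by move=> x _; rewrite lee_fin mulr_ge0// normal_pdf_ge0.
  - by rewrite lee_fin normal_pdf_ge0.
rewrite (@fubini_tonelli _ _ _ _ _ mu mu (EFin \o F))//=.
apply/esym; apply: etrans.
  by apply: (ge0_integral_normal r (continuous_measurable_fun ch)).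
apply: eq_integral => x _.
under eq_integral.
  move=> y _; rewrite /F/= mulrCA normal_pdf_mul// -/r mulrA EFinM.
  over.
rewrite ge0_integralZl//.
- by rewrite integral_normal_pdf mule1.
- by apply/measurable_EFinP; exact: measurable_normal_pdf.
- by move=> y _; rewrite lee_fin normal_pdf_ge0.
- by rewrite lee_fin mulr_ge0// normal_pdf_ge0.
Qed.

End Normal.

(** * Gaussian averages *)

Section StandardNormal.
Variable R : realType.
Notation mu := (@lebesgue_measure R).
Notation RR := (measurableTypeR R).

Definition std_normal : probability RR R := normal_prob 0 1.
Notation N := std_normal.

Lemma expR_ge_expr (x : R) r : 0 <= x -> x ^+ r / r`!%:R <= expR x.
Proof.
move=> x0; case: r => [|r]; first by rewrite expr0 fact0 divr1 -expR0 ler_expR.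
by apply: le_trans (expR_ge1Dxn r x0); rewrite lerDr.
Qed.

(** Half of the exponent pays for the power, and what is left is a multiple of
    the Gaussian density of variance 2. *)
Lemma std_normal_even_moment r :
  (\int[N]_x (x ^+ (2 * r))%:E <= (4 ^+ r * r`!%:R * Num.sqrt 2)%:E)%E.
Proof.
have s20 : 0 < Num.sqrt 2 :> R by rewrite sqrtr_gt0.
have mx : measurable_fun setT (fun x : R => x ^+ (2 * r)).
  by apply: measurable_funX; exact: measurable_id.
have x0 (x : R) : 0 <= x ^+ (2 * r) by rewrite exprM exprn_ge0// sqr_ge0.
rewrite (ge0_integral_normal 1 mx x0).
pose K : R := 4 ^+ r * r`!%:R * Num.sqrt 2.
have K0 : 0 <= K by rewrite !mulr_ge0// ?exprn_ge0// ltW.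
apply: (@le_trans _ _ (\int[mu]_x (K * normal_pdf 0 (Num.sqrt 2) x)%:E)%E).
  apply: ge0_le_integral => //.
  - by move=> x _; rewrite lee_fin mulr_ge0// normal_pdf_ge0.
  - apply/measurable_EFinP; apply: measurable_funM => //; exact: measurable_normal_pdf.
  - apply/measurable_EFinP; apply: measurable_funM => //; exact: measurable_normal_pdf.
  - move=> x _; rewrite lee_fin !normal_pdfE0// mul1r sqr_sqrtr//.
    have pi0 : 0 < Num.sqrt (pi *+ 2) :> R by rewrite sqrtr_gt0 mulrn_wgt0// pi_gt0.
    have -> : K * ((Num.sqrt 2 * Num.sqrt (pi *+ 2))^-1 * expR (- x ^+ 2 / (2 *+ 2))) =
        (4 ^+ r * r`!%:R * expR (- x ^+ 2 / (2 *+ 2))) * (Num.sqrt (pi *+ 2))^-1.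
      by rewrite /K; field; rewrite !gt_eqF.
    rewrite mulrCA [leRHS]mulrC ler_pM2l ?invr_gt0//.
    have -> : - x ^+ 2 / (1 ^+ 2 *+ 2) = - (x ^+ 2 / 4) + - x ^+ 2 / (2 *+ 2) by field.
    rewrite expRD mulrA ler_pM2r ?expR_gt0// expRN ler_pdivrMr ?expR_gt0//.
    have := @expR_ge_expr (x ^+ 2 / 4) r _.
    rewrite divr_ge0 ?sqr_ge0// => /(_ isT).
    rewrite ler_pdivrMr ?ltr0n ?fact_gt0// expr_div_n ler_pdivrMr ?exprn_gt0//.
    by rewrite exprM => h; apply: le_trans h _; rewrite le_eqVlt; apply/orP; left; apply/eqP; ring.
rewrite (_ : (fun x => _) = (fun x => K%:E * (normal_pdf 0 (Num.sqrt 2) x)%:E)%E)//.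
rewrite ge0_integralZl//.
- by rewrite integral_normal_pdf mule1.
- by apply/measurable_EFinP; exact: measurable_normal_pdf.
- by move=> x _; rewrite lee_fin normal_pdf_ge0.
Qed.

Lemma am_std_normal : all_moments N (fun z : R => z).
Proof.
exists (fun r => 1 + 4 ^+ r * r`!%:R * Num.sqrt 2); split; first exact: measurable_id.
move=> r.
have mx k : measurable_fun setT (fun x : RR => (x ^+ k : R)%:E).
  by apply/measurable_EFinP; apply: measurable_funX; exact: measurable_id.
apply: (@le_trans _ _ (\int[N]_x ((1 : R)%:E + ((x : R) ^+ (2 * r))%:E))%E).
  apply: ge0_le_integral => //; try by move=> w _; rewrite lee_fin exprn_ge0.
  - by apply: measurable_abs_expr; exact: measurable_id.
  - by apply: emeasurable_funD.
  - move=> x _; rewrite -EFinD lee_fin mulnC exprM.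
    rewrite -[x ^+ r ^+ 2]real_normK ?num_real// normrX.
    have := sqr_ge0 (`|x| ^+ r - 1); have : 0 <= `|x| ^+ r by rewrite exprn_ge0.
    by move: (`|x| ^+ r) => u; nra.
rewrite ge0_integralD//; last first.
  by move=> x _; rewrite lee_fin exprM exprn_ge0// sqr_ge0.
rewrite EFinD leeD//; last exact: std_normal_even_moment.
rewrite integral_cst// mul1e; exact: probability_le1.
Qed.

(** Integrals known because the integrand turns one Gaussian density into a
    multiple of another. *)
Lemma std_normal_tilt (m s c : R) (rho : R -> R) : measurable_fun setT rho ->
  (forall x, 0 <= rho x) ->
  (forall x, rho x * normal_pdf 0 1 x = c * normal_pdf m s x) -> 0 <= c ->
  N.-integrable setT (EFin \o rho) /\ Ex N rho = c.
Proof.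
move=> mr r0 rE c0.
have E : (\int[N]_x (rho x)%:E = c%:E)%E.
  rewrite (ge0_integral_normal 1 mr r0).
  under eq_integral do rewrite rE EFinM.
  rewrite ge0_integralZl//.
  - by rewrite integral_normal_pdf mule1.
  - by apply/measurable_EFinP; exact: measurable_normal_pdf.
  - by move=> x _; rewrite lee_fin normal_pdf_ge0.
split; last by rewrite /Ex /Rintegral E.
apply/integrableP; split; first exact/measurable_EFinP.
by under eq_integral do rewrite /= ger0_norm//; rewrite E ltry.
Qed.

(** This moment and the next come from the tangent line inequality for the
    exponential, applied to the ratio of a Gaussian density to the standard one:
    the resulting inequality holds for a family of parameters around the standard
    one, where it is an equality. *)
Lemma std_normal_mean : Ex N (fun z : R => z) = 0.
Proof.
have az := am_std_normal.
have key (m : R) : m * Ex N (fun z : R => z) <= m ^+ 2 / 2.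
  pose rho (x : R) := expR (m * x - m ^+ 2 / 2).
  have mr : measurable_fun setT rho.
    apply: measurableT_comp => //; apply: measurable_funB => //.
  have rE x : rho x * normal_pdf 0 1 x = 1 * normal_pdf m 1 x.
    rewrite mul1r !normal_pdfE ?oner_eq0// /normal_fun mulrCA -expRD subr0.
    by congr (_ * expR _); field.
  have [ir Er] := std_normal_tilt mr (fun x => expR_ge0 _) rE ler01.
  have : Ex N (fun z : R => (1 - m ^+ 2 / 2) + m * z) <= Ex N rho.
    apply: le_Rintegral => //.
      apply: am_integrable; apply: amD; first exact: am_cst.
      by apply: amM => //; exact: am_cst.
    move=> x _; apply: le_trans (expR_ge1Dx _); lra.
  rewrite ExD ?ExZ ?Ex_cst ?Er//; [lra|exact: am_cst|].
  by apply: amM => //; exact: am_cst.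
set e := Ex N _ in key *.
have := key e => h; apply/eqP; rewrite -sqrf_eq0 eq_le sqr_ge0 andbT; lra.
Qed.

Lemma std_normal_second_moment : Ex N (fun z : R => z ^+ 2) = 1.
Proof.
have az := am_std_normal.
have az2 : all_moments N (fun z : R => z ^+ 2) := amX 2 az.
set m := Ex N _.
have m0 : 0 <= m by apply: Ex_ge0 => z; exact: sqr_ge0.
have key (s : R) : 0 < s -> 1 - (s ^- 2 - 1) * m / 2 <= s.
  move=> s0; pose rho (x : R) := expR ((1 - s ^- 2) * (x ^+ 2) / 2).
  have mr : measurable_fun setT rho.
    apply: measurableT_comp => //; apply: measurable_funM => //.
    by apply: measurable_funM => //; exact: measurable_funX.
  have rE x : rho x * normal_pdf 0 1 x = s * normal_pdf 0 s x.
    rewrite !normal_pdfE0// mul1r [RHS]mulrA mulrCA -expRD.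
    have pi0 : Num.sqrt (pi *+ 2) != 0 :> R.
      by rewrite gt_eqF// sqrtr_gt0 mulrn_wgt0// pi_gt0.
    congr (_ * expR _); first by field; rewrite pi0 gt_eqF.
    by field; rewrite gt_eqF.
  have [ir Er] := std_normal_tilt mr (fun x => expR_ge0 _) rE (ltW s0).
  have : Ex N (fun z : R => 1 + ((1 - s ^- 2) / 2) * z ^+ 2) <= Ex N rho.
    apply: le_Rintegral => //.
      apply: am_integrable; apply: amD; first exact: am_cst.
      by apply: amM => //; exact: am_cst.
    by move=> x _; apply: le_trans (expR_ge1Dx _); rewrite /rho mulrAC.
  rewrite ExD ?ExZ ?Ex_cst ?Er//; [|exact: am_cst|].
    by rewrite -/m; lra.
  by apply: amM => //; exact: am_cst.
have s0 : 0 < (m + 1) / 2 by rewrite divr_gt0// ltr_wpDl.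
have := key _ s0; set s := (m + 1) / 2.
have s2 : 0 < s ^+ 2 by rewrite exprn_gt0.
rewrite -(ler_pM2l s2).
have -> : s ^+ 2 * (1 - (s ^- 2 - 1) * m / 2) = s ^+ 2 - (1 - s ^+ 2) * m / 2.
  by field; rewrite gt_eqF.
have -> : m = 2 * s - 1 by rewrite /s; field.
move: s0; rewrite -/s => s0 h.
have : (s - 1) ^+ 2 <= 0 by nra.
by rewrite le_eqVlt ltNge sqr_ge0 orbF sqrf_eq0 subr_eq0 => /eqP ->; ring.
Qed.

End StandardNormal.

Section HeatSemigroup.
Variable R : realType.
Notation N := (@std_normal R).
Implicit Types (g h : R -> R) (M s t v x y : R).

Definition bounded_lipschitz M g :=
  (forall x, `|g x| <= M) /\ (forall x y, `|g x - g y| <= M * `|x - y|).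

Notation bl := bounded_lipschitz.

Lemma bl_ge0 M g : bl M g -> 0 <= M.
Proof. by move=> [gM _]; exact: le_trans (normr_ge0 _) (gM 0). Qed.

Lemma bl_continuous M g : bl M g -> continuous g.
Proof.
move=> gM x; have M0 := bl_ge0 gM; case: gM => _ gL.
apply/cvgrPdist_lt => e e0.
have M1 : 0 < M + 1 by rewrite ltr_wpDl.
exists (e / (M + 1)) => /=; first by rewrite divr_gt0.
move=> y /=; rewrite ltr_pdivlMr// => h.
apply: le_lt_trans (gL _ _) _; apply: le_lt_trans h.
by rewrite mulrC ler_wpM2l//; lra.
Qed.

Lemma bl_measurable M g : bl M g -> measurable_fun setT g.
Proof. by move=> gM; apply: continuous_measurable_fun; exact: bl_continuous gM. Qed.

Lemma am_bl d (T : measurableType d) (P : probability T R) M g (X : T -> R) :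
  bl M g -> measurable_fun setT X -> all_moments P (fun w => g (X w)).
Proof.
move=> gM mX; apply: (@am_bounded _ _ _ P _ M).
  by apply: measurableT_comp => //; exact: bl_measurable gM.
by move=> w; case: gM => gM _; exact: gM.
Qed.

(** The mean of [g] at [x] plus a centred Gaussian variable of variance [t]: the
    solution of the heat equation. Written over one fixed Gaussian law, it makes
    sense at [t] = 0 and is Lipschitz in sqrt t. *)
Definition heat t g x := Ex N (fun z => g (x + Num.sqrt t * z)).

Lemma measurable_affine (x s : R) : measurable_fun [set: measurableTypeR R] (fun z : R => x + s * z).
Proof. by apply: measurable_funD => //; exact: measurable_funM. Qed.

Lemma am_heat M g x t : bl M g -> all_moments N (fun z => g (x + Num.sqrt t * z)).
Proof. by move=> gM; apply: am_bl gM _; exact: measurable_affine. Qed.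

Lemma bl_heat M g t : bl M g -> bl M (heat t g).
Proof.
move=> gM; have M0 := bl_ge0 gM; split => [x|x y].
  apply: le_trans (norm_Ex (am_heat x t gM)) _.
  rewrite -[leRHS](Ex_cst N M); apply: le_Ex.
  - exact/am_norm/(am_heat x t gM).
  - exact: am_cst.
  - by move=> z; case: gM => gM _; exact: gM.
rewrite /heat -ExB; [|exact: (am_heat _ _ gM)|exact: (am_heat _ _ gM)].
have ad : all_moments N (fun z => g (x + Num.sqrt t * z) - g (y + Num.sqrt t * z)).
  by apply: amB; exact: (am_heat _ _ gM).
apply: le_trans (norm_Ex ad) _.
rewrite -[leRHS](Ex_cst N (M * `|x - y|)); apply: le_Ex.
- exact: am_norm.
- exact: am_cst.
- move=> z; case: gM => _ gL; apply: le_trans (gL _ _) _.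
  by rewrite opprD addrACA subrr addr0.
Qed.

Lemma heat0 g x : heat 0 g x = g x.
Proof.
rewrite /heat sqrtr0.
transitivity (Ex N (fun=> g x)); last exact: Ex_cst.
by apply: eq_Ex => z; rewrite mul0r addr0.
Qed.

Lemma Ex_heatE M g x t : bl M g ->
  (\int[N]_z (g (x + Num.sqrt t * z))%:E)%E = (heat t g x)%:E.
Proof.
by move=> gM; rewrite (Ex_EFin (am_heat x t gM)).
Qed.

Lemma blD_cst M g (c : R) : bl M g -> 0 <= c -> bl (M + c) (fun x => g x + c).
Proof.
move=> gM c0; have M0 := bl_ge0 gM; case: gM => gM gL; split => [x|x y].
  by rewrite (le_trans (ler_normD _ _))// (ger0_norm c0) lerD2r.
rewrite opprD addrACA subrr addr0 (le_trans (gL _ _))//.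
by rewrite ler_wpM2r// lerDl.
Qed.

Lemma bl_affine M g (x : R) : bl M g -> bl M (fun y => g (x + y)).
Proof.
move=> [gM gL]; split => [y|y z]; first exact: gM.
by apply: le_trans (gL _ _) _; rewrite opprD addrACA subrr add0r.
Qed.

Lemma heat_affine g x t : heat t g x = heat t (fun y => g (x + y)) 0.
Proof. by rewrite /heat; apply: eq_Ex => z; rewrite add0r. Qed.

Lemma heat_shift M g (c : R) t x : bl M g ->
  heat t (fun y => g y + c) x = heat t g x + c.
Proof.
move=> gM; rewrite /heat ExD ?Ex_cst//; [exact: am_heat gM|exact: am_cst].
Qed.

Lemma ge0_heat_normal M g t : 0 < t -> bl M g -> (forall x, 0 <= g x) ->
  (\int[normal_prob 0 (Num.sqrt t)]_x (g x)%:E)%E = (heat t g 0)%:E.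
Proof.
move=> t0 gM g0; rewrite normal_scale ?sqrtr_gt0//; last exact: bl_continuous gM.
rewrite -(Ex_heatE _ _ gM); apply: eq_integral => z _.
by rewrite add0r mulrC.
Qed.

(** Sums of independent Gaussian variables are Gaussian, by
    [normal_convolution]. That lemma is about nonnegative functions, to which a
    constant shift reduces the bounded ones. *)
Lemma heat_semigroup M g s t x : 0 <= s -> 0 <= t -> bl M g ->
  heat (s + t) g x = heat s (heat t g) x.
Proof.
rewrite le_eqVlt => /predU1P[<- _ _|s0]; first by rewrite add0r heat0.
rewrite le_eqVlt => /predU1P[<- _|t0 gM].
  rewrite addr0; congr (heat s _ x); apply/funext => y; exact/esym/heat0.
have M0 := bl_ge0 gM.
wlog g0 : M g gM M0 / forall x, 0 <= g x.
  move=> H.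
  have := H _ _ (blD_cst gM M0) (addr_ge0 M0 M0).
  rewrite (heat_shift M _ _ gM).
  have -> : heat t (fun y => g y + M) = fun y => heat t g y + M.
    by apply/funext => y; exact: heat_shift gM.
  rewrite (heat_shift M _ _ (bl_heat t gM)) => /(_ _)/addIr; apply.
  by move=> y; case: gM => gM _; have := gM y; rewrite ler_norml; lra.
rewrite heat_affine [RHS]heat_affine.
set G := fun y => g (x + y).
have GM : bl M G by exact: bl_affine.
have G0 y : 0 <= G y by exact: g0.
have hG0 y : 0 <= heat t G y by apply: Ex_ge0 => z; exact: g0.
have -> : (fun y => heat t g (x + y)) = heat t G.
  by apply/funext => y; rewrite /heat; apply: eq_Ex => z; rewrite /G addrA.
apply: EFin_inj.
apply: etrans (esym (ge0_heat_normal (addr_gt0 s0 t0) GM G0)) _.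
apply: etrans _ (ge0_heat_normal s0 (bl_heat t GM) hG0).
have s'0 : 0 < Num.sqrt s by rewrite sqrtr_gt0.
have t'0 : 0 < Num.sqrt t by rewrite sqrtr_gt0.
have st : Num.sqrt (s + t) = Num.sqrt (Num.sqrt s ^+ 2 + Num.sqrt t ^+ 2).
  by rewrite !sqr_sqrtr// ltW.
rewrite st; apply: etrans (esym (normal_convolution s'0 t'0 (bl_continuous GM) G0)) _.
apply: eq_integral => y _.
apply: etrans (ge0_heat_normal t0 (bl_affine y GM) (fun z => G0 _)) _.
by congr (_%:E); exact/esym/heat_affine.
Qed.

Lemma integral_gaussian_law M g v : 0 <= v -> bl M g ->
  (\int[gaussian_law v]_x (g x)%:E)%E = (heat v g 0)%:E.
Proof.
move=> v0 gM; rewrite /gaussian_law; case: eqVneq => [->|vn0].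
  rewrite heat0 integral_dirac// ?diracT ?mul1e//.
  by apply/measurable_EFinP; exact: bl_measurable gM.
have {v0 vn0} v0 : 0 < v by rewrite lt_neqAle eq_sym vn0.
have M0 := bl_ge0 gM.
have h0 x : 0 <= g x + M by case: gM => gM _; have := gM x; rewrite ler_norml; lra.
have ag : all_moments (normal_prob 0 (Num.sqrt v)) g.
  by apply: (@am_bounded _ _ _ _ _ M); [exact: bl_measurable gM|case: gM].
have E := ge0_heat_normal v0 (blD_cst gM M0) h0.
rewrite (heat_shift M v 0 gM) (Ex_EFin (amD ag (am_cst _ M))) in E.
move: E => [] /eqP; rewrite ExD//; last exact: am_cst.
by rewrite Ex_cst => /eqP/addIr E; rewrite (Ex_EFin ag) E.
Qed.

(** The test functions of the replacement argument; one constant serves for all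
    bounds. Only the expansion is recorded, not that [h1] and [h2] are
    derivatives, which makes stability under Gaussian averages immediate. *)
Definition taylor3 M h h1 h2 := [/\ bl M h, bl M h1, bl M h2 &
  forall x y, `|h (x + y) - (h x + h1 x * y + h2 x * (y ^+ 2 / 2))| <= M * `|y| ^+ 3].

Lemma taylor3_heat M h h1 h2 t : taylor3 M h h1 h2 ->
  taylor3 M (heat t h) (heat t h1) (heat t h2).
Proof.
move=> [hM h1M h2M hT]; split; try exact: bl_heat.
move=> x y; have M0 := bl_ge0 hM.
have a0 := am_heat x t hM; have a1 := am_heat x t h1M; have a2 := am_heat x t h2M.
have axy := am_heat (x + y) t hM.
have ay : all_moments N (fun z => h (x + Num.sqrt t * z) + y * h1 (x + Num.sqrt t * z) +
   (y ^+ 2 / 2) * h2 (x + Num.sqrt t * z)).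
  by apply: amD; [apply: amD => //|]; apply: amM => //; exact: am_cst.
have -> : heat t h (x + y) - (heat t h x + heat t h1 x * y + heat t h2 x * (y ^+ 2 / 2)) =
   Ex N (fun z => h (x + y + Num.sqrt t * z) - (h (x + Num.sqrt t * z) +
      y * h1 (x + Num.sqrt t * z) + (y ^+ 2 / 2) * h2 (x + Num.sqrt t * z))).
  rewrite ExB// ExD; last 2 first.
  - by apply: amD => //; apply: amM => //; exact: am_cst.
  - by apply: amM => //; exact: am_cst.
  rewrite ExD//; last by apply: amM => //; exact: am_cst.
  by rewrite !ExZ// /heat; ring.
have ad := amB axy ay.
apply: le_trans (norm_Ex ad) _.
rewrite -[leRHS](Ex_cst N (M * `|y| ^+ 3)); apply: le_Ex.
- exact: am_norm.
- exact: am_cst.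
- move=> z; apply: le_trans (hT (x + Num.sqrt t * z) y).
  by rewrite (addrAC x y) (mulrC y) (mulrC (y ^+ 2 / 2)).
Qed.

Definition normal_third : R := Ex N (fun z => `|z| ^+ 3).

(** Taylor expansion under a Gaussian average: the first two moments of the
    law give the first two terms. *)
Lemma heat_taylor M h h1 h2 v x : taylor3 M h h1 h2 -> 0 <= v ->
  `|heat v h x - (h x + h2 x * (v / 2))| <= M * (Num.sqrt v ^+ 3 * normal_third).
Proof.
move=> [hM h1M h2M hT] v0; have M0 := bl_ge0 hM.
have az := am_std_normal R.
have a1 : all_moments N (fun z : R => (h1 x * Num.sqrt v) * z).
  by apply: amM => //; exact: am_cst.
have a2 : all_moments N (fun z : R => (h2 x * (v / 2)) * z ^+ 2).
  by apply: amM; [exact: am_cst|exact: amX].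
have a0 := am_heat x v hM.
have a012 : all_moments N (fun z : R => (h x + (h1 x * Num.sqrt v) * z) + (h2 x * (v / 2)) * z ^+ 2).
  by apply: amD => //; apply: amD => //; exact: am_cst.
have -> : heat v h x - (h x + h2 x * (v / 2)) =
    Ex N (fun z => h (x + Num.sqrt v * z) -
      ((h x + (h1 x * Num.sqrt v) * z) + (h2 x * (v / 2)) * z ^+ 2)).
  rewrite ExB// ExD//; last by apply: amD => //; exact: am_cst.
  rewrite ExD//; last exact: am_cst.
  rewrite Ex_cst !ExZ//; last exact: amX.
  by rewrite std_normal_mean std_normal_second_moment /heat; ring.
apply: le_trans (norm_Ex (amB a0 a012)) _.
rewrite -!ExZ; last 2 first.
- by apply: amM; [exact: am_cst|exact/amX/am_norm].
- exact/amX/am_norm.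
apply: le_Ex.
- exact: am_norm (amB a0 a012).
- by apply: amM; [exact: am_cst|apply: amM; [exact: am_cst|exact/amX/am_norm]].
move=> z.
have -> : h x + h1 x * Num.sqrt v * z + h2 x * (v / 2) * z ^+ 2 =
    h x + h1 x * (Num.sqrt v * z) + h2 x * ((Num.sqrt v * z) ^+ 2 / 2).
  by rewrite exprMn sqr_sqrtr//; ring.
apply: le_trans (hT _ _) _.
by rewrite normrM exprMn (ger0_norm (sqrtr_ge0 v)).
Qed.

End HeatSemigroup.

(** * The replacement argument of Lindeberg *)

Section Lindeberg.
Context d (T : measurableType d) (R : realType) (P : probability T R).
Notation N := (@std_normal R).

(** [Y] is replaced by an independent Gaussian variable of the same variance: the
    Taylor expansions of the two sides agree up to the second order, and only
    the third moments remain. *)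
Lemma lindeberg_step (M : R) h h1 h2 (W Y : T -> R) (v : R) : taylor3 M h h1 h2 ->
  measurable_fun setT W -> all_moments P Y -> Ex P Y = 0 -> indep2 P W Y ->
  v = Ex P (fun w => Y w ^+ 2) ->
  `|Ex P (fun w => h (W w + Y w)) - Ex P (fun w => heat v h (W w))| <=
  M * (Ex P (fun w => `|Y w| ^+ 3) + Num.sqrt v ^+ 3 * normal_third R).
Proof.
move=> hT3 mW aY Y0 WY vE; have [hM h1M h2M hT] := hT3; have M0 := bl_ge0 hM.
have v0 : 0 <= v by rewrite vE; apply: Ex_ge0 => w; exact: sqr_ge0.
have mY := am_measurable aY.
have aY2 : all_moments P (fun w => Y w ^+ 2) by exact: amX.
have aY3 : all_moments P (fun w => `|Y w| ^+ 3) by exact/amX/am_norm.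
have a0 := am_bl P hM mW; have a1 := am_bl P h1M mW; have a2 := am_bl P h2M mW.
have ah := am_bl P (bl_heat v hM) mW.
have a01 : all_moments P (fun w => h (W w + Y w)).
  by apply: am_bl hM _; exact: measurable_funD.
have a1Y : all_moments P (fun w => h1 (W w) * Y w) by exact: amM.
have a2Y : all_moments P (fun w => h2 (W w) * (Y w ^+ 2)) by exact: amM.
have E1 : Ex P (fun w => h1 (W w) * Y w) = 0.
  rewrite (Ex_indep2 WY (bl_measurable h1M) (@measurable_id _ _ _) a1 aY).
  by rewrite [X in _ * X](_ : _ = 0) ?mulr0.
have E2 : Ex P (fun w => h2 (W w) * Y w ^+ 2) = Ex P (fun w => h2 (W w)) * v.
  have m2 : measurable_fun [set: R] (fun y : R => y ^+ 2).
    by apply: measurable_funX; exact: measurable_id.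
  by rewrite vE; exact: (Ex_indep2 WY (bl_measurable h2M) m2 a2 aY2).
pose q w := h (W w) + h1 (W w) * Y w + h2 (W w) * (Y w ^+ 2) * 2^-1.
have aq : all_moments P q.
  by apply: amD; [exact: amD|apply: amM => //; exact: am_cst].
have Eq : Ex P q = Ex P (fun w => h (W w) + (v / 2) * h2 (W w)).
  have ah2 : all_moments P (fun w => h2 (W w) * Y w ^+ 2 * 2^-1).
    by apply: amM => //; exact: am_cst.
  have ah3 : all_moments P (fun w => (v / 2) * h2 (W w)).
    by apply: amM => //; exact: am_cst.
  rewrite /q !ExD//; last exact: amD.
  rewrite E1 addr0; congr (_ + _).
  rewrite (_ : (fun w => h2 (W w) * Y w ^+ 2 * 2^-1) =
    (fun w => 2^-1 * (h2 (W w) * Y w ^+ 2))); last by apply/funext => w; ring.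
  by rewrite !ExZ// E2; ring.
have first : `|Ex P (fun w => h (W w + Y w)) - Ex P q| <=
    M * Ex P (fun w => `|Y w| ^+ 3).
  rewrite -ExB//; apply: le_trans (norm_Ex (amB a01 aq)) _.
  rewrite -ExZ//; apply: le_Ex.
  - exact/am_norm/amB.
  - by apply: amM => //; exact: am_cst.
  by move=> w; rewrite /q -mulrA; exact: hT.
have second : `|Ex P q - Ex P (fun w => heat v h (W w))| <=
    M * (Num.sqrt v ^+ 3 * normal_third R).
  have aq' : all_moments P (fun w => h (W w) + v / 2 * h2 (W w)).
    by apply: amD => //; apply: amM => //; exact: am_cst.
  rewrite Eq -ExB//; apply: le_trans (norm_Ex (amB aq' ah)) _.
  rewrite -[leRHS](Ex_cst P); apply: le_Ex.
  - exact/am_norm/amB.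
  - exact: am_cst.
  by move=> w; rewrite distrC (mulrC (v / 2)); exact: heat_taylor hT3 v0.
rewrite mulrDr (le_trans (ler_distD (Ex P q) _ _))//.
exact: lerD.
Qed.

(** The last summand is replaced by a Gaussian variable, which is absorbed in
    the test function as a heat flow; the induction then applies to the new test
    function, of the same class with the same constant. So the Gaussian
    variables never have to be realized next to the [Y j]. *)
Lemma lindeberg (M : R) h h1 h2 (Y : nat -> T -> R) (v : nat -> R) K : taylor3 M h h1 h2 ->
  (forall k, all_moments P (Y k)) -> (forall k, Ex P (Y k) = 0) ->
  (forall k, indep2 P (fun w => \sum_(j < k) Y j w) (Y k)) ->
  (forall k, v k = Ex P (fun w => Y k w ^+ 2)) ->
  `|Ex P (fun w => h (\sum_(j < K) Y j w)) - heat (\sum_(j < K) v j) h 0| <=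
  M * \sum_(j < K) (Ex P (fun w => `|Y j w| ^+ 3) +
                    Num.sqrt (v j) ^+ 3 * normal_third R).
Proof.
move=> hT aY Y0 iY vE.
have v0 k : 0 <= v k by rewrite vE; apply: Ex_ge0 => w; exact: sqr_ge0.
elim: K h h1 h2 hT => [|K IH] h h1 h2 hT.
  under eq_fun do rewrite big_ord0.
  by rewrite Ex_cst !big_ord0 heat0 subrr normr0 mulr0.
under eq_fun do rewrite big_ord_recr/=.
have [hM _ _ _] := hT.
have aW : all_moments P (fun w => \sum_(j < K) Y j w) by exact: am_sum.
have step := lindeberg_step hT (am_measurable aW) (aY K) (Y0 K) (iY K) (vE K).
have := IH _ _ _ (taylor3_heat (v K) hT).
rewrite !big_ord_recr/= -(heat_semigroup 0 _ _ hM)//; last exact: sumr_ge0.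
move=> rest.
rewrite [leRHS]mulrDr [leRHS]addrC.
exact: le_trans (ler_distD _ _ _) (lerD step rest).
Qed.

End Lindeberg.

(** * Test functions *)

Section TestFunctions.
Variable R : realType.
Implicit Types (p q : {poly R}) (x y : R).

(** Test functions are polynomials in the logistic function: it is bounded and
    injective, so that they separate laws by the theorem of Weierstrass, and it
    solves y' = y - y ^ 2, so that their derivatives are of the same form. *)
Definition logistic x : R := (1 + expR (- x))^-1.
Notation psi := logistic.

Lemma logistic_den_gt0 x : 0 < 1 + expR (- x).
Proof. by rewrite ltr_pwDl// expR_ge0. Qed.

Lemma logistic_gt0 x : 0 < psi x.
Proof. by rewrite invr_gt0 logistic_den_gt0. Qed.

Lemma logistic_lt1 x : psi x < 1.
Proof. by rewrite invf_lt1 ?logistic_den_gt0// ltrDl expR_gt0. Qed.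

Lemma is_derive_logistic x : is_derive x 1 psi (psi x - psi x ^+ 2).
Proof.
have d0 := logistic_den_gt0 x.
have h : is_derive x 1 (fun y : R => 1 + expR (- y)) (- expR (- x)).
  apply: is_derive_eq.
  by rewrite ?add0r ?mulN1r ?mulrN ?mulr1 ?mul1r.
apply: (@is_derive_eq _ _ _ _ _ _ _ _ (is_deriveV _ h)).
  by rewrite gt_eqF.
rewrite /psi /GRing.scale/=; field; rewrite gt_eqF//.
Qed.

(** The derivation of polynomials that corresponds to the derivative of their
    composition with the logistic function. *)
Definition derivL p : {poly R} := p^`() * ('X - 'X^2).

Lemma is_derive_horner_logistic p x :
  is_derive x 1 (fun y => p.[psi y]) (derivL p).[psi x].
Proof.
apply: (@is_derive_eq _ _ _ _ _ _ _ _ (is_derive1_comp _ (is_derive_logistic x))).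
by rewrite /derivL !hornerE.
Qed.

Definition coef_sum p := \sum_(i < size p) `|p`_i|.

Lemma horner_unit_le p y : 0 <= y <= 1 -> `|p.[y]| <= coef_sum p.
Proof.
move=> /andP[y0 y1]; rewrite horner_coef; apply: le_trans (ler_norm_sum _ _ _) _.
apply: ler_sum => i _; rewrite normrM ler_piMr// ger0_norm ?exprn_ge0//.
exact: exprn_ile1.
Qed.

Lemma horner_logistic_le p x : `|p.[psi x]| <= coef_sum p.
Proof. by apply: horner_unit_le; rewrite !ltW ?logistic_gt0 ?logistic_lt1. Qed.

(** Repeated use turns a bound on a derivative into Taylor remainders. *)
Lemma mean_value_le (F F' : R -> R) (C : R) k x : F 0 = 0 ->
  (forall y, is_derive y 1 F (F' y)) -> (forall y, `|F' y| <= C * `|y| ^+ k) ->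
  `|F x| <= C * `|x| ^+ k.+1.
Proof.
move=> F0 dF F'C.
have cF (a b : R) : {within `[a, b], continuous F}.
  apply: continuous_subspaceT => y; apply: differentiable_continuous.
  by apply/derivable1_diffP; case: (dF y).
have C0 : 0 <= C by have := F'C 1; rewrite normr1 expr1n mulr1; exact: le_trans.
suff [c cx ->] : exists2 c, `|c| <= `|x| & F x = F' c * x.
  rewrite normrM exprSr mulrA ler_wpM2r//; apply: le_trans (F'C c) _.
  by rewrite ler_wpM2l// lerXn2r ?nnegrE.
have [x0|x0] := lerP 0 x.
- have [c] := MVT_segment x0 (fun y _ => dF y) (cF 0 x).
  rewrite in_itv/= F0 !subr0 => /andP[c0 cx] E; exists c => //.
  by rewrite !ger0_norm.
- have [c] := MVT_segment (ltW x0) (fun y _ => dF y) (cF x 0).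
  rewrite in_itv/= F0 !sub0r => /andP[xc c0] E; exists c.
    by rewrite !ler0_norm ?lerN2// ltW.
  by apply: oppr_inj; rewrite E mulrN.
Qed.

Lemma is_derive_addl x y : is_derive y 1 (fun s : R => x + s) 1.
Proof.
by apply: is_derive_eq; rewrite add0r mulr1.
Qed.

Lemma is_derive_horner_shift p x y :
  is_derive y 1 (fun s => p.[psi (x + s)]) (derivL p).[psi (x + y)].
Proof.
apply: is_derive_eq (is_derive1_comp (f := fun z => p.[psi z])
  (is_derive_horner_logistic p (x + y)) (is_derive_addl x y)) _.
by rewrite mulr1.
Qed.

Lemma bl_horner_logistic p M : coef_sum p <= M -> coef_sum (derivL p) <= M ->
  bounded_lipschitz M (fun x => p.[psi x]).
Proof.
move=> pM dpM; split=> [x|x y]; first exact: le_trans (horner_logistic_le _ _) pM.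
have := @mean_value_le (fun t => p.[psi (y + t)] - p.[psi y])
   (fun t => (derivL p).[psi (y + t)]) M 0 (x - y).
rewrite addr0 subrr => /(_ erefl); rewrite (addrC y) subrK expr1; apply.
- move=> t; have h1 := is_derive_horner_shift p y t.
  by apply: is_derive_eq; rewrite subr0.
- by move=> t; rewrite expr0 mulr1; exact: le_trans (horner_logistic_le _ _) dpM.
Qed.

Lemma taylor3_horner_logistic p : exists M,
  taylor3 M (fun x => p.[psi x]) (fun x => (derivL p).[psi x])
    (fun x => (derivL (derivL p)).[psi x]).
Proof.
pose M := coef_sum p + coef_sum (derivL p) + coef_sum (derivL (derivL p)) +
  coef_sum (derivL (derivL (derivL p))).
have c0 q : 0 <= coef_sum q by exact: sumr_ge0.
have [M0 M1 M2 M3] : [/\ coef_sum p <= M, coef_sum (derivL p) <= M,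
   coef_sum (derivL (derivL p)) <= M & coef_sum (derivL (derivL (derivL p))) <= M].
  have := c0 p; have := c0 (derivL p); have := c0 (derivL (derivL p)).
  have := c0 (derivL (derivL (derivL p))); rewrite /M.
  move: (coef_sum _) (coef_sum _) (coef_sum _) (coef_sum _) => *.
  by split; lra.
have B2 : bounded_lipschitz M (fun x => (derivL (derivL p)).[psi x]).
  exact: bl_horner_logistic.
exists M; split => //; try exact: bl_horner_logistic.
move=> x y.
have comp q t := is_derive_horner_shift q x t.
pose F1 t := (derivL p).[psi (x + t)] - ((derivL p).[psi x] + (derivL (derivL p)).[psi x] * t).
pose F0 t := p.[psi (x + t)] - (p.[psi x] + (derivL p).[psi x] * t
   + (derivL (derivL p)).[psi x] * (t ^+ 2 / 2)).
have h1 t : `|F1 t| <= M * `|t| ^+ 2.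
  apply: (mean_value_le (F' := fun t => (derivL (derivL p)).[psi (x + t)] - (derivL (derivL p)).[psi x])).
  - by rewrite /F1 addr0 mulr0 addr0 subrr.
  - move=> s; have := comp (derivL p) s => h; apply: is_derive_eq.
    rewrite /GRing.scale/=; ring.
  - move=> s; rewrite expr1; case: B2 => _ /(_ (x + s) x); by rewrite (addrC x) addrK.
apply: (mean_value_le (F := F0) (F' := F1)) => //.
- by rewrite /F0 addr0 mulr0 expr0n/= mul0r mulr0 !addr0 subrr.
- move=> s; have := comp p s => h; apply: is_derive_eq.
  by rewrite /F1 /GRing.scale/=; field.
Qed.

(** On [-L, L] the logistic function is inverted and Weierstrass approximation
    applied in the new variable; clamping that variable to the image of [-L, L]
    keeps the global bound up to [e]. *)
Lemma logistic_approximation (g : R -> R) B L e : continuous g ->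
  (forall x, `|g x| <= B) -> 0 < e -> exists p,
  (forall x, `|p.[psi x]| <= B + e) /\
  (forall x, `|x| <= L -> `|g x - p.[psi x]| <= e).
Proof.
move=> cg gB e0.
pose lo := psi (- `|L|); pose hi := psi `|L|.
pose cl y := Num.min (Num.max y lo) hi.
pose unl y : R := ln (y / (1 - y)).
have psi_mono : {homo psi : x y / x <= y}.
  move=> x y xy; rewrite /psi lef_pV2 ?posrE ?logistic_den_gt0//.
  by rewrite lerD2l ler_expR lerN2.
have lohi : lo <= hi.
  by apply: psi_mono; rewrite (@le_trans _ _ 0)// oppr_le0.
have cl_in y : lo <= cl y <= hi.
  by rewrite /cl le_min lohi le_max lexx orbT/= ge_min lexx orbT.
have cl01 y : 0 < cl y < 1.
  have /andP[h1 h2] := cl_in y.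
  by rewrite (lt_le_trans (logistic_gt0 _) h1) (le_lt_trans h2 (logistic_lt1 _)).
have unlK x : unl (psi x) = x.
  rewrite /unl /psi -[RHS]expRK expRN; congr ln.
  have := expR_gt0 x; move: (expR x) => E E0; field.
  by apply/and3P; split; rewrite gt_eqF//; lra.
pose G y := g (unl (cl y)).
have cG : continuous G.
  move=> y; apply: continuous_comp; last exact: cg.
  have /andP[y0 y1] := cl01 y.
  have ccl : {for y, continuous cl}.
    by apply: continuous_min; [apply: continuous_max|]; [exact: cvg_id|exact: cvg_cst|exact: cvg_cst].
  apply: (@continuous_comp _ _ _ (fun y => cl y / (1 - cl y)) (@ln R)).
    apply: cvgM => //; apply: cvgV; first by rewrite subr_eq0 gt_eqF.
    by apply: cvgB => //; exact: cvg_cst.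
  by apply: continuous_ln; rewrite divr_gt0// subr_gt0.
have [p hp] := @weierstrass R G 1 e cG ltr01 e0.
have pp x : `|psi x| <= 1 by rewrite ger0_norm ltW ?logistic_gt0 ?logistic_lt1.
exists p; split=> x.
  have -> : p.[psi x] = G (psi x) - (G (psi x) - p.[psi x]) by rewrite subKr.
  by rewrite (le_trans (ler_normB _ _))// lerD// ?gB// hp.
move=> xL; have := hp (psi x) (pp x); congr (`|_ - _| <= e).
have /andP[lx xh] : - `|L| <= x <= `|L|.
  by rewrite -ler_norml (le_trans xL)// ler_norm.
rewrite /G; suff -> : cl (psi x) = psi x by rewrite unlK.
by rewrite /cl max_l ?min_l//; exact: psi_mono.
Qed.

End TestFunctions.

(** * A criterion for convergence to a Gaussian law *)

Lemma gaussian_law_second_moment (R : realType) (v : R) : 0 <= v ->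
  (\int[gaussian_law v]_x (x ^+ 2)%:E <= v%:E)%E.
Proof.
move=> v0; rewrite /gaussian_law; case: eqVneq => [->|vn0].
  rewrite integral_dirac//.
    by rewrite diracT mul1e expr0n.
  by apply/measurable_EFinP; apply: measurable_funX; exact: measurable_id.
have {v0 vn0} v0 : 0 < v by rewrite lt_neqAle eq_sym vn0.
have cX : continuous (fun x : R => x ^+ 2) by move=> x; exact: exprn_continuous.
apply: (@le_trans _ _ (\int[std_normal R]_x (v * x ^+ 2)%:E)%E).
  rewrite normal_scale ?sqrtr_gt0//; last by move=> x; exact: sqr_ge0.
  rewrite le_eqVlt; apply/orP; left; apply/eqP; apply: eq_integral => x _.
  by rewrite exprMn sqr_sqrtr ?ltW// mulrC.
have aZ := amX 2 (am_std_normal R).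
rewrite Ex_EFin; last by apply: amM => //; exact: am_cst.
by rewrite ExZ// std_normal_second_moment mulr1.
Qed.

(** Tightness in the form used below: an error that is only controlled
    quadratically at infinity is controlled in mean by the second moment. *)
Lemma Ex_tight_le d (T : measurableType d) (R : realType) (P : probability T R)
    (X : T -> R) (g h : R -> R) (B C e K V : R) :
  measurable_fun setT X -> measurable_fun setT g -> measurable_fun setT h ->
  (forall x, `|g x| <= B) -> (forall x, `|h x| <= C) ->
  0 <= e -> 0 <= K -> (forall x, `|g x - h x| <= e + K * x ^+ 2) ->
  (\int[P]_w (X w ^+ 2)%:E <= V%:E)%E ->
  `|Ex P (g \o X) - Ex P (h \o X)| <= e + K * V.
Proof.
move=> mX mg mh gB hC e0 K0 gh X2.
have ag : all_moments P (g \o X).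
  by apply: (@am_bounded _ _ _ _ _ B) => [|w]; [exact: measurableT_comp|exact: gB].
have ah : all_moments P (h \o X).
  by apply: (@am_bounded _ _ _ _ _ C) => [|w]; [exact: measurableT_comp|exact: hC].
rewrite -ExB//; have agh := amB ag ah.
apply: le_trans (norm_Ex agh) _.
rewrite -lee_fin -(Ex_EFin (am_norm agh)).
have mX2 : measurable_fun setT (fun w => (X w ^+ 2)%:E).
  by apply/measurable_EFinP; exact: measurable_funX.
apply: (@le_trans _ _ (\int[P]_w (e%:E + K%:E * (X w ^+ 2)%:E))%E).
  apply: ge0_le_integral => //.
  - by apply/measurable_EFinP; exact: am_measurable (am_norm agh).
  - by apply: emeasurable_funD => //; exact: measurable_funeM.
  - by move=> w _; rewrite -EFinM -EFinD lee_fin; exact: gh.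
rewrite ge0_integralD//; last 2 first.
- by move=> w _; rewrite mule_ge0// lee_fin ?sqr_ge0.
- exact: measurable_funeM.
rewrite integral_cst// ge0_integralZl//; last first.
  by move=> w _; rewrite lee_fin sqr_ge0.
by rewrite EFinD EFinM leeD ?lee_wpmul2l ?lee_fin// -[leRHS]mule1 lee_wpmul2l ?lee_fin// probability_le1.
Qed.

(** Uniformly bounded second moments keep the mass in compact sets, where
    polynomials in the logistic function approximate all continuous functions. *)
Lemma cvg_gaussian_criterion (R : realType) (d : nat -> measure_display)
    (T : forall n, measurableType (d n)) (P : forall n, probability (T n) R)
    (X : forall n, T n -> R) (v V : R) :
  0 <= v -> (forall n, measurable_fun setT (X n)) ->
  (forall n, (0 < n)%N -> (\int[P n]_w (X n w ^+ 2)%:E <= V%:E)%E) ->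
  (forall p : {poly R}, (fun n => Ex (P n) (fun w => p.[logistic (X n w)])) @ \oo -->
     heat v (fun x => p.[logistic x]) 0) ->
  cvg_in_distribution P X (gaussian_law v).
Proof.
move=> v0 mX XV cvgp; split=> // g cg [B gB].
have B0 : 0 <= B := le_trans (normr_ge0 _) (gB 0).
have mg : measurable_fun setT g by exact: continuous_measurable_fun.
pose G := gaussian_law v.
have aG : all_moments G (g : measurableTypeR R -> R).
  by apply: (@am_bounded _ _ _ _ _ B).
have -> : (\int[G]_x (g x)%:E)%E = (Ex G (g : measurableTypeR R -> R))%:E by exact: Ex_EFin.
have agX n : all_moments (P n) (g \o X n).
  by apply: (@am_bounded _ _ _ _ _ B) => [|w]; [exact: measurableT_comp|exact: gB].
have -> : (fun n => 'E_(P n)[g \o X n]%E) = (fun n => (Ex (P n) (g \o X n))%:E).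
  by apply/funext => n; rewrite unlock (Ex_EFin (agX n)).
apply: cvg_EFin; first exact: nearW.
rewrite [X in X @ _](_ : _ = (fun n => Ex (P n) (g \o X n)))//.
apply/cvgrPdist_le => eps eps0.
pose e := eps / 6; have e0 : 0 < e by rewrite divr_gt0.
pose W := Num.max V v; have W0 : 0 <= W by rewrite le_max v0 orbT.
have D0 : 0 <= 2 * B + e by rewrite addr_ge0 ?mulr_ge0// ltW.
pose L := 1 + (2 * B + e) * W / e.
have L1 : 1 <= L.
  by rewrite lerDl mulr_ge0 ?invr_ge0 ?(ltW e0)// mulr_ge0.
have [p [pB pg]] := logistic_approximation L cg gB e0.
pose h x := p.[logistic x].
have [M [hM _ _ _]] := taylor3_horner_logistic p.
have mh : measurable_fun setT h by exact: bl_measurable hM.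
pose K := (2 * B + e) / L ^+ 2.
have L20 : 0 < L ^+ 2 by rewrite exprn_gt0// (lt_le_trans ltr01).
have K0 : 0 <= K by rewrite divr_ge0 ?(ltW L20)// addr_ge0 ?mulr_ge0 ?(ltW e0).
have gh x : `|g x - h x| <= e + K * x ^+ 2.
  have [xL|Lx] := lerP `|x| L.
    by apply: le_trans (pg _ xL) _; rewrite lerDl mulr_ge0 ?sqr_ge0.
  apply: (@le_trans _ _ (2 * B + e)).
    by rewrite (le_trans (ler_normB _ _))//; have := gB x; have := pB x; rewrite -/(h x); lra.
  rewrite -[leLHS]add0r lerD ?(ltW e0)// /K mulrAC ler_pdivlMr//.
  rewrite ler_wpM2l//.
  rewrite -[x ^+ 2]real_normK ?num_real// lerXn2r ?nnegrE ?(ltW Lx)//.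
  exact: le_trans L1.
have KW : K * W <= e.
  rewrite /K mulrAC ler_pdivrMr//.
  have LL : L <= L ^+ 2 by rewrite expr2 ler_peMl// (le_trans _ L1).
  apply: (@le_trans _ _ (e * L)); last by rewrite ler_pM2l.
  by rewrite /L mulrDr mulrCA divff ?gt_eqF// !mulr1 lerDr ltW.
have eV n : (0 < n)%N -> `|Ex (P n) (g \o X n) - Ex (P n) (h \o X n)| <= 2 * e.
  move=> n0; have XW : (\int[P n]_w (X n w ^+ 2)%:E <= W%:E)%E.
    by apply: le_trans (XV n n0) _; rewrite lee_fin le_max lexx.
  have := Ex_tight_le (mX n) mg mh gB pB (ltW e0) K0 gh XW; lra.
have eG : `|Ex G (g : measurableTypeR R -> R) - heat v h 0| <= 2 * e.
  have XW : (\int[G]_w (w ^+ 2)%:E <= W%:E)%E.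
    by apply: le_trans (gaussian_law_second_moment v0) _; rewrite lee_fin le_max lexx orbT.
  have -> : heat v h 0 = Ex G (h \o idfun).
    apply: EFin_inj; rewrite -(integral_gaussian_law v0 hM).
    exact: (Ex_EFin (am_bl G hM (@measurable_id _ _ _))).
  have := @Ex_tight_le _ (measurableTypeR R) R G idfun g h B (B + e) e K W (@measurable_id _ _ _) mg mh gB pB (ltW e0) K0 gh XW.
  rewrite (_ : g \o idfun = g)//; lra.
have := cvgp p => /cvgrPdist_le/(_ e e0)[N _ hN].
exists N.+1 => //= n Nn.
have n0 : (0 < n)%N by exact: leq_ltn_trans Nn.
have := hN n (ltnW Nn) => /= h1.
have := eV n n0; move: eG h1; rewrite /h /comp.
set a := Ex G _; set b := heat _ _ _; set c := Ex (P n) _; set c' := Ex (P n) _.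
rewrite !ler_norml /e => /andP[? ?] /andP[? ?] /andP[? ?].
by apply/andP; split; lra.
Qed.

(** * The integrand of the Gamma function *)

Section GammaIntegral.
Variable R : realType.
Notation mu := (@lebesgue_measure R).
Implicit Types (s x : R) (k m : nat).

(** The only singularity of the Gamma integrand; the integral is computed on
    [1 / n, 1] and passed to the limit by monotone convergence. *)
Lemma powR_integral_near0 s : 0 < s ->
  (\int[mu]_(x in `]0%R, 1%R]) (x `^ (s - 1))%:E <= (s^-1)%:E)%E.
Proof.
move=> s0.
have mp : measurable_fun setT (fun x : R => (x `^ (s - 1))%:E).
  by apply/measurable_EFinP; exact: measurable_powR.
have cp (x p : R) : 0 < x -> {for x, continuous (fun y : R => y `^ p)}.
  move=> x0; apply: differentiable_continuous; apply/derivable1_diffP.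
  by apply: derivable_powR; rewrite in_itv/= x0.
pose F (i : nat) : set R := `[i.+1%:R^-1, 1]%classic.
have F_le i : (\int[mu]_(x in F i) (x `^ (s - 1))%:E <= (s^-1)%:E)%E.
  case: i => [|i].
    by rewrite /F invr1 set_itv1 integral_set1 lee_fin invr_ge0 ltW.
  have i0 : 0 < i.+2%:R^-1 :> R by rewrite invr_gt0.
  have i1 : i.+2%:R^-1 < 1 :> R by rewrite invf_lt1// ltr1n.
  rewrite (@continuous_FTC2 _ _ (fun x => s^-1 * x `^ s) _ _ i1).
  - rewrite -EFinB lee_fin powR1 mulr1 lerBlDr lerDl mulr_ge0 ?powR_ge0//.
    by rewrite invr_ge0 ltW.
  - apply: continuous_in_subspaceT => x; rewrite inE/= in_itv/= => /andP[xi _].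
    by apply: cp; exact: lt_le_trans xi.
  - split.
    + move=> x; rewrite in_itv/= => /andP[xi _].
      apply: derivableM; first exact: derivable_cst.
      by apply: derivable_powR; rewrite in_itv/= (lt_trans i0).
    + apply: cvg_at_right_filter; apply: cvgM; first exact: cvg_cst.
      exact: cp.
    + apply: cvg_at_left_filter; apply: cvgM; first exact: cvg_cst.
      exact: cp.
  - move=> x; rewrite in_itv/= => /andP[xi _]; have x0 := lt_trans i0 xi.
    rewrite derive1Ml; last by apply: derivable_powR; rewrite in_itv/= x0.
    by rewrite powR_derive1 ?in_itv/= ?x0// mulrA mulVf ?mul1r// gt_eqF.
have FU : `]0%R, 1%R]%classic = \bigcup_i F i.
  apply/seteqP; split=> x /=.
    rewrite in_itv/= => /andP[x0 x1]; have [N hN] := ltr_add_invr x0.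
    exists N => //; rewrite /F/= in_itv/= x1 andbT.
    by move: hN; rewrite add0r => /ltW.
  move=> [i _]; rewrite /F/= !in_itv/= => /andP[ix ->]; rewrite andbT.
  by apply: lt_le_trans ix; rewrite invr_gt0.
have ndF : nondecreasing_seq F.
  move=> i j ij; apply/subsetPset => x; rewrite /F/= !in_itv/= => /andP[ix ->].
  rewrite andbT; apply: le_trans ix; rewrite lef_pV2 ?posrE// ler_nat.
  by rewrite ltnS.
have mF i : measurable (F i) by exact: measurable_itv.
have mpF i : measurable_fun (F i) (fun x : R => (x `^ (s - 1))%:E).
  exact: measurable_funTS.
have p0 i x : F i x -> (0 <= (x `^ (s - 1))%:E)%E by rewrite lee_fin powR_ge0.
have h := @ge0_nondecreasing_set_cvg_integral _ (measurableTypeR R) R F _ (@lebesgue_measure R) ndF mF mpF p0.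
rewrite FU -(cvg_lim _ h)//; apply: lime_le; last exact: nearW.
apply: ereal_nondecreasing_is_cvgn.
exact: ge0_nondecreasing_set_nondecreasing_integral.
Qed.

Definition gamma_weight s x : R :=
  if 0 < x then x `^ (s - 1) * expR (- x) else 0.

Lemma gamma_weight_ge0 s x : 0 <= gamma_weight s x.
Proof. by rewrite /gamma_weight; case: ifP => // _; rewrite mulr_ge0 ?powR_ge0 ?expR_ge0. Qed.

Lemma measurable_gamma_weight s : measurable_fun setT (gamma_weight s).
Proof.
apply: measurable_fun_ifT => //; first exact: measurable_fun_ltr.
apply: measurable_funM; first exact: measurable_powR.
by apply: measurableT_comp => //; exact: measurable_oppr.
Qed.

Lemma gamma_weight_expr s x k : x ^+ k * gamma_weight s x = gamma_weight (s + k%:R) x.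
Proof.
rewrite /gamma_weight; case: ifPn => x0; last by rewrite mulr0.
rewrite mulrA -powR_mulrn ?ltW// -powRD; last by rewrite (gt_eqF x0) implybT.
by congr (_ `^ _ * _); ring.
Qed.

(** An integrable majorant of the Gamma integrand for all parameters between
    [s] and [m + 1]: the worst power near 0, and half of the exponential decay
    elsewhere, the other half paying for the power. *)
Definition gamma_dom s m x : R :=
  (if 0 < x <= 1 then x `^ (s - 1) else 0) +
  (2 ^+ m * m`!%:R * 2) * exponential_pdf 2^-1 x.

Lemma gamma_dom_ge0 s m x : 0 <= gamma_dom s m x.
Proof.
rewrite addr_ge0 ?mulr_ge0 ?exprn_ge0 ?exponential_pdf_ge0//.
by case: ifP => // _; exact: powR_ge0.
Qed.

Lemma measurable_gamma_dom s m : measurable_fun setT (gamma_dom s m).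
Proof.
apply: measurable_funD.
  apply: measurable_fun_ifT => //.
  by apply: measurable_and; [exact: measurable_fun_ltr|exact: measurable_fun_ler].
by apply: measurable_funM => //; exact: measurable_exponential_pdf.
Qed.

Lemma gamma_dom_integral s m : 0 < s ->
  (\int[mu]_x (gamma_dom s m x)%:E <= (s^-1 + 2 ^+ m * m`!%:R * 2)%:E)%E.
Proof.
move=> s0; have K0 : 0 <= 2 ^+ m * m`!%:R * 2 :> R by rewrite !mulr_ge0// exprn_ge0.
have me := @measurable_exponential_pdf R 2^-1.
have e0 x : 0 <= exponential_pdf 2^-1 x :> R by exact: exponential_pdf_ge0.
under eq_integral do rewrite EFinD.
rewrite ge0_integralD//; last 4 first.
- by move=> x _; rewrite lee_fin; case: ifP => // _; exact: powR_ge0.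
- apply/measurable_EFinP; apply: measurable_fun_ifT => //.
  by apply: measurable_and; [exact: measurable_fun_ltr|exact: measurable_fun_ler].
- by move=> x _; rewrite lee_fin mulr_ge0.
- by apply/measurable_EFinP; apply: measurable_funM.
rewrite EFinD leeD//.
  apply: le_trans (powR_integral_near0 s0).
  rewrite [leRHS]integral_mkcond/=; apply: ge0_le_integral => //.
  - by move=> x _; rewrite lee_fin; case: ifP => // _; exact: powR_ge0.
  - apply/measurable_EFinP; apply: measurable_fun_ifT => //.
    by apply: measurable_and; [exact: measurable_fun_ltr|exact: measurable_fun_ler].
  - apply/(measurable_restrictT _ (measurable_itv _)); apply: measurable_funTS.
    by apply/measurable_EFinP; exact: measurable_powR.
  - move=> x _; rewrite patchE; case: ifPn => [x01|_].
      by rewrite mem_set//= in_itv.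
    by case: ifP => // _; rewrite lee_fin powR_ge0.
under eq_integral do rewrite EFinM.
rewrite ge0_integralZl//.
- by rewrite integral_exponential_pdf ?mule1// invr_gt0.
- exact/measurable_EFinP.
- by move=> x _; rewrite lee_fin.
Qed.

Lemma gamma_weight_le s0 s m x : 0 < s0 -> s0 <= s -> s <= m%:R + 1 ->
  gamma_weight s x <= gamma_dom s0 m x.
Proof.
move=> s00 s0s sm; rewrite /gamma_weight /gamma_dom.
case: ifPn => x0; last by rewrite add0r mulr_ge0 ?mulr_ge0 ?exprn_ge0// exponential_pdf_ge0.
have K0 : 0 <= 2 ^+ m * m`!%:R * 2 :> R by rewrite !mulr_ge0// exprn_ge0.
rewrite /=; have [x1|x1] := leP x 1.
  rewrite -[leLHS]addr0 lerD//; last by rewrite mulr_ge0// exponential_pdf_ge0.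
  apply: (@le_trans _ _ (x `^ (s - 1))).
    by rewrite ler_piMr ?powR_ge0// -expR0 ler_expR oppr_le0 ltW.
  rewrite (_ : s - 1 = (s0 - 1) + (s - s0)); last by ring.
  rewrite powRD; last by rewrite (gt_eqF x0) implybT.
  have xs1 : x `^ (s - s0) <= 1.
    by rewrite -(powRr0 x) ger_powR ?x0 ?subr_ge0.
  by rewrite ler_piMr ?powR_ge0.
rewrite add0r (exponential_pdfE _ (ltW x0)).
have xm : x `^ (s - 1) <= x ^+ m.
  by rewrite -(powR_mulrn m (ltW x0)); apply: ler_powR (ltW x1) _ _ _; lra.
apply: le_trans (ler_wpM2r (expR_ge0 _) xm) _.
have -> : 2 ^+ m * m`!%:R * 2 * (2^-1 * expR (- 2^-1 * x)) =
    (2 ^+ m * m`!%:R * expR (x / 2)) * expR (- x).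
  have -> : - 2^-1 * x = x / 2 - x by field.
  by rewrite expRD; field.
rewrite ler_pM2r ?expR_gt0//.
have := @expR_ge_expr R (x / 2) m _.
rewrite divr_ge0 ?(ltW x0)// => /(_ isT).
by rewrite ler_pdivrMr ?ltr0n ?fact_gt0// expr_div_n ler_pdivrMr ?exprn_gt0//; lra.
Qed.

End GammaIntegral.

(** * The chi laws *)

Section ChiLaw.
Variable R : realType.
Notation RR := (measurableTypeR R).
Notation mu := (@lebesgue_measure R).
Implicit Types (s x : R) (k m : nat).

Lemma Gamma_weightE s : Gamma s = fine (\int[mu]_x (gamma_weight s x)%:E)%E.
Proof.
rewrite /Gamma /Rintegral integral_mkcond; congr fine; apply: eq_integral => x _.
rewrite patchE /gamma_weight; case: ifPn => [|/negP] x0.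
  by move: x0; rewrite inE/= in_itv/= andbT => ->.
by case: ifPn => // x0'; exfalso; apply: x0; rewrite inE/= in_itv/= x0'.
Qed.

Lemma Gamma_ge0 s : 0 <= Gamma s.
Proof.
rewrite Gamma_weightE fine_ge0//; apply: integral_ge0 => x _.
by rewrite lee_fin gamma_weight_ge0.
Qed.

Lemma gamma_weight_integrable s : 0 < s -> mu.-integrable setT (EFin \o gamma_weight s).
Proof.
move=> s0; pose m := Num.truncn s.
have sm : s <= m%:R + 1 by rewrite natr1 ltW// truncnS_gt.
apply/integrableP; split.
  by apply/measurable_EFinP; exact: measurable_gamma_weight.
apply: le_lt_trans (ltry (s^-1 + 2 ^+ m * m`!%:R * 2)).
apply: le_trans (gamma_dom_integral m s0); apply: ge0_le_integral => //.
- by apply/measurable_EFinP; apply: measurableT_comp => //; exact: measurable_gamma_weight.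
- by apply/measurable_EFinP; exact: measurable_gamma_dom.
- by move=> x _; rewrite /= lee_fin ger0_norm ?gamma_weight_ge0// gamma_weight_le.
Qed.

Lemma Gamma_EFin s : 0 < s -> (\int[mu]_x (gamma_weight s x)%:E = (Gamma s)%:E)%E.
Proof.
move=> s0; rewrite Gamma_weightE fineK//.
have := gamma_weight_integrable s0.
by move=> /integrable_fin_num; apply.
Qed.

(** A lower bound for Gamma that is uniform in the parameter: on [1, 2] the
    integrand is at least exp (-2) / x. *)
Definition Gamma_lower : R := expR (- 2) / 2.

Lemma Gamma_lower_gt0 : 0 < Gamma_lower.
Proof. by rewrite divr_gt0// expR_gt0. Qed.

Lemma Gamma_ge_lower s : 0 < s -> Gamma_lower <= Gamma s.
Proof.
move=> s0; rewrite -lee_fin -Gamma_EFin//.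
have -> : (Gamma_lower%:E = \int[mu]_(x in `[1%R, 2%R]) Gamma_lower%:E)%E.
  rewrite integral_cst; last exact: measurable_itv.
  transitivity (Gamma_lower%:E * 1)%E; first by rewrite mule1.
  congr (_ * _)%E; apply/esym; apply: etrans (lebesgue_measure_itv _) _.
  by rewrite /= lte_fin ltr1n/= -EFinB; congr EFin; ring.
rewrite integral_mkcond/=; apply: ge0_le_integral => //.
- move=> x _; rewrite patchE; case: ifP => // _.
  by rewrite lee_fin ltW// Gamma_lower_gt0.
- by apply/(measurable_restrictT _ (measurable_itv _)); exact: measurable_cst.
- by apply/measurable_EFinP; exact: measurable_gamma_weight.
- move=> x _; rewrite patchE; case: ifPn => [|_]; last by rewrite lee_fin gamma_weight_ge0.
  rewrite inE/= in_itv/= => /andP[x1 x2]; have x0 : 0 < x := lt_le_trans ltr01 x1.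
  rewrite lee_fin /gamma_weight x0 /Gamma_lower (mulrC (expR _)) ler_pM ?invr_ge0 ?expR_ge0//.
    apply: (@le_trans _ _ (x `^ (- 1))).
      by rewrite powR_inv1 ?(ltW x0)// lef_pV2 ?posrE.
    by apply: ler_powR => //; lra.
  by rewrite ler_expR lerN2.
Qed.

Lemma Gamma_gt0 s : 0 < s -> 0 < Gamma s.
Proof. by move=> s0; exact: lt_le_trans Gamma_lower_gt0 (Gamma_ge_lower s0). Qed.

Lemma gamma_pdfE s x : gamma_pdf s x = gamma_weight s x / Gamma s.
Proof. by rewrite /gamma_pdf /gamma_weight; case: ifP => // _; rewrite mul0r. Qed.

Lemma gamma_pdf_ge0 s x : 0 <= gamma_pdf s x.
Proof. by rewrite gamma_pdfE divr_ge0 ?gamma_weight_ge0 ?Gamma_ge0. Qed.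

Lemma measurable_gamma_pdf s : measurable_fun setT (gamma_pdf s).
Proof.
rewrite (_ : gamma_pdf s = fun x => gamma_weight s x * (Gamma s)^-1).
  by apply: measurable_funM => //; exact: measurable_gamma_weight.
by apply/funext => x; exact: gamma_pdfE.
Qed.

Definition gamma_measure s : set RR -> \bar R := gamma_law s.

Let gamma0 s : gamma_measure s set0 = 0%E.
Proof. by rewrite /gamma_measure /gamma_law integral_set0. Qed.

Let gamma_ge0 s A : (0 <= gamma_measure s A)%E.
Proof. by apply: integral_ge0 => x _; rewrite lee_fin gamma_pdf_ge0. Qed.

Let gamma_sigma_additive s : semi_sigma_additive (gamma_measure s).
Proof.
move=> /= F mF tF mUF; rewrite /gamma_measure /gamma_law; apply: cvg_toP.
  apply: ereal_nondecreasing_is_cvgn => m n mn.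
  apply: lee_sum_nneg_natr => // k _ _; apply: integral_ge0 => /= x Fkx.
  by rewrite lee_fin gamma_pdf_ge0.
rewrite ge0_integral_bigcup//=.
- by apply/measurable_funTS/measurable_EFinP; exact: measurable_gamma_pdf.
- by move=> x _; rewrite lee_fin gamma_pdf_ge0.
Qed.

HB.instance Definition _ s := isMeasure.Build _ _ _ (gamma_measure s)
  (gamma0 s) (gamma_ge0 s) (@gamma_sigma_additive s).

Lemma gamma_measureT s : 0 < s -> gamma_measure s setT = 1%E.
Proof.
move=> s0; rewrite /gamma_measure /gamma_law.
under eq_integral do rewrite gamma_pdfE mulrC EFinM.
rewrite ge0_integralZl//.
- by rewrite Gamma_EFin// -EFinM mulVf// gt_eqF// Gamma_gt0.
- by apply/measurable_EFinP; exact: measurable_gamma_weight.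
- by move=> x _; rewrite lee_fin gamma_weight_ge0.
- by rewrite lee_fin invr_ge0 Gamma_ge0.
Qed.

Lemma measurable_sqrtr : measurable_fun [set: RR] (fun x : RR => Num.sqrt x : R).
Proof. by apply: continuous_measurable_fun; exact: sqrt_continuous. Qed.

(** The law of the square root of a Gamma variable of shape [s]. Normalization
    makes it a probability law for every value of the parameter, and changes
    nothing for the positive ones. *)
Definition chi_prob s : probability R R :=
  distribution (mnormalize (gamma_measure s) \d_(0 : RR)) (rv_of measurable_sqrtr).

Lemma mnormalize_gamma s : 0 < s -> mnormalize (gamma_measure s) \d_(0 : RR) = gamma_measure s.
Proof.
move=> s0; apply/funext => A; rewrite /mnormalize.
have -> : (gamma_measure s : {measure set RR -> \bar R}) setT = 1%E by exact: gamma_measureT.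
by rewrite onee_eq0/= invr1 mule1.
Qed.

Lemma chi_probE s A : 0 < s -> chi_prob s A = tchi_law (2 * s) A.
Proof.
move=> s0; rewrite /chi_prob /distribution/= /pushforward (mnormalize_gamma s0).
by rewrite /tchi_law /pushforward /gamma_measure (_ : 2 * s / 2 = s)//; field.
Qed.

Lemma ge0_integral_chi s (h : R -> R) : 0 < s -> measurable_fun setT h -> (forall x, 0 <= h x) ->
  (\int[chi_prob s]_y (h y)%:E =
   ((Gamma s)^-1)%:E * \int[mu]_x (h (Num.sqrt x) * gamma_weight s x)%:E)%E.
Proof.
move=> s0 mh h0.
have mhs : measurable_fun [set: RR] (fun x : RR => h (Num.sqrt x)).
  by apply: measurableT_comp => //; exact: measurable_sqrtr.
transitivity (\int[gamma_measure s]_x (h (Num.sqrt x))%:E)%E.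
  rewrite ge0_integral_distribution//; last exact/measurable_EFinP.
  by apply: eq_measure_integral => A _ _; rewrite /= mnormalize_gamma.
have nuE (A : set RR) : measurable A ->
   gamma_measure s A = (\int[mu]_(x in A) (gamma_pdf s x)%:E)%E by [].
apply: etrans (@ge0_integral_density _ RR R (@lebesgue_measure R) (gamma_measure s)
  (gamma_pdf s) (@measurable_gamma_pdf s) (@gamma_pdf_ge0 s) nuE _ _ _) _.
- exact/measurable_EFinP.
- by move=> x; rewrite lee_fin.
under eq_integral do rewrite -EFinM gamma_pdfE mulrA mulrC EFinM.
rewrite ge0_integralZl//.
- apply/measurable_EFinP; apply: measurable_funM => //.
  exact: measurable_gamma_weight.
- by move=> x _; rewrite lee_fin mulr_ge0 ?gamma_weight_ge0.
- by rewrite lee_fin invr_ge0 Gamma_ge0.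
Qed.

End ChiLaw.

(** * Dominated convergence under varying laws *)

Section DominatedConvergence.
Variable R : realType.

(** Convergence of laws against functions that may be unbounded, up to the
    weight [w]. The test functions vary with the law: this is what makes the
    notion stable under products, because the inner integrals of the theorem of
    Fubini form such a varying sequence. *)
Definition dom_cvg d (E : measurableType d) (w : E -> R) (B : R)
    (nu_ : nat -> probability E R) (nu : probability E R) :=
  [/\ measurable_fun setT w, forall x, 0 <= w x,
      forall n, (\int[nu_ n]_x (w x)%:E <= B%:E)%E,
      (\int[nu]_x (w x)%:E <= B%:E)%E &
      forall (G_ : nat -> E -> R) (G : E -> R) C,
        (forall n, measurable_fun setT (G_ n)) ->
        (forall x, G_ n x @[n --> \oo] --> G x) ->
        (forall n x, `|G_ n x| <= C * w x) ->
        Ex (nu_ n) (G_ n) @[n --> \oo] --> Ex nu G].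

Section Weighted.
Context d (E : measurableType d) (nu : probability E R) (w : E -> R) (B : R).
Hypotheses (mw : measurable_fun setT w) (w0 : forall x, 0 <= w x)
  (wB : (\int[nu]_x (w x)%:E <= B%:E)%E).

Lemma weight_integrable : nu.-integrable setT (EFin \o w).
Proof.
apply/integrableP; split; first exact/measurable_EFinP.
apply: le_lt_trans (ltry B); apply: le_trans wB.
by under eq_integral do rewrite /= ger0_norm//.
Qed.

Lemma dominated_integrable (G : E -> R) C : measurable_fun setT G ->
  (forall x, `|G x| <= C * w x) -> nu.-integrable setT (EFin \o G).
Proof.
move=> mG GC; apply: (@le_integrable _ _ _ nu setT measurableT _ (fun x => C%:E * (w x)%:E)%E).
- exact/measurable_EFinP.
- by move=> x _ /=; rewrite lee_fin (le_trans (GC x))// ler_norm.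
- by apply: integrableZl => //; exact: weight_integrable.
Qed.

Lemma dominated_Ex_le (G : E -> R) C : measurable_fun setT G -> 0 <= C ->
  (forall x, `|G x| <= C * w x) -> `|Ex nu G| <= C * B.
Proof.
move=> mG C0 GC; have iG := dominated_integrable mG GC.
apply: le_trans (le_normr_Rintegral _ iG) _ => //.
apply: (@le_trans _ _ (\int[nu]_x (C * w x))).
  apply: le_Rintegral => //; first exact: integrable_norm iG.
  by have := integrableZl measurableT C weight_integrable; apply.
rewrite RintegralZl//; last exact: weight_integrable.
rewrite ler_wpM2l// -lee_fin fineK//.
by have /integrable_fin_num := weight_integrable; apply.
Qed.

End Weighted.

Lemma Rintegral_dominated_cvg d (E : measurableType d) (m : {measure set E -> \bar R})
    (F_ : nat -> E -> R) (F W : E -> R) :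
  (forall n, measurable_fun setT (F_ n)) -> measurable_fun setT F ->
  {ae m, forall x, F_ n x @[n --> \oo] --> F x} ->
  m.-integrable setT (EFin \o W) -> (forall n x, `|F_ n x| <= W x) ->
  \int[m]_x F_ n x @[n --> \oo] --> \int[m]_x F x.
Proof.
move=> mF_ mF FF iW FW.
have /= := @dominated_convergence _ _ _ m setT measurableT (fun n x => (F_ n x)%:E)
  (EFin \o F) (EFin \o W).
case => //.
- by move=> n; exact/measurable_EFinP.
- exact/measurable_EFinP.
- by apply: filterS FF => x Fx _; apply: cvg_EFin; [exact: nearW|exact: Fx].
- by apply: aeW => x n _; rewrite lee_fin.
move=> iF _ cF; have /integrable_fin_num := iF => /(_ measurableT) fF.
by move: cF; rewrite -(fineK fF) => /fine_cvg.
Qed.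

Lemma dom_cvg_eventually d (E : measurableType d) (w : E -> R) B
    (nu_ : nat -> probability E R) nu N :
  measurable_fun setT w -> (forall x, 0 <= w x) ->
  (forall n, (\int[nu_ n]_x (w x)%:E <= B%:E)%E) ->
  (forall n, (N <= n)%N -> nu_ n = nu) -> dom_cvg w B nu_ nu.
Proof.
move=> mw w0 wB nuE.
have wBnu : (\int[nu]_x (w x)%:E <= B%:E)%E by rewrite -(nuE N)//.
split=> // G_ G C mG GG GC.
have iCw : nu.-integrable setT (EFin \o (fun x => C * w x)).
  by have := integrableZl measurableT C (weight_integrable mw w0 wBnu); apply.
have mG' : measurable_fun setT G.
  by apply: (measurable_fun_cvg mG) => x _; exact: GG.
have GG' : {ae nu, forall x, G_ n x @[n --> \oo] --> G x} by exact: aeW.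
have cG := Rintegral_dominated_cvg mG mG' GG' iCw GC.
apply/cvgrPdist_le => e e0; have [M _ hM] := (cvgrPdist_le _ _).1 cG e e0.
exists (maxn N M) => // n /=; rewrite geq_max => /andP[Nn Mn].
by rewrite (nuE n Nn); exact: hM.
Qed.

(** The inner means converge pointwise by convergence of the second factor and
    are dominated by a multiple of [w1], so that they are test functions for the
    first factor. *)
Lemma dom_cvg_prod d1 (E1 : measurableType d1) d2 (E2 : measurableType d2)
    (w1 : E1 -> R) (w2 : E2 -> R) B1 B2 nu1_ nu1 nu2_ nu2 :
  dom_cvg w1 B1 nu1_ nu1 -> dom_cvg w2 B2 nu2_ nu2 ->
  dom_cvg (fun z : E1 * E2 => w1 z.1 * w2 z.2) (B1 * B2)
    (fun n => (nu1_ n \x nu2_ n)%E) (nu1 \x nu2)%E.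
Proof.
move=> [mw1 w10 wB1 wB1' c1] [mw2 w20 wB2 wB2' c2].
pose w (z : E1 * E2) := w1 z.1 * w2 z.2.
have mw : measurable_fun setT w.
  by apply: measurable_funM; exact: measurableT_comp.
have w0 z : 0 <= w z by rewrite mulr_ge0.
have B20 : 0 <= B2.
  rewrite -lee_fin; apply: le_trans (wB2 0%N).
  by apply: integral_ge0 => x _; rewrite lee_fin.
have wBprod (m1 : probability E1 R) (m2 : probability E2 R) :
    (\int[m1]_x (w1 x)%:E <= B1%:E)%E -> (\int[m2]_x (w2 x)%:E <= B2%:E)%E ->
    (\int[m1 \x m2]_z (w z)%:E <= (B1 * B2)%:E)%E.
  move=> h1 h2.
  have mwE : measurable_fun setT (EFin \o w) by exact/measurable_EFinP.
  have w0E z : (0 <= (EFin \o w) z)%E by rewrite lee_fin.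
  rewrite (fubini_tonelli1 _ mwE w0E).
  apply: (@le_trans _ _ (\int[m1]_x ((w1 x)%:E * B2%:E))%E).
    apply: ge0_le_integral => //.
    - by move=> x _; apply: integral_ge0 => y _; exact: w0E.
    - exact: (measurable_fun_fubini_tonelli_F _ mwE w0E).
    - by apply: emeasurable_funM => //; exact/measurable_EFinP.
    - move=> x _; rewrite /fubini_F /w/=; under eq_integral do rewrite EFinM.
      rewrite ge0_integralZl// ?lee_fin//; last first.
      + by move=> y _; rewrite lee_fin.
      + exact/measurable_EFinP.
      by rewrite lee_wpmul2l ?lee_fin.
  under eq_integral do rewrite muleC.
  rewrite ge0_integralZl//; last 2 first.
  - exact/measurable_EFinP.
  - by move=> x _; rewrite lee_fin.
  by rewrite muleC EFinM lee_wpmul2r ?lee_fin.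
split => //; [by move=> n; exact: wBprod|exact: wBprod|].
move=> G_ G C mG GG GC.
have C0 : forall z, 0 <= C * w z by move=> z; exact: le_trans (GC 0%N z).
have mG' : measurable_fun setT G.
  by apply: (measurable_fun_cvg mG) => x _; exact: GG.
have GC' z : `|G z| <= C * w z.
  have h : `|G_ n z| @[n --> \oo] --> `|G z| by apply: cvg_norm; exact: GG.
  by apply: (cvgr_to_le h); exact: nearW.
pose D := `|C|.
have CD z : C * w z <= D * w z by rewrite ler_wpM2r// ler_norm.
have iter (m1 : probability E1 R) (m2 : probability E2 R) (H : E1 * E2 -> R) :
    (\int[m1]_x (w1 x)%:E <= B1%:E)%E -> (\int[m2]_x (w2 x)%:E <= B2%:E)%E ->
    measurable_fun setT H -> (forall z, `|H z| <= D * w z) ->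
  [/\ Ex (m1 \x m2)%E H = Ex m1 (fun x => Ex m2 (fun y => H (x, y))),
    measurable_fun setT (fun x => Ex m2 (fun y => H (x, y))) &
    forall x, `|Ex m2 (fun y => H (x, y))| <= (D * B2) * w1 x].
  move=> h1 h2 mH HD.
  have iH := dominated_integrable mw w0 (wBprod _ _ h1 h2) mH HD.
  have mHx x : measurable_fun setT (fun y => H (x, y)) by exact: measurableT_comp.
  have HDx x y : `|H (x, y)| <= (D * w1 x) * w2 y.
    by rewrite -mulrA; exact: HD (x, y).
  have iHx x := dominated_integrable mw2 w20 h2 (mHx x) (HDx x).
  have FE x : fubini_F m2 (EFin \o H) x = (Ex m2 (fun y => H (x, y)))%:E.
    rewrite /fubini_F /Ex /Rintegral fineK//.
    by have /integrable_fin_num := iHx x; apply.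
  split.
  - rewrite {1}/Ex /Rintegral -(integral12_prod_meas1 iH).
    by rewrite /Ex /Rintegral; congr fine; apply: eq_integral => x _; exact: FE.
  - apply/measurable_EFinP; have := measurable_fubini_F iH.
    by congr (measurable_fun _ _); apply/funext => x; exact: FE.
  - move=> x; rewrite mulrAC.
    by apply: (dominated_Ex_le mw2 w20 h2 (mHx x) _ (HDx x)); rewrite mulr_ge0// normr_ge0.
have HD n z : `|G_ n z| <= D * w z by exact: le_trans (GC n z) (CD z).
have HD' z : `|G z| <= D * w z by exact: le_trans (GC' z) (CD z).
have [-> _ _] := iter nu1 nu2 G wB1' wB2' mG' HD'.
under eq_fun => n do have [-> _ _] := iter _ _ _ (wB1 n) (wB2 n) (mG n) (HD n).
apply: (c1 _ _ (D * B2)).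
- by move=> n; have [] := iter _ _ _ (wB1 n) (wB2 n) (mG n) (HD n).
- move=> x; apply: (c2 _ _ (D * w1 x)).
  + by move=> n; exact: measurableT_comp.
  + by move=> y; exact: GG.
  + by move=> n y; rewrite -mulrA; exact: HD n (x, y).
- by move=> n x; have [] := iter _ _ _ (wB1 n) (wB2 n) (mG n) (HD n).
Qed.

End DominatedConvergence.

(** * Product laws, weights and moments of chi laws *)

Section ProductLawConvergence.
Variable R : realType.

Lemma dom_cvg_distribution d (E : measurableType d) d' (E' : measurableType d')
    (phi : E -> E') (mphi : measurable_fun setT phi) (w : E -> R) (w' : E' -> R)
    B (nu_ : nat -> probability E R) nu :
  measurable_fun setT w' -> (forall y, 0 <= w' y) -> (forall x, w' (phi x) = w x) ->
  dom_cvg w B nu_ nu ->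
  dom_cvg w' B (fun n => distribution (nu_ n) (rv_of mphi) : probability E' R)
    (distribution nu (rv_of mphi)).
Proof.
move=> mw' w'0 ww' [mw w0 wB wB' cG].
have le (m : probability E R) : (\int[m]_x (w x)%:E <= B%:E)%E ->
    (\int[distribution m (rv_of mphi)]_y (w' y)%:E <= B%:E)%E.
  move=> h; rewrite ge0_integral_distribution//; last exact/measurable_EFinP.
  by apply: le_trans h; under eq_integral do rewrite /= ww'.
split=> //; [by move=> n; exact: le|exact: le|].
move=> G_ G C mG GG GC.
have mG' : measurable_fun setT G.
  by apply: (measurable_fun_cvg mG) => x _; exact: GG.
have GC' z : `|G z| <= C * w' z.
  have h : `|G_ n z| @[n --> \oo] --> `|G z| by apply: cvg_norm; exact: GG.
  by apply: (cvgr_to_le h); exact: nearW.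
have ExE (m : probability E R) (H : E' -> R) : (\int[m]_x (w x)%:E <= B%:E)%E ->
    measurable_fun setT H -> (forall z, `|H z| <= C * w' z) ->
    Ex (distribution m (rv_of mphi)) H = Ex m (H \o phi).
  move=> h mH HC; rewrite /Ex /Rintegral integral_distribution//.
    exact/measurable_EFinP.
  apply: (@dominated_integrable _ _ _ m w B mw w0 h (H \o phi) C).
    exact: measurableT_comp.
  by move=> x; rewrite -ww'; exact: HC.
under eq_fun => n do rewrite (ExE _ _ (wB n) (mG n) (GC n)).
rewrite (ExE _ _ wB' mG' GC'); apply: (cG _ _ C).
- by move=> n; exact: measurableT_comp.
- by move=> x; exact: GG.
- by move=> n x; rewrite -ww'; exact: GC.
Qed.

Lemma dom_cvg_product_law d (E : measurableType d) (w : E -> R) B L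
    (nu_ : nat -> nat -> probability E R) (nu : nat -> probability E R) :
  measurable_fun setT w -> (forall x, 0 <= w x) ->
  (forall j, dom_cvg w B (fun n => nu_ n j) (nu j)) ->
  dom_cvg (fun t : L.-tuple E => \prod_(j < L) w (tnth t j)) (B ^+ L)
    (fun n => product_law (nu_ n) L) (product_law nu L).
Proof.
move=> mw w0; elim: L nu_ nu => [|L IH] nu_ nu cj.
  have m1 : measurable_fun setT (fun t : 0.-tuple E => \prod_(j < 0) w (tnth t j)).
    by apply: measurable_prod => -[].
  apply: (@dom_cvg_eventually _ _ _ _ _ _ _ 0%N) => //.
  - by move=> t; rewrite big_ord0.
  - move=> n /=; rewrite integral_dirac//=; last exact/measurable_EFinP.
    by rewrite big_ord0 expr0 mule1 lee_fin lern1 leq_b1.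
have mprod : measurable_fun setT (fun t : L.+1.-tuple E => \prod_(j < L.+1) w (tnth t j)).
  by apply: measurable_prod => j _; apply: measurableT_comp => //; exact: measurable_tnth.
rewrite exprS.
apply: (@dom_cvg_distribution _ _ _ _ _ (@measurable_tuple_cons _ E L)
   (fun z => w z.1 * \prod_(j < L) w (tnth z.2 j))).
- exact: mprod.
- by move=> t; apply: prodr_ge0.
- move=> -[x t]; rewrite big_ord_recl/= (tnth_nth x)/=; congr (_ * _).
  by apply: eq_bigr => j _; rewrite tnthS.
- exact: (dom_cvg_prod (cj 0%N)
    (IH (fun n j => nu_ n j.+1) (fun j => nu j.+1) (fun j => cj j.+1))).
Qed.

End ProductLawConvergence.

Section ChiConvergence.
Variable R : realType.
Notation RR := (measurableTypeR R).
Notation mu := (@lebesgue_measure R).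
Implicit Types (s x : R).

(** Weights for polynomial growth: they are at least 1, and their products over
    the entries dominate powers of the norm of the matrix. *)
Definition wt K x : R := (1 + x ^+ 2) ^+ K.

Lemma wt_ge1 K x : 1 <= wt K x.
Proof. by rewrite /wt exprn_ege1// lerDl sqr_ge0. Qed.

Lemma wt_ge0 K x : 0 <= wt K x.
Proof. exact: le_trans ler01 (wt_ge1 K x). Qed.

Lemma measurable_wt K : measurable_fun setT (wt K).
Proof.
by apply: measurable_funX; apply: measurable_funD => //; exact: measurable_funX.
Qed.

Lemma wt_gamma_weight_le K s x :
  wt K (Num.sqrt x) * gamma_weight s x <=
  2 ^+ K * (gamma_weight s x + gamma_weight (s + K%:R) x).
Proof.
have [x0|x0] := ltP 0 x; last first.
  rewrite {1}/gamma_weight ltNge x0 mulr0.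
  by rewrite mulr_ge0 ?exprn_ge0// addr_ge0 ?gamma_weight_ge0.
rewrite -gamma_weight_expr -[X in X + _]mul1r -mulrDl mulrA.
rewrite ler_wpM2r ?gamma_weight_ge0// /wt (sqr_sqrtr (ltW x0)).
have := normD_expr_le 1 x K.
by rewrite normr1 expr1n (ger0_norm (ltW x0)) (ger0_norm (addr_ge0 ler01 (ltW x0))).
Qed.

Lemma wt_le K K' x : (K <= K')%N -> wt K x <= wt K' x.
Proof. by move=> KK; rewrite /wt ler_weXn2l// lerDl sqr_ge0. Qed.

(** A bound for the mean of the weight of order [K] that is uniform over the
    parameters in (0, alpha]: parameters near 0 occur at the lower end of the
    matrix, and there only the normalization by Gamma keeps the mass finite. *)
Definition chiB (alpha : R) K : R :=
  let m := (Num.truncn alpha + K.+1)%N in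
  2 ^+ K.+1 * (1 + (Gamma_lower R)^-1 * (1 + 2 ^+ m * m`!%:R * 2)).

Lemma chi_wt_le alpha K s : 0 < s -> s <= alpha ->
  (\int[chi_prob s]_y (wt K y)%:E <= (chiB alpha K)%:E)%E.
Proof.
move=> s0 sa; have G0 := Gamma_gt0 s0.
(* With K + 1 in place of K the shifted parameter is at least 1, so that its
   integral has a bound that is uniform in s. *)
have K2 : 0 <= 2 ^+ K.+1 :> R by rewrite exprn_ge0.
apply: (@le_trans _ _ (\int[chi_prob s]_y (wt K.+1 y)%:E)%E).
  apply: ge0_le_integral => //.
  - by move=> y _; rewrite lee_fin wt_ge0.
  - by apply/measurable_EFinP; exact: measurable_wt.
  - by apply/measurable_EFinP; exact: measurable_wt.
  - by move=> y _; rewrite lee_fin wt_le.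
rewrite (ge0_integral_chi s0 (measurable_wt _) (wt_ge0 _)).
set m := (Num.truncn alpha + K.+1)%N.
have sKm : s + K.+1%:R <= m%:R + 1.
  rewrite natrD addrAC lerD2r (le_trans sa)//.
  by rewrite natr1 ltW// truncnS_gt.
apply: (@le_trans _ _ ((Gamma s)^-1%:E * ((2 ^+ K.+1)%:E *
    \int[mu]_x ((gamma_weight s x)%:E + (gamma_weight (s + K.+1%:R) x)%:E)))%E).
  rewrite lee_wpmul2l ?lee_fin ?invr_ge0 ?(ltW G0)//.
  rewrite -ge0_integralZl//; last 2 first.
  - by apply: emeasurable_funD; apply/measurable_EFinP; exact: measurable_gamma_weight.
  - by move=> x _; rewrite -EFinD lee_fin addr_ge0 ?gamma_weight_ge0.
  apply: ge0_le_integral => //.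
  - by move=> x _; rewrite lee_fin mulr_ge0 ?wt_ge0 ?gamma_weight_ge0.
  - apply/measurable_EFinP; apply: measurable_funM; last exact: measurable_gamma_weight.
    by apply: measurableT_comp; [exact: measurable_wt|exact: measurable_sqrtr].
  - apply: measurable_funeM; apply: emeasurable_funD; apply/measurable_EFinP;
    exact: measurable_gamma_weight.
  - by move=> x _; rewrite -EFinD -EFinM lee_fin wt_gamma_weight_le.
rewrite ge0_integralD//; last 4 first.
- by move=> x _; rewrite lee_fin gamma_weight_ge0.
- by apply/measurable_EFinP; exact: measurable_gamma_weight.
- by move=> x _; rewrite lee_fin gamma_weight_ge0.
- by apply/measurable_EFinP; exact: measurable_gamma_weight.
rewrite Gamma_EFin//.
have h : (\int[mu]_x (gamma_weight (s + K.+1%:R) x)%:E <=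
    (1 + 2 ^+ m * m`!%:R * 2)%:E)%E.
  have := gamma_dom_integral m (@ltr01 R); rewrite invr1; apply: le_trans.
  apply: ge0_le_integral => //.
  - by move=> x _; rewrite lee_fin gamma_weight_ge0.
  - by apply/measurable_EFinP; exact: measurable_gamma_weight.
  - by apply/measurable_EFinP; exact: measurable_gamma_dom.
  - move=> x _; rewrite lee_fin gamma_weight_le//.
    by rewrite (@le_trans _ _ K.+1%:R) ?ler1n// lerDr ltW.
apply: (@le_trans _ _ ((Gamma s)^-1%:E * ((2 ^+ K.+1)%:E *
   ((Gamma s)%:E + (1 + 2 ^+ m * m`!%:R * 2)%:E)))%E).
  by rewrite lee_wpmul2l ?lee_fin ?invr_ge0 ?(ltW G0)// lee_wpmul2l ?lee_fin// leeD2l.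
rewrite -EFinD -!EFinM lee_fin /chiB -/m mulrCA ler_wpM2l// mulrDr mulVf ?gt_eqF//.
rewrite lerD2l ler_wpM2r ?addr_ge0 ?mulr_ge0 ?exprn_ge0//.
by rewrite lef_pV2 ?posrE ?Gamma_lower_gt0//; exact: Gamma_ge_lower.
Qed.

End ChiConvergence.

(** * Continuity of the chi laws in their parameter *)

Section ChiConvergence.
Variable R : realType.
Notation RR := (measurableTypeR R).
Notation mu := (@lebesgue_measure R).
Implicit Types (s x : R).

Lemma gamma_weight_cvg (s_ : nat -> R) s x : s_ n @[n --> \oo] --> s ->
  gamma_weight (s_ n) x @[n --> \oo] --> gamma_weight s x.
Proof.
move=> ss; rewrite /gamma_weight; case: ifPn => x0; last exact: cvg_cst.
rewrite /powR gt_eqF//; apply: cvgM; last exact: cvg_cst.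
have h : (s_ n - 1) * ln x @[n --> \oo] --> (s - 1) * ln x.
  by apply: cvgM; [apply: cvgB => //; exact: cvg_cst|exact: cvg_cst].
by apply: continuous_cvg => //; exact: continuous_expR.
Qed.

Lemma measurable_chi_integrand (G : R -> R) s : measurable_fun setT G ->
  measurable_fun [set: RR] (fun x : RR => G (Num.sqrt x) * gamma_weight s x).
Proof.
move=> mG; apply: measurable_funM; last exact: measurable_gamma_weight.
by apply: measurableT_comp => //; exact: measurable_sqrtr.
Qed.

Lemma chi_integrand_le (G : R -> R) C K s x : (forall y, `|G y| <= C * wt K y) ->
  `|G (Num.sqrt x) * gamma_weight s x| <=
  `|C| * 2 ^+ K * (gamma_weight s x + gamma_weight (s + K%:R) x).
Proof.
move=> GC; rewrite normrM (ger0_norm (gamma_weight_ge0 _ _)).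
apply: (@le_trans _ _ (`|C| * (wt K (Num.sqrt x) * gamma_weight s x))).
  rewrite mulrA ler_wpM2r ?gamma_weight_ge0// (le_trans (GC _))//.
  by rewrite ler_wpM2r ?wt_ge0// ler_norm.
by rewrite -mulrA ler_wpM2l// wt_gamma_weight_le.
Qed.

Lemma chi_integrand_integrable (G : R -> R) C K s : 0 < s -> measurable_fun setT G ->
  (forall y, `|G y| <= C * wt K y) ->
  mu.-integrable setT (EFin \o (fun x => G (Num.sqrt x) * gamma_weight s x)).
Proof.
move=> s0 mG GC; have sK : 0 < s + K%:R by rewrite ltr_wpDr.
have iW : mu.-integrable setT (EFin \o (fun x => `|C| * 2 ^+ K *
    (gamma_weight s x + gamma_weight (s + K%:R) x))).
  have h := integrableD measurableT (gamma_weight_integrable s0) (gamma_weight_integrable sK).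
  exact: (integrableZl measurableT (`|C| * 2 ^+ K) h).
apply: (le_integrable measurableT _ _ iW).
  by apply/measurable_EFinP; exact: measurable_chi_integrand.
move=> x _ /=; rewrite lee_fin; apply: le_trans (chi_integrand_le s x GC) _.
exact: ler_norm.
Qed.

(** Adding the weight reduces to nonnegative functions. *)
Lemma Ex_chi (G : R -> R) C K s : 0 < s -> measurable_fun setT G ->
  (forall y, `|G y| <= C * wt K y) ->
  Ex (chi_prob s) G =
  (Gamma s)^-1 * \int[mu]_x (G (Num.sqrt x) * gamma_weight s x).
Proof.
move=> s0 mG GC; pose W y := `|C| * wt K y.
have GW y : `|G y| <= W y.
  by apply: le_trans (GC y) _; rewrite ler_wpM2r ?wt_ge0// ler_norm.
have mW : measurable_fun setT W.
  by apply: measurable_funM => //; exact: measurable_wt.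
have ge0 (H : R -> R) D : measurable_fun setT H -> (forall y, 0 <= H y) ->
    (forall y, `|H y| <= D * wt K y) -> Ex (chi_prob s) H =
    (Gamma s)^-1 * \int[mu]_x (H (Num.sqrt x) * gamma_weight s x).
  move=> mH H0 HD; rewrite /Ex /Rintegral ge0_integral_chi//.
  rewrite fineM//.
  by have /integrable_fin_num := chi_integrand_integrable s0 mH HD; apply.
have WD y : `|W y| <= `|C| * wt K y by rewrite ger0_norm// mulr_ge0 ?wt_ge0.
have W0 y : 0 <= W y by rewrite mulr_ge0 ?wt_ge0.
have mA : measurable_fun setT (fun y => G y + W y) by exact: measurable_funD.
have A0 y : 0 <= G y + W y by have := GW y; rewrite ler_norml; lra.
have AD y : `|G y + W y| <= (2 * `|C|) * wt K y.
  rewrite (le_trans (ler_normD _ _))//; have := GW y; have := WD y; rewrite /W; lra.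
have iA := dominated_integrable (measurable_wt K) (wt_ge0 K) (chi_wt_le K s0 (lexx s)) mA AD.
have iW := dominated_integrable (measurable_wt K) (wt_ge0 K) (chi_wt_le K s0 (lexx s)) mW WD.
transitivity (Ex (chi_prob s) (fun y => (G y + W y) - W y)).
  by apply: eq_Ex => y; rewrite addrK.
rewrite {1}/Ex RintegralB// -/(Ex _ _) -/(Ex _ _) (ge0 _ _ mA A0 AD) (ge0 _ _ mW W0 WD).
rewrite -mulrBr -RintegralB//.
- by congr (_ * _); apply: eq_Rintegral => x _; rewrite -mulrBl addrK.
- exact: chi_integrand_integrable s0 mA AD.
- exact: chi_integrand_integrable s0 mW WD.
Qed.

(** Dominated convergence for the densities: from some point on the parameters
    stay above [s / 2], where [gamma_dom] is a common majorant. *)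
Lemma dom_cvg_chi alpha K (s_ : nat -> R) s :
  (forall n, 0 < s_ n <= alpha) -> 0 < s -> s <= alpha -> s_ n @[n --> \oo] --> s ->
  dom_cvg (wt K) (chiB alpha K) (fun n => chi_prob (s_ n)) (chi_prob s).
Proof.
move=> s_0 s0 sa ss; split.
- exact: measurable_wt.
- exact: wt_ge0.
- by move=> n; have /andP[h1 h2] := s_0 n; exact: chi_wt_le.
- exact: chi_wt_le.
move=> G_ G C mG GG GC.
have mG' : measurable_fun setT G.
  by apply: (measurable_fun_cvg mG) => x _; exact: GG.
have GC' z : `|G z| <= C * wt K z.
  have h : `|G_ n z| @[n --> \oo] --> `|G z| by apply: cvg_norm; exact: GG.
  by apply: (cvgr_to_le h); exact: nearW.
have s2 : 0 < s / 2 by rewrite divr_gt0.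
have s2s : 0 < s - s / 2 by lra.
have [N _ hN] := (cvgrPdist_le _ _).1 ss _ s2s.
have sN n : s / 2 <= s_ (n + N)%N.
  by have := hN (n + N)%N (leq_addl _ _); rewrite /= ler_norml; lra.
pose m := Num.truncn alpha.
have sm t : t <= alpha -> t <= m%:R + 1.
  by move=> h; apply: le_trans h _; rewrite natr1 ltW// truncnS_gt.
have smK t : t <= alpha -> t + K%:R <= (m + K)%:R + 1.
  by move=> h; rewrite natrD addrAC lerD2r sm.
pose W0 x := `|C| * 2 ^+ K * (gamma_dom (s / 2) m x + gamma_dom (s / 2) (m + K) x).
have idom k : mu.-integrable setT (EFin \o gamma_dom (s / 2) k).
  apply/integrableP; split.
    by apply/measurable_EFinP; exact: measurable_gamma_dom.
  apply: le_lt_trans (ltry ((s / 2)^-1 + 2 ^+ k * k`!%:R * 2)).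
  apply: le_trans (gamma_dom_integral k s2).
  by under eq_integral do rewrite /= ger0_norm ?gamma_dom_ge0//.
have iW c : mu.-integrable setT (EFin \o (fun x => c *
    (gamma_dom (s / 2) m x + gamma_dom (s / 2) (m + K) x))).
  have h := integrableD measurableT (idom m) (idom (m + K)%N).
  exact: (integrableZl measurableT c h).
have lims (H_ : nat -> R -> R) (H : R -> R) D : (forall n, measurable_fun setT (H_ n)) -> measurable_fun setT H ->
    (forall x, H_ n x @[n --> \oo] --> H x) -> (forall n x, `|H_ n x| <= D * wt K x) ->
    \int[mu]_x (H_ n (Num.sqrt x) * gamma_weight (s_ n) x) @[n --> \oo] -->
    \int[mu]_x (H (Num.sqrt x) * gamma_weight s x).
  move=> mH_ mH HH HD; rewrite -(cvg_shiftn N)/=.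
  apply: (@Rintegral_dominated_cvg _ _ _ mu
    (fun n x => H_ (n + N)%N (Num.sqrt x) * gamma_weight (s_ (n + N)%N) x) _ _ _ _ _ (iW (`|D| * 2 ^+ K))).
  - by move=> n; exact: measurable_chi_integrand.
  - exact: measurable_chi_integrand.
  - apply: aeW => x.
    rewrite (cvg_shiftn N (fun n => H_ n (Num.sqrt x) * gamma_weight (s_ n) x)).
    by apply: cvgM; [exact: HH|exact: gamma_weight_cvg].
  - move=> n x; have /andP[t0 ta] := s_0 (n + N)%N.
    apply: le_trans (chi_integrand_le _ x (HD _)) _.
    rewrite ler_wpM2l ?mulr_ge0 ?exprn_ge0// lerD//.
      by apply: gamma_weight_le s2 (sN n) (sm _ ta).
    apply: gamma_weight_le s2 _ (smK _ ta).
    by rewrite (le_trans (sN n))// lerDl.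
have cGamma : Gamma (s_ n) @[n --> \oo] --> Gamma s.
  have GE t : 0 < t -> Gamma t = \int[mu]_x (1 * gamma_weight t x).
    move=> t0; rewrite Gamma_weightE /Rintegral; congr fine.
    by apply: eq_integral => x _; rewrite mul1r.
  rewrite (GE _ s0); under eq_fun => n.
    rewrite (GE (s_ n)); last by have /andP[] := s_0 n.
    over.
  apply: (lims (fun _ _ => 1) (fun=> 1) 1) => //.
  - by move=> x; exact: cvg_cst.
  - by move=> n x; rewrite normr1 mul1r wt_ge1.
have E n : Ex (chi_prob (s_ n)) (G_ n) = (Gamma (s_ n))^-1 *
    \int[mu]_x (G_ n (Num.sqrt x) * gamma_weight (s_ n) x).
  by have /andP[t0 _] := s_0 n; exact: (Ex_chi t0 (mG n) (GC n)).
have E' := Ex_chi s0 mG' GC'.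
have cJ := lims G_ G C mG mG' GG GC.
have cGV : (Gamma (s_ n))^-1 @[n --> \oo] --> (Gamma s)^-1.
  by apply: cvgV => //; rewrite gt_eqF// Gamma_gt0.
have h : (Gamma (s_ n))^-1 * \int[mu]_x (G_ n (Num.sqrt x) * gamma_weight (s_ n) x)
    @[n --> \oo] --> (Gamma s)^-1 * \int[mu]_x (G (Num.sqrt x) * gamma_weight s x).
  exact: cvgM cGV cJ.
move: h; rewrite -E'; apply: cvg_trans.
by apply: near_eq_cvg; apply: nearW => n; rewrite -E.
Qed.

End ChiConvergence.

(** * Riemann sums with varying samples *)

Section RiemannSum.
Variable R : realType.
Notation RR := (measurableTypeR R).
Notation mu := (@lebesgue_measure R).
Variables (w : nat -> nat -> R) (V : R -> R) (B : R) (m : nat).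
Hypotheses (m0 : (0 < m)%N) (wB : forall n j, `|w n j| <= B)
  (wV : forall u, 0 <= u < 1 ->
    w n (Num.truncn (u * n%:R / m%:R)) @[n --> \oo] --> V u).

Let mr0 : 0 < m%:R :> R. Proof. by rewrite ltr0n. Qed.

Let cell n j : set R := `[j%:R * m%:R / n%:R, j.+1%:R * m%:R / n%:R[.

Let cellP n j u : (0 < n)%N ->
  cell n j u <-> 0 <= u /\ Num.truncn (u * n%:R / m%:R) = j.
Proof.
move=> n0; have nr0 : 0 < n%:R :> R by rewrite ltr0n.
have E : cell n j u <-> j%:R <= u * n%:R / m%:R < j.+1%:R.
  by rewrite /cell /= in_itv/= ler_pdivrMr// ltr_pdivlMr// ler_pdivlMr// ltr_pdivrMr.
rewrite E; split.
  move=> /andP[h1 h2].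
  have u0 : 0 <= u * n%:R / m%:R by exact: le_trans h1.
  split; first by move: u0; rewrite pmulr_lge0 ?invr_gt0// pmulr_lge0.
  by apply/eqP; rewrite truncn_eq// h1 h2.
move=> [u0 <-]; apply: truncn_itv.
by rewrite mulr_ge0 ?invr_ge0 ?(ltW mr0)// mulr_ge0.
Qed.

Let step n u : R := \sum_(j < n | (j * m < n)%N) w n j * \1_(cell n j) u.

Let stepE n u : (0 < n)%N -> 0 <= u ->
  let j := Num.truncn (u * n%:R / m%:R) in
  step n u = if (j * m < n)%N then w n j else 0.
Proof.
move=> n0 u0 j; rewrite /step.
have ind i : \1_(cell n i) u = (i == j)%:R :> R.
  rewrite indicE; case: (eqVneq i j) => [->|ij].
    by rewrite mem_set//; apply/cellP.
  rewrite memNset// => /(cellP _ _ n0)[_ h]; move: ij; rewrite -h /j eqxx//.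
under eq_bigr do rewrite ind.
case: ifPn => jn.
  have jn' : (j < n)%N by rewrite (leq_ltn_trans _ jn)// leq_pmulr.
  rewrite (bigD1 (Ordinal jn'))//= eqxx mulr1 big1 ?addr0// => i /andP[_ ij].
  suff -> : (i : nat) == j = false by rewrite mulr0.
  by apply/negbTE; apply: contra ij => /eqP ij; apply/eqP/val_inj.
apply: big1 => i im; suff -> : (i : nat) == j = false by rewrite mulr0.
by apply/negbTE; apply: contra jn => /eqP <-.
Qed.

Let measurable_step n : measurable_fun [set: RR] (step n : RR -> R).
Proof.
rewrite (_ : step n = fun u => \sum_(j < n) (if (j * m < n)%N then w n j * \1_(cell n j) u else 0)).
  apply: measurable_sum => j; case: (j * m < n)%N => //.
  apply: measurable_funM => //; apply: measurable_indic; exact: measurable_itv.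
by apply/funext => u; rewrite /step big_mkcond.
Qed.

Let scaled_indic (A : set RR) (c x : R) : measurable A -> mu A = x%:E ->
  mu.-integrable setT (EFin \o (fun u : RR => c * \1_A u)) /\
  (\int[mu]_u (c * \1_A u)%:E)%E = (c * x)%:E.
Proof.
move=> mA muA.
have iA : mu.-integrable setT (EFin \o (\1_A : RR -> R)).
  apply/integrableP; split.
    by apply/measurable_EFinP; exact: measurable_indic.
  under eq_integral do rewrite /= ger0_norm//.
  apply: le_lt_trans (ltry x); rewrite -muA le_eqVlt; apply/orP; left; apply/eqP.
  by apply: etrans (integral_indic _ measurableT mA) _; rewrite setIT.
split; first exact: (integrableZl measurableT c iA).
apply: etrans (integralZl measurableT iA c) _.
by rewrite EFinM; congr (_ * _)%E; apply: etrans (integral_indic _ measurableT mA) _; rewrite setIT.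
Qed.

Let B0 : 0 <= B. Proof. exact: le_trans (normr_ge0 _) (wB 0 0). Qed.

Let step_lt0 n u : (0 < n)%N -> u < 0 -> step n u = 0.
Proof.
move=> n0 u0; rewrite /step big1// => j _; rewrite indicE memNset ?mulr0//.
by move=> /(cellP _ _ n0)[]; rewrite leNgt u0.
Qed.

Let step_gt n u : (0 < n)%N -> 1 <= u -> m%:R <= (u - 1) * n%:R -> step n u = 0.
Proof.
move=> n0 u1 um; have u0 : 0 <= u by exact: le_trans u1.
rewrite stepE// ltnNge; suff -> : (n <= Num.truncn (u * n%:R / m%:R) * m)%N by [].
have x0 : 0 <= u * n%:R / m%:R by rewrite mulr_ge0 ?invr_ge0 ?(ltW mr0)// mulr_ge0.
have /andP[_] := truncn_itv x0; rewrite ltr_pdivrMr// -natr1 => h.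
rewrite -(ler_nat R) natrM; apply/ltW; lra.
Qed.

Let step_le n u : (0 < n)%N -> `|step n u| <= B * \1_(`[0, 1 + m%:R]%classic) u.
Proof.
move=> n0; rewrite indicE; have [u0|u0] := ltP u 0.
  by rewrite step_lt0// normr0 mulr_ge0.
have [um|um] := leP u (1 + m%:R).
  rewrite mem_set/= ?in_itv/= ?u0// mulr1 stepE//.
  by case: ifP => _ //; rewrite normr0.
rewrite step_gt ?normr0 ?mulr_ge0//.
  by apply: ltW; apply: le_lt_trans um; rewrite lerDl.
have n1 : 1 <= n%:R :> R by rewrite ler1n.
have h : m%:R <= u - 1 by lra.
by apply: le_trans h _; rewrite ler_peMr//; move: mr0 um; lra.
Qed.

Let Rintegral_step n : (0 < n)%N ->
  \int[mu]_u step n u = m%:R * (n%:R^-1 * \sum_(j < n | (j * m < n)%N) w n j).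
Proof.
move=> n0; have nr0 : 0 < n%:R :> R by rewrite ltr0n.
have mu_cell j : mu (cell n j) = (m%:R / n%:R)%:E.
  apply: etrans (lebesgue_measure_itv _) _; rewrite /= lte_fin ifT.
    by rewrite -EFinB; congr EFin; rewrite -natr1; field; rewrite gt_eqF.
  by rewrite ltr_pM2r ?invr_gt0// ltr_pM2r// ltr_nat.
have mcell j : measurable (cell n j : set RR) by exact: measurable_itv.
rewrite /Rintegral /step.
under eq_integral do rewrite -sumEFin.
rewrite integral_sum//=; last first.
  by move=> j; have [] := scaled_indic (w n j) (mcell j) (mu_cell j).
rewrite (eq_bigr (fun j : 'I_n => (w n j * (m%:R / n%:R))%:E)); last first.
  by move=> j _; have [] := scaled_indic (w n j) (mcell j) (mu_cell j).
rewrite sumEFin/= -mulr_suml; ring.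
Qed.

(** The sum is the integral of a step function, on cells of width m / n, that
    converges at every point but 1, where the last cell ends; dominated
    convergence applies without any regularity of [V]. *)
Lemma riemann_cvg : cvgn (fun n => n%:R^-1 * \sum_(j < n | (j * m < n)%N) w n j).
Proof.
pose V' u := if 0 <= u < 1 then V u else 0.
have stepV u : u != 1 -> step n u @[n --> \oo] --> V' u.
  move=> u1; have [u0|u0] := ltP u 0.
    rewrite /V' leNgt u0/=; apply: cvg_near_cst; exists 1%N => // n /= n1.
    exact: step_lt0.
  have [ult|uge] := ltP u 1.
    rewrite /V' u0 ult/=; apply: cvg_trans (wV _); last by rewrite u0 ult.
    apply: near_eq_cvg; exists 1%N => // n /= n1; rewrite stepE// ifT//.
    have x0 : 0 <= u * n%:R / m%:R by rewrite mulr_ge0 ?invr_ge0 ?(ltW mr0)// mulr_ge0.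
    have /andP[h _] := truncn_itv x0; move: h; rewrite ler_pdivlMr// -natrM => h.
    rewrite -(ltr_nat R); apply: le_lt_trans h _.
    by rewrite gtr_pMl// ltr0n.
  have {}uge : 1 < u by rewrite lt_neqAle eq_sym u1.
  rewrite /V' u0/= ltNge (ltW uge)/=; apply: cvg_near_cst.
  have u10 : 0 < u - 1 by rewrite subr_gt0.
  exists (Num.truncn (m%:R / (u - 1))).+1 => // n /= nM.
  apply: step_gt; [exact: leq_ltn_trans nM|exact: ltW|].
  have := truncnS_gt (m%:R / (u - 1)); rewrite ltr_pdivrMr// mulrC => h.
  apply/ltW; apply: lt_le_trans h _; rewrite ler_wpM2l ?(ltW u10)//.
  by rewrite ler_nat.
have mstep1 : measurable (~` [set 1 : RR]) by apply: measurableC; exact: measurable_set1.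
have mV' : measurable_fun [set: RR] (V' : RR -> R).
  have h : measurable_fun (~` [set 1 : RR]) (V' : RR -> R).
    apply: (@measurable_fun_cvg _ RR R _ (fun n => step n)).
      by move=> n; apply: measurable_funS (measurable_step n).
    by move=> u /= u1; apply: stepV; apply/eqP.
  have -> : V' = V' \_ (~` [set 1 : RR]).
    apply/funext => u; rewrite patchE; case: ifPn => //.
    rewrite notin_setE/= => /contrapT ->; by rewrite /V' ltxx andbF.
  exact/(measurable_restrictT _ mstep1).
have ae : {ae mu, forall u, step n.+1 u @[n --> \oo] --> V' u}.
  exists [set 1]; split; [exact: measurable_set1|exact: lebesgue_measure_set1|].
  move=> u /=; apply: contra_notP => /eqP u1; have := stepV u u1.
  by rewrite -(cvg_shiftS (fun n => step n u)).
have iB : mu.-integrable setT (EFin \o (fun u => B * \1_(`[0, 1 + m%:R]%classic) u)).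
  have mI : mu (`[0, 1 + m%:R]%classic : set RR) = (1 + m%:R)%:E.
    apply: etrans (lebesgue_measure_itv _) _; rewrite /= lte_fin ifT.
      by rewrite -EFinB subr0.
    by rewrite addr_gt0.
  by have [] := scaled_indic B (measurable_itv _) mI.
have h := Rintegral_dominated_cvg (fun n => measurable_step n.+1) mV' ae iB
  (fun n u => step_le u (ltn0Sn n)).
apply/cvg_ex; exists (m%:R^-1 * \int[mu]_x V' x).
rewrite -cvg_shiftS/=.
have -> : (fun n => n.+1%:R^-1 * \sum_(j < n.+1 | (j * m < n.+1)%N) w n.+1 j) =
   (fun n => m%:R^-1 * \int[mu]_x step n.+1 x).
  by apply/funext => n; rewrite Rintegral_step// mulKf// gt_eqF.
by apply: cvgM => //; exact: cvg_cst.
Qed.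

End RiemannSum.

(** * The laws of the entries *)

Section BlockGrowth.
Variable R : realType.

Lemma sum_sqr_le_prod_wt (x : nat -> R) L :
  1 + \sum_(l < L) x l ^+ 2 <= \prod_(l < L) wt 1 (x l).
Proof.
elim: L => [|L IH]; first by rewrite !big_ord0 addr0.
rewrite !big_ord_recr/= addrA {2}/wt expr1 mulrDr mulr1 lerD//.
rewrite ler_peMl ?sqr_ge0//; apply: le_trans IH.
by rewrite lerDl; apply: sumr_ge0 => l _; exact: sqr_ge0.
Qed.

(** The growth of the statistic in terms of a product of functions of the single
    entries, as convergence of product laws requires. *)
Lemma jstat_growth f (c : R) k n x : 0 <= c ->
  (forall y, `|f y| <= c * (1 + y ^+ (2 * k))) ->
  `|jstat f n x| <= c * n%:R * (1 + n%:R ^+ (2 * k)) * \prod_(l < 2 * n) wt k (x l).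
Proof.
move=> c0 fk; apply: le_trans (trf_growth (tridiag_sym _ _ _) fk c0) _.
rewrite -[leRHS]mulrA ler_wpM2l ?mulr_ge0//.
set S := \sum_(l < 2 * n) x l ^+ 2.
have S0 : 0 <= S by apply: sumr_ge0 => l _; exact: sqr_ge0.
have xS (l : nat) : (l < 2 * n)%N -> x l ^+ 2 <= S.
  move=> ln; rewrite /S (bigD1 (Ordinal ln))//= lerDl.
  by apply: sumr_ge0 => i _; exact: sqr_ge0.
have AS : \sum_i \sum_j (jacobi n x) i j ^+ 2 <= n%:R ^+ 2 * S.
  apply: (@le_trans _ _ (\sum_(i < n) \sum_(j < n) S)).
    apply: ler_sum => i _; apply: ler_sum => j _; rewrite mxE.
    have in_ := ltn_ord i; have jn := ltn_ord j.
    case: (i == j :> nat); first by apply: xS; lia.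
    case: (i == j.+1 :> nat); first by apply: xS; lia.
    case: (j == i.+1 :> nat); first by apply: xS; lia.
    by rewrite expr0n.
  by rewrite !sumr_const !card_ord -mulrnA -[leLHS]mulr_natl natrM expr2.
have A0 : 0 <= \sum_i \sum_j (jacobi n x) i j ^+ 2.
  by apply: sumr_ge0 => i _; apply: sumr_ge0 => j _; exact: sqr_ge0.
have prodE : \prod_(l < 2 * n) wt k (x l) = (\prod_(l < 2 * n) wt 1 (x l)) ^+ k.
  by rewrite -prodrXl; apply: eq_bigr => l _; rewrite /wt expr1.
have Sk : (1 + S) ^+ k <= \prod_(l < 2 * n) wt k (x l).
  rewrite prodE lerXn2r ?nnegrE ?addr_ge0//; last exact: sum_sqr_le_prod_wt.
  by apply: prodr_ge0 => l _; exact: wt_ge0.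
have Sk1 : 1 <= (1 + S) ^+ k by rewrite exprn_ege1// lerDl.
apply: (@le_trans _ _ ((1 + n%:R ^+ (2 * k)) * (1 + S) ^+ k)); last first.
  by rewrite ler_wpM2l// addr_ge0// exprn_ge0.
rewrite mulrDl mul1r lerD//.
apply: (@le_trans _ _ ((n%:R ^+ 2 * S) ^+ k)).
  by rewrite lerXn2r ?nnegrE// mulr_ge0// exprn_ge0.
rewrite exprMn exprM ler_wpM2l ?exprn_ge0// lerXn2r ?nnegrE ?addr_ge0//.
by rewrite lerDr.
Qed.

End BlockGrowth.

Section EntryLaws.
Variable R : realType.
Variable alpha : R.
Hypothesis alpha0 : 0 < alpha.

(** The real line carries two displays of its Borel sets, one of them for the
    Gaussian laws. *)
Lemma measurable_retype :
  measurable_fun [set: measurableTypeR R] (fun x : measurableTypeR R => x : R).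
Proof. exact: measurable_id. Qed.

Definition normal_law : probability R R :=
  distribution (std_normal R) (rv_of measurable_retype).

Lemma normal_lawE A : normal_law A = gaussian_law 1 A.
Proof.
rewrite /normal_law /distribution/= /pushforward /gaussian_law oner_eq0.
by rewrite sqrtr1.
Qed.

Definition zero_law : probability R R := \d_(0 : R).

(** The laws of the sequence a_1, b_1, a_2, b_2, and so on, of the entries of
    the matrix of size [n], followed by zeros. *)
Definition gbe_law n j : probability R R :=
  if odd j then
    if (j./2 < n.-1)%N then chi_prob (alpha * (n - j./2.+1)%:R / n%:R) else zero_law
  else if (j./2 < n)%N then normal_law else zero_law.

(** The laws seen in the bulk: around site u n the shape parameters of the
    off-diagonal entries are close to [s] = alpha (1 - u), and the zeros are far
    away. *)
Definition limit_law (s : R) j : probability R R :=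
  if odd j then chi_prob s else normal_law.

Definition entryB K : R := chiB alpha K + Ex (std_normal R) (wt K) + 1.

Lemma chiB_ge0 K : 0 <= chiB alpha K.
Proof.
rewrite -lee_fin; apply: le_trans (chi_wt_le K alpha0 (lexx _)).
by apply: integral_ge0 => y _; rewrite lee_fin wt_ge0.
Qed.

Lemma am_normal_wt K : all_moments (std_normal R) (wt K).
Proof.
apply: amX; apply: amD; first exact: am_cst.
exact/amX/am_std_normal.
Qed.

Lemma normal_wt_ge0 K : 0 <= Ex (std_normal R) (wt K).
Proof. by apply: Ex_ge0 => z; exact: wt_ge0. Qed.

Lemma entryB_ge0 K : 0 <= entryB K.
Proof. by rewrite !addr_ge0 ?chiB_ge0 ?normal_wt_ge0. Qed.

Lemma chi_wt_entryB K s : 0 < s -> s <= alpha ->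
  (\int[chi_prob s]_y (wt K y)%:E <= (entryB K)%:E)%E.
Proof.
move=> s0 sa; apply: le_trans (chi_wt_le K s0 sa) _; rewrite lee_fin /entryB -addrA.
by rewrite lerDl addr_ge0 ?normal_wt_ge0.
Qed.

Lemma normal_wt_entryB K : (\int[normal_law]_y (wt K y)%:E <= (entryB K)%:E)%E.
Proof.
rewrite ge0_integral_distribution//; last 2 first.
- by apply/measurable_EFinP; exact: measurable_wt.
- by move=> y; rewrite lee_fin wt_ge0.
rewrite [leLHS](Ex_EFin (am_normal_wt K)) lee_fin /entryB addrAC.
by rewrite lerDr addr_ge0 ?chiB_ge0.
Qed.

Lemma dirac_wt_entryB K : (\int[zero_law]_y (wt K y)%:E <= (entryB K)%:E)%E.
Proof.
rewrite /zero_law integral_dirac//; last by apply/measurable_EFinP; exact: measurable_wt.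
rewrite diracT mul1e lee_fin /wt expr0n addr0 expr1n /entryB.
by rewrite lerDr addr_ge0 ?chiB_ge0 ?normal_wt_ge0.
Qed.

Lemma shape_bounds n i : (i < n.-1)%N -> 0 < alpha * (n - i.+1)%:R / n%:R <= alpha.
Proof.
move=> im; have n0 : (0 < n)%N by lia.
rewrite divr_gt0 ?mulr_gt0 ?ltr0n//; last by lia.
by rewrite ler_pdivrMr ?ltr0n// ler_pM2l// ler_nat leq_subr.
Qed.

Lemma gbe_law_wt K n j : (\int[gbe_law n j]_y (wt K y)%:E <= (entryB K)%:E)%E.
Proof.
rewrite /gbe_law; case: ifP => _; case: ifPn => h.
- by have /andP[? ?] := shape_bounds h; exact: chi_wt_entryB.
- exact: dirac_wt_entryB.
- exact: normal_wt_entryB.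
- exact: dirac_wt_entryB.
Qed.

Lemma dom_cvg_near d (E : measurableType d) (w : E -> R) B B'
    (nu_ nu'_ : nat -> probability E R) nu N :
  (forall n, (\int[nu_ n]_x (w x)%:E <= B%:E)%E) -> B' <= B ->
  (forall n, (N <= n)%N -> nu_ n = nu'_ n) ->
  dom_cvg w B' nu'_ nu -> dom_cvg w B nu_ nu.
Proof.
move=> wB BB nuE [mw w0 wB' wB'' cG]; split=> //.
  by apply: le_trans wB'' _; rewrite lee_fin.
move=> G_ G C mG GG GC; apply: cvg_trans (cG _ _ _ mG GG GC).
by apply: near_eq_cvg; exists N => // n /= Nn; rewrite nuE.
Qed.

Let half_le l : (l./2 <= l)%N.
Proof. by rewrite -divn2 leq_div. Qed.

(** The block that contains site u n starts less than [m] sites before it;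
    hence its shape parameters tend to alpha (1 - u), and for u < 1 its
    entries are eventually all inside the matrix. *)
Lemma gbe_law_cvg K m l u : 0 <= u < 1 -> (0 < m)%N ->
  dom_cvg (wt K) (entryB K)
    (fun n => gbe_law n (2 * (Num.truncn (u * n%:R / m%:R) * m) + l))
    (limit_law (alpha * (1 - u)) l).
Proof.
move=> /andP[u0 u1] m0; have mr0 : 0 < m%:R :> R by rewrite ltr0n.
pose q n := (Num.truncn (u * n%:R / m%:R : R) * m)%N.
have qb n : u * n%:R - m%:R <= (q n)%:R :> R /\ (q n)%:R <= u * n%:R :> R.
  have x0 : 0 <= u * n%:R / m%:R by rewrite mulr_ge0 ?invr_ge0 ?(ltW mr0)// mulr_ge0.
  have /andP[] := truncn_itv x0.
  rewrite ler_pdivlMr// ltr_pdivrMr// -natr1 mulrDl mul1r natrM => h1 h2.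
  by split => //; rewrite lerBlDr ltW.
pose i n := (q n + l./2)%N.
have oddE n : odd (2 * q n + l) = odd l by rewrite oddD oddM.
have halfE n : (2 * q n + l)./2 = i n by rewrite mul2n halfD odd_double doubleK.
have lawE n : gbe_law n (2 * q n + l) = if odd l then
    if (i n < n.-1)%N then chi_prob (alpha * (n - (i n).+1)%:R / n%:R) else zero_law
    else if (i n < n)%N then normal_law else zero_law.
  by rewrite /gbe_law oddE halfE.
have u10 : 0 < 1 - u by rewrite subr_gt0.
pose N0 := (Num.truncn (l.+2%:R / (1 - u) : R)).+1.
have iN n : (N0 <= n)%N -> (i n < n.-1)%N.
  move=> h; have hN : l.+2%:R <= (1 - u) * n%:R.
    have := truncnS_gt (l.+2%:R / (1 - u)); rewrite ltr_pdivrMr// mulrC => h1.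
    by apply/ltW; apply: lt_le_trans h1 _; rewrite ler_wpM2l ?(ltW u10)// ler_nat.
  have [_ h2] := qb n.
  suff : (i n + 2 <= n)%N by lia.
  rewrite -(ler_nat R) !natrD.
  have : (l./2)%:R <= l%:R :> R by rewrite ler_nat half_le.
  move: hN; rewrite -!natr1 => *; lra.
have s0 : 0 < alpha * (1 - u) by rewrite mulr_gt0.
have sa : alpha * (1 - u) <= alpha by rewrite ler_piMr ?(ltW alpha0)//; lra.
rewrite -/(q _); under eq_fun do rewrite -/(q _) lawE.
have wB n := gbe_law_wt K n (2 * q n + l).
rewrite /limit_law; case: ifPn => ol; last first.
  apply: (@dom_cvg_eventually _ _ _ _ _ _ _ N0).
  - exact: measurable_wt.
  - exact: wt_ge0.
  - by move=> n; have := wB n; rewrite lawE (negbTE ol).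
  - by move=> n /iN h; rewrite ifT// (leq_trans h)// leq_pred.
pose s_ n := if (i n < n.-1)%N then alpha * (n - (i n).+1)%:R / n%:R else alpha * (1 - u).
apply: (@dom_cvg_near _ _ _ _ (chiB alpha K) _ (fun n => chi_prob (s_ n)) _ N0).
- by move=> n; have := wB n; rewrite lawE ol.
- by rewrite /entryB -addrA lerDl addr_ge0 ?normal_wt_ge0.
- by move=> n /iN h; rewrite /s_ h.
apply: dom_cvg_chi => // [n|].
  by rewrite /s_; case: ifP => h; [exact: shape_bounds|rewrite s0].
apply/cvgrPdist_le => e e0.
pose N1 := (Num.truncn (alpha * (m + l + 1)%:R / e)).+1.
exists (maxn N0 N1) => // n /=; rewrite geq_max => /andP[nN0 nN1].
have h := iN n nN0; rewrite /s_ h.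
have iN' : ((i n).+1 <= n)%N := leq_trans h (leq_pred n).
have n0 : (0 < n)%N := leq_ltn_trans (leq0n _) iN'.
have nr0 : 0 < n%:R :> R by rewrite ltr0n.
have [q1 q2] := qb n.
have lh : (l./2)%:R <= l%:R :> R by rewrite ler_nat half_le.
have l0 : 0 <= (l./2)%:R :> R by [].
have -> : alpha * (1 - u) - alpha * (n - (i n).+1)%:R / n%:R =
   alpha * ((q n)%:R + (l./2)%:R + 1 - u * n%:R) / n%:R.
  rewrite natrB//.
  by rewrite -natr1 natrD; field; rewrite gt_eqF.
rewrite normrM normrV ?unitfE ?gt_eqF// (gtr0_norm nr0) normrM (gtr0_norm alpha0).
rewrite ler_pdivrMr//.
have eN : alpha * (m + l + 1)%:R <= e * n%:R.
  have := truncnS_gt (alpha * (m + l + 1)%:R / e); rewrite ltr_pdivrMr// => h1.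
  rewrite [leRHS]mulrC; apply/ltW; apply: lt_le_trans h1 _.
  by rewrite ler_pM2r// ler_nat.
apply: le_trans eN; rewrite ler_pM2l// !natrD ler_norml.
have m1 : 0 <= m%:R :> R by exact: ltW.
by apply/andP; split; lra.
Qed.

End EntryLaws.

(** * The variance of a block *)

(** Means of functionals of a window depend on the laws only. *)
Lemma Ex_window d (T : measurableType d) (R : realType) (P : probability T R)
    (X : nat -> T -> R) nu i L (G : L.-tuple R -> R) :
  independent_with_laws P X nu -> measurable_fun setT G ->
  all_moments P (fun w => G (window X i L w)) ->
  Ex P (fun w => G (window X i L w)) = Ex (product_law (fun j => nu (i + j)%N) L) G.
Proof.
move=> Xnu mG aG; have mW := @measurable_window _ _ _ _ _ P X nu i L Xnu.
rewrite /Ex /Rintegral; congr fine.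
transitivity (\int[distribution P (rv_of mW)]_t (G t)%:E)%E.
  rewrite integral_distribution//; last exact: am_integrable aG.
  exact/measurable_EFinP.
apply: eq_measure_integral => A mA _; exact: (@window_law _ _ _ _ _ P X nu i L Xnu A mA).
Qed.

Section BlockVariance.
Variables (R : realType) (f : R -> R) (c : R) (k : nat).
Hypotheses (cf : continuous f) (c0 : 0 <= c)
  (fk : forall y, `|f y| <= c * (1 + y ^+ (2 * k))).

Definition block_stat m (t : (2 * m).-tuple R) : R := jstat f m (nth 0 t).

(** The variance of the statistic of size [m] for independent entries of laws
    [nu], computed under the product law: a quantity attached to laws, hence
    comparable across probability spaces. *)
Definition block_variance (nu : nat -> probability R R) m : R :=
  Ex (product_law nu (2 * m)) (fun t => block_stat t ^+ 2) -
  Ex (product_law nu (2 * m)) (@block_stat m) ^+ 2.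

Let wp m (t : (2 * m).-tuple R) := \prod_(j < 2 * m) wt (2 * k) (tnth t j).

Let Cg m : R := c * m%:R * (1 + m%:R ^+ (2 * k)).

Let Cg0 m : 0 <= Cg m.
Proof. by rewrite /Cg !mulr_ge0// addr_ge0// exprn_ge0. Qed.

Let measurable_block_stat m : measurable_fun setT (@block_stat m).
Proof. by have [] := @local_jstat R f m cf. Qed.

Let wpE m (t : (2 * m).-tuple R) : \prod_(l < 2 * m) wt k (nth 0 t l) ^+ 2 = wp t.
Proof.
by apply: eq_bigr => l _; rewrite -tnth_nth /wt -exprM (mulnC k).
Qed.

Let block_stat_sqr_le m (t : (2 * m).-tuple R) :
  `|block_stat t ^+ 2| <= Cg m ^+ 2 * wp t.
Proof.
rewrite normrX -wpE prodrXl -exprMn lerXn2r ?nnegrE//.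
  by rewrite mulr_ge0//; apply: prodr_ge0 => l _; exact: wt_ge0.
exact: jstat_growth.
Qed.

Let block_stat_le m (t : (2 * m).-tuple R) : `|block_stat t| <= Cg m * wp t.
Proof.
apply: le_trans (jstat_growth m (nth 0 t) c0 fk) _; rewrite ler_wpM2l ?Cg0//.
rewrite -wpE; apply: ler_prod => l _; rewrite wt_ge0/= expr2.
by rewrite ler_peMl ?wt_ge0 ?wt_ge1.
Qed.

(** For a fixed size the statistic and its square grow polynomially, so that
    they are test functions for the convergence of the product laws. *)
Lemma block_variance_cvg B (nu_ : nat -> nat -> probability R R) nu m :
  (forall j, dom_cvg (wt (2 * k)) B (fun n => nu_ n j) (nu j)) ->
  block_variance (nu_ n) m @[n --> \oo] --> block_variance nu m.
Proof.
move=> cnu; have [_ _ _ _ cG] := dom_cvg_product_law (2 * m)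
  (@measurable_wt R (2 * k)) (wt_ge0 (2 * k)) cnu.
have mB := @measurable_block_stat m.
have c2 : Ex (product_law (nu_ n) (2 * m)) (fun t => block_stat t ^+ 2) @[n --> \oo] -->
    Ex (product_law nu (2 * m)) (fun t => block_stat t ^+ 2).
  apply: (cG _ _ (Cg m ^+ 2)).
  - by move=> _; exact: measurable_funX.
  - by move=> t; exact: cvg_cst.
  - by move=> _ t; exact: block_stat_sqr_le.
have c1 : Ex (product_law (nu_ n) (2 * m)) (@block_stat m) @[n --> \oo] -->
    Ex (product_law nu (2 * m)) (@block_stat m).
  apply: (cG _ _ (Cg m)).
  - by move=> _.
  - by move=> t; exact: cvg_cst.
  - by move=> _ t; exact: block_stat_le.
by apply: cvgB => //; exact: cvgM.
Qed.

Lemma block_variance_le B (nu : nat -> probability R R) m : 0 <= B ->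
  (forall j, (\int[nu j]_y (wt (2 * k) y)%:E <= B%:E)%E) ->
  `|block_variance nu m| <=
  Cg m ^+ 2 * B ^+ (2 * m) + (Cg m * B ^+ (2 * m)) ^+ 2.
Proof.
move=> B0 nuB.
have cnu j : dom_cvg (wt (2 * k)) B (fun _ : nat => nu j) (nu j).
  apply: (@dom_cvg_eventually _ _ _ _ _ _ _ 0%N) => //.
  - exact: measurable_wt.
  - exact: wt_ge0.
have [mw w0 _ wB _] := dom_cvg_product_law (2 * m)
  (@measurable_wt R (2 * k)) (wt_ge0 (2 * k)) cnu.
have mB := @measurable_block_stat m.
have m2 : measurable_fun setT (fun t : (2 * m).-tuple R => block_stat t ^+ 2).
  exact: measurable_funX.
have h2 := dominated_Ex_le mw w0 wB m2 (sqr_ge0 _) (@block_stat_sqr_le m).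
have h1 := dominated_Ex_le mw w0 wB mB (Cg0 m) (@block_stat_le m).
rewrite (le_trans (ler_normB _ _))// lerD// normrX lerXn2r ?nnegrE//.
by rewrite mulr_ge0// exprn_ge0.
Qed.

Variable alpha : R.
Hypothesis alpha0 : 0 < alpha.

(** The blocks start at the sites j m < n; the last one may overlap the padding. *)
Definition total_variance m n : R := n%:R^-1 * \sum_(j < n | (j * m < n)%N)
  block_variance (fun l => gbe_law alpha n (2 * (j * m) + l)) m.

(** A Riemann sum: the block at site u n contributes a variance that tends to
    that of a block of entries of laws [limit_law (alpha * (1 - u))]. *)
Lemma total_variance_cvg m : (0 < m)%N -> cvgn (total_variance m).
Proof.
move=> m0.
apply: (@riemann_cvg R (fun n j => block_variance (fun l => gbe_law alpha n (2 * (j * m) + l)) m)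
  (fun u => block_variance (limit_law (alpha * (1 - u))) m)
  (Cg m ^+ 2 * entryB alpha (2 * k) ^+ (2 * m) + (Cg m * entryB alpha (2 * k) ^+ (2 * m)) ^+ 2)
  m m0).
- move=> n j; apply: block_variance_le; first exact: entryB_ge0.
  by move=> l; exact: gbe_law_wt.
- move=> u u01; apply: (@block_variance_cvg (entryB alpha (2 * k))) => l.
  exact: gbe_law_cvg.
Qed.

Lemma var_block d (T : measurableType d) (P : probability T R)
    (X : nat -> T -> R) nu i m : independent_with_laws P X nu ->
  all_moments P (fun w => jstat f m (shift i (X^~ w))) ->
  var P (fun w => jstat f m (shift i (X^~ w))) =
  block_variance (fun l => nu (i + l)%N) m.
Proof.
move=> Xnu aJ.
have EJ w : jstat f m (shift i (X^~ w)) = block_stat (window X i (2 * m) w).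
  exact: (local_window X i w (local_jstat m cf)).
have ExJ (G : R -> R) : measurable_fun setT G ->
    all_moments P (fun w => G (jstat f m (shift i (X^~ w)))) ->
    Ex P (fun w => G (jstat f m (shift i (X^~ w)))) =
    Ex (product_law (fun l => nu (i + l)%N) (2 * m)) (fun t => G (block_stat t)).
  move=> mG aG.
  have aG' : all_moments P (fun w => G (block_stat (window X i (2 * m) w))).
    by under eq_fun do rewrite -EJ.
  transitivity (Ex P (fun w => G (block_stat (window X i (2 * m) w)))).
    by apply: eq_Ex => w; rewrite EJ.
  apply: (@Ex_window _ _ _ _ _ _ _ _ (fun t => G (block_stat t)) Xnu _ aG').
  by apply: measurableT_comp => //; exact: measurable_block_stat.
rewrite (varE aJ) /block_variance.
have m2 : measurable_fun [set: R] (fun y : R => y ^+ 2) by exact: measurable_funX.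
by rewrite (ExJ _ m2 (amX 2 aJ)) (ExJ id (@measurable_id _ _ _) aJ).
Qed.

End BlockVariance.

(** * The matrix as a sequence of independent entries *)

Section EmpiricalMean.
Variable R : realType.

Lemma Rintegral_empirical (s : seq R) (f : R -> R) : measurable_fun setT f ->
  \int[empirical_distribution s]_x f x = (size s)%:R^-1 * \sum_(x <- s) f x.
Proof.
move=> mf.
have ge0 (g : R -> R) : measurable_fun setT g -> (forall x, 0 <= g x) ->
    (\int[empirical_distribution s]_x (g x)%:E =
     ((size s)%:R^-1 * \sum_(x <- s) g x)%:E)%E.
  move=> mg g0; rewrite /empirical_distribution ge0_integral_mscale//; last first.
  - by move=> x _; rewrite lee_fin.
  - exact/measurable_EFinP.
  rewrite ge0_integral_measure_sum//; last 2 first.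
  - by move=> x _; rewrite lee_fin.
  - exact/measurable_EFinP.
  rewrite EFinM; congr (_ * _)%E; rewrite (big_nth 0) big_mkord -sumEFin.
  apply: eq_bigr => i _; rewrite integral_dirac//; last exact/measurable_EFinP.
  by rewrite diracT mul1e.
have mp : measurable_fun setT (fun x => Num.max (f x) 0).
  by apply: measurable_maxr => //.
have mn : measurable_fun setT (fun x => Num.max (- f x) 0).
  by apply: measurable_maxr => //; exact: measurableT_comp.
rewrite /Rintegral integralE.
have -> : (\int[empirical_distribution s]_x ((fun x => (f x)%:E)^\+ x) =
   \int[empirical_distribution s]_x (Num.max (f x) 0)%:E)%E.
  by apply: eq_integral => x _; rewrite funeposE/= EFin_max.
have -> : (\int[empirical_distribution s]_x ((fun x => (f x)%:E)^\- x) =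
   \int[empirical_distribution s]_x (Num.max (- f x) 0)%:E)%E.
  by apply: eq_integral => x _; rewrite funenegE/= EFin_max.
rewrite !ge0//; try by move=> x; rewrite le_max lexx orbT.
rewrite -EFinB/= -mulrBr -sumrB; congr (_ * _); apply: eq_bigr => x _.
have /orP[h|h] := le_total 0 (f x).
  by rewrite max_l// max_r ?oppr_le0// subr0.
by rewrite max_r// max_l ?oppr_ge0// sub0r opprK.
Qed.

End EmpiricalMean.

Section PaddedMatrix.
Variable R : realType.
Implicit Types (f : R -> R) (x : nat -> R).

Lemma jstat_zero f q : jstat f q (fun=> 0) = q%:R * f 0.
Proof.
elim: q => [|q IH]; first by rewrite jstat0 mul0r.
have := @trf_tridiag_split R f 1 q (fun=> 0) (fun=> 0) (fun _ _ => erefl).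
rewrite -/(jstat f 1 (fun=> 0)) -/(jstat f q (fun=> 0)) -/(jstat f (1 + q) (fun=> 0)).
by rewrite jstat1 IH => E; apply: etrans E _; rewrite -natr1; ring.
Qed.

(** The zeros let the statistic be read off a matrix of a larger, dyadic size,
    to which they contribute a constant. *)
Definition padded n (a b : nat -> R) j : R :=
  if odd j then (if (j./2 < n.-1)%N then b j./2 else 0)
  else (if (j./2 < n)%N then a j./2 else 0).

Lemma padded_even n a b i : padded n a b (2 * i) = if (i < n)%N then a i else 0.
Proof. by rewrite /padded mul2n odd_double doubleK. Qed.

Lemma padded_odd n a b i : padded n a b (2 * i).+1 = if (i < n.-1)%N then b i else 0.
Proof. by rewrite /padded mul2n /= odd_double/= uphalf_double. Qed.

Lemma jstat_padded f n q a b :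
  jstat f (n + q) (padded n a b) = trf f (tridiag n a b) + q%:R * f 0.
Proof.
rewrite /jstat /jacobi trf_tridiag_split; last first.
  by move=> i; rewrite padded_odd; case: ifP => //; lia.
apply: (f_equal2 (fun u v : R => u + v)).
  congr (trf f _); apply: tridiag_ext => i ni.
    by rewrite padded_even ni.
  by rewrite padded_odd ifT//; lia.
rewrite -jstat_zero; congr (trf f _); apply: tridiag_ext => i ni.
  by rewrite padded_even ltnNge leq_addr.
by rewrite padded_odd ifN//; lia.
Qed.

End PaddedMatrix.

Section Model.
Context d (T : measurableType d) (R : realType) (P : probability T R).
Variables (n : nat) (alpha : R) (a b : nat -> {RV P >-> R}).
Hypotheses (n0 : (0 < n)%N) (alpha0 : 0 < alpha)
  (gbe : gbe_entries n (2 * alpha / n%:R) a b).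

Definition entry_process j w : R := padded n (a^~ w) (b^~ w) j.

Lemma measurable_entry_process j : measurable_fun setT (entry_process j).
Proof.
rewrite /entry_process /padded; case: (odd j).
  by case: (j./2 < n.-1)%N; [exact: measurable_funP|exact: measurable_cst].
by case: (j./2 < n)%N; [exact: measurable_funP|exact: measurable_cst].
Qed.

Let big_even_odd (F : nat -> \bar R) M :
  (\prod_(j < 2 * M) F j =
   (\prod_(i < M) F (2 * i)%N) * (\prod_(i < M) F (2 * i).+1))%E.
Proof.
elim: M => [|M IH]; first by rewrite muln0 !big_ord0 mule1.
rewrite mulnS add2n !big_ord_recr/= IH -!muleA; congr (_ * _)%E.
by rewrite muleCA.
Qed.

Let big_trim (F : nat -> \bar R) M M' : (M <= M')%N ->
  (forall i, (M <= i < M')%N -> F i = 1%E) ->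
  (\prod_(i < M') F i = \prod_(i < M) F i)%E.
Proof.
move=> MM F1; rewrite (big_ord_widen _ F MM) [RHS]big_mkcond; apply: eq_bigr => i _.
by case: ltnP => // Mi; rewrite F1// Mi ltn_ord.
Qed.

(** Independence is given for the entries that occur in the matrix; the padding
    is constant, so that the events that it enters are either void or
    certain. *)
Lemma entry_process_laws : independent_with_laws P entry_process (gbe_law alpha n).
Proof.
split; first exact: measurable_entry_process.
move=> N A mA.
have [diag sub indep] := gbe.
pose A' j := if (j < N)%N then A j else setT.
have mA' j : measurable (A' j) by rewrite /A'; case: ifP.
pose M := maxn n N.
pose pad j := if odd j then ~~ (j./2 < n.-1)%N else ~~ (j./2 < n)%N.
have pad0 j w : pad j -> entry_process j w = 0.
  by rewrite /pad /entry_process /padded; case: (odd j) => /negbTE ->.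
have padL j : pad j -> gbe_law alpha n j = zero_law R.
  by rewrite /pad /gbe_law; case: (odd j) => /negbTE ->.
have [[j0 [j0N pj0 Aj0]]|noz] := pselect (exists j, [/\ (j < N)%N, pad j & ~ A j 0]).
  rewrite (_ : [set w | _] = set0); last first.
    by apply/seteqP; split => // w /= /(_ j0 j0N); rewrite pad0.
  rewrite measure0 (bigD1 (Ordinal j0N))//= padL// /zero_law/= diracE.
  by rewrite memNset// mul0e.
have A0 j : pad j -> A' j 0.
  rewrite /A' => pj; case: ifP => // jN; apply: contrapT => nA.
  by apply: noz; exists j.
have -> : (\prod_(j < N) gbe_law alpha n j (A j) =
    \prod_(j < 2 * M) gbe_law alpha n j (A' j))%E.
  have NM : (N <= 2 * M)%N.
    by rewrite (@leq_trans M)// ?leq_maxr// leq_pmull.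
  rewrite (@big_trim (fun j => gbe_law alpha n j (A' j)) _ _ NM).
    by apply: eq_bigr => j _; rewrite /A' ltn_ord.
  move=> i /andP[Ni _]; rewrite /A' ltnNge Ni/=; exact: probability_setT.
have F1 j : pad j -> gbe_law alpha n j (A' j) = 1%E.
  by move=> pj; rewrite padL// /zero_law/= diracE mem_set//; exact: A0.
rewrite (big_even_odd (fun j => gbe_law alpha n j (A' j))).
rewrite (@big_trim (fun i => gbe_law alpha n (2 * i)%N (A' (2 * i)%N)) _ _ (leq_maxl n N)); last first.
  move=> i /andP[ni _]; apply: F1.
  by rewrite /pad mul2n odd_double doubleK -leqNgt.
have n1M : (n.-1 <= M)%N by rewrite (leq_trans (leq_pred n))// leq_maxl.
rewrite (@big_trim (fun i => gbe_law alpha n (2 * i).+1 (A' (2 * i).+1)) _ _ n1M); last first.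
  move=> i /andP[ni _]; apply: F1.
  by rewrite /pad mul2n /= odd_double/= uphalf_double -leqNgt.
pose B (k : 'I_n + 'I_n.-1) := match k with inl i => A' (2 * i)%N | inr i => A' (2 * i).+1 end.
have mB k : k \in [set: 'I_n + 'I_n.-1]%SET -> measurable (B k) by case: k => i _; exact: mA'.
have := indep [set: 'I_n + 'I_n.-1]%SET B mB.
have -> : \bigcap_(i in [set` [set: 'I_n + 'I_n.-1]%SET])
    (match i with inl i => a i | inr i => b i end : {RV P >-> R}) @^-1` B i =
    [set w | forall j, (j < N)%N -> A j (entry_process j w)].
  apply/seteqP; split=> w /= H.
    move=> j jN; suff : A' j (entry_process j w) by rewrite /A' jN.
    have [pj|npj] := boolP (pad j); first by rewrite pad0//; exact: A0.
    move: npj; rewrite /pad /entry_process /padded.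
    have jE := odd_double_half j; case: (odd j) jE => jE; rewrite negbK => h; rewrite h.
      have := H (inr (Ordinal h)); rewrite /B/= => /(_ _).
      by rewrite mul2n -[(_).*2.+1]add1n jE; apply; rewrite inE.
    have := H (inl (Ordinal h)); rewrite /B/= => /(_ _).
    by rewrite mul2n -[_.*2]add0n jE; apply; rewrite inE.
  move=> [i|i] _ /=.
    rewrite /B /A'; case: ifP => // iN; have := H _ iN.
    by rewrite /entry_process padded_even ltn_ord.
  rewrite /B /A'; case: ifP => // iN; have := H _ iN.
  by rewrite /entry_process padded_odd ltn_ord.
move=> ->; rewrite big_mkcond/=.
under eq_bigr do rewrite inE.
rewrite big_sumType/=; congr (_ * _)%E; apply: eq_bigr => i _.
  have := diag i (A' (2 * i)%N) (mA' _); rewrite /distribution/= /pushforward => ->.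
  rewrite /gbe_law mul2n odd_double doubleK ltn_ord; exact/esym/normal_lawE.
have := sub i (A' (2 * i).+1) (mA' _); rewrite /distribution/= /pushforward => ->.
rewrite /gbe_law mul2n /= odd_double/= uphalf_double ltn_ord.
have /andP[s0 _] := shape_bounds alpha0 (ltn_ord i).
have -> : (n - i.+1)%:R * (2 * alpha / n%:R) = 2 * (alpha * (n - i.+1)%:R / n%:R) :> R.
  by ring.
exact/esym/chi_probE.
Qed.

Lemma linear_statisticE (f : R -> R) q w : measurable_fun setT f ->
  linear_statistic n a b f w =
  n%:R^-1 * (jstat f (n + q) (entry_process^~ w) - q%:R * f 0).
Proof.
move=> mf; rewrite /linear_statistic Rintegral_empirical//.
rewrite size_eigenvalues ?tridiag_sym//; congr (_ * _).
by rewrite [jstat _ _ _]jstat_padded addrK.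
Qed.

End Model.

(** * Deviations in L2 *)

(** Both sides are means over the same Gaussian variable. The square roots are
    the natural scale here: it is deviations, not variances, that the block
    approximation controls. *)
Lemma heat_lipschitz (R : realType) M (h : R -> R) v v' x : bounded_lipschitz M h ->
  `|heat v h x - heat v' h x| <= M * `|Num.sqrt v - Num.sqrt v'|.
Proof.
move=> hM; have M0 := bl_ge0 hM; have az := am_std_normal R.
have a1 := am_heat x v hM; have a2 := am_heat x v' hM.
rewrite /heat -ExB//; apply: le_trans (norm_Ex (amB a1 a2)) _.
have aZ : all_moments (std_normal R) (fun z => (M * `|Num.sqrt v - Num.sqrt v'|) * `|z|).
  by apply: amM; [exact: am_cst|exact: am_norm].
apply: le_trans (le_Ex (am_norm (amB a1 a2)) aZ _) _.
  move=> z; case: hM => _ hL; apply: le_trans (hL _ _) _.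
  by rewrite opprD addrACA subrr add0r -mulrBl normrM mulrA.
rewrite ExZ; last exact: am_norm.
rewrite ler_piMr ?mulr_ge0//.
by apply: Ex_norm_le => //; rewrite expr1n std_normal_second_moment.
Qed.

Section L2.
Context d (T : measurableType d) (R : realType) (P : probability T R).

(** The L2 norm is 1-Lipschitz; the slack [eps] covers the case of a vanishing
    norm. *)
Lemma L2_triangle (X Y : T -> R) (e : R) : all_moments P X -> all_moments P Y -> 0 < e ->
  Ex P (fun w => (X w - Y w) ^+ 2) <= e ^+ 2 ->
  `|Num.sqrt (Ex P (fun w => X w ^+ 2)) - Num.sqrt (Ex P (fun w => Y w ^+ 2))| <= e.
Proof.
move=> aX aY e0 XY.
have half (U V : T -> R) : all_moments P U -> all_moments P V ->
    Ex P (fun w => (U w - V w) ^+ 2) <= e ^+ 2 ->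
    Num.sqrt (Ex P (fun w => U w ^+ 2)) <= Num.sqrt (Ex P (fun w => V w ^+ 2)) + e.
  move=> aU aV UV; apply/ler_addgt0Pr => eps eps0.
  set y := Num.sqrt (Ex P (fun w => V w ^+ 2)).
  have V20 : 0 <= Ex P (fun w => V w ^+ 2) by apply: Ex_ge0 => w; exact: sqr_ge0.
  have y0 : 0 <= y := sqrtr_ge0 _.
  have yV : Ex P (fun w => V w ^+ 2) <= (y + eps) ^+ 2.
    rewrite -[leLHS](sqr_sqrtr V20) lerXn2r ?nnegrE// ?addr_ge0 ?(ltW eps0)//.
    by rewrite lerDl ltW.
  have ye : 0 < y + eps by rewrite ltr_wpDl.
  have := L2_add aV (amB aU aV) ye e0 yV UV.
  have -> : Ex P (fun w => (V w + (U w - V w)) ^+ 2) = Ex P (fun w => U w ^+ 2).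
    by apply: eq_Ex => w; rewrite addrC subrK.
  move=> h; have ->  : y + e + eps = Num.sqrt ((y + eps + e) ^+ 2).
    by rewrite sqrtr_sqr ger0_norm ?addr_ge0 ?(ltW eps0) ?(ltW e0)//; ring.
  by rewrite ler_wsqrtr.
have h1 := half _ _ aX aY XY.
have h2 : Num.sqrt (Ex P (fun w => Y w ^+ 2)) <= Num.sqrt (Ex P (fun w => X w ^+ 2)) + e.
  apply: half => //; apply: le_trans XY; rewrite le_eqVlt; apply/orP; left; apply/eqP.
  by apply: eq_Ex => w; rewrite -sqrrN opprB.
by rewrite ler_norml; apply/andP; split; lra.
Qed.

Lemma var_sum_indep (Y : nat -> T -> R) K : (forall j, all_moments P (Y j)) ->
  (forall j, indep2 P (fun w => \sum_(i < j) Y i w) (Y j)) ->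
  var P (fun w => \sum_(j < K) Y j w) = \sum_(j < K) var P (Y j).
Proof.
move=> aY iY; elim: K => [|K IH].
  under eq_fun do rewrite big_ord0.
  rewrite big_ord0 varE; last exact: am_cst.
  transitivity (Ex P (fun=> 0 ^+ 2) - Ex P (fun=> 0) ^+ 2); first by [].
  by rewrite !Ex_cst subrr.
have aS : all_moments P (fun w => \sum_(j < K) Y j w) by exact: am_sum.
under eq_fun do rewrite big_ord_recr/=.
by rewrite big_ord_recr/= (var_indepD aS (aY K) (iY K)) IH.
Qed.

Lemma var_centered (Y : T -> R) : Ex P Y = 0 -> var P Y = Ex P (fun w => Y w ^+ 2).
Proof. by move=> Y0; apply: eq_Ex => w; rewrite /cen Y0 subr0. Qed.

End L2.

(** * Comparison with sums of independent blocks *)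

Section BlockApproximation.
Context d (T : measurableType d) (R : realType) (P : probability T R).
Variables (X : nat -> T -> R) (nu : nat -> probability R R) (f : R -> R).
Hypotheses (Xnu : independent_with_laws P X nu) (cf : continuous f).
Variables (C : nat -> R) (c : R) (r : nat) (c' : R) (k' : nat).
Hypotheses (CX : forall j, moments_le P C (X j))
  (fphi : dominated_increments f (fun x => c * (x + x ^+ r)))
  (c'0 : 0 <= c') (fk : forall y, `|f y| <= c' * (1 + y ^+ (2 * k'))).
Variables (n m k : nat).
Hypotheses (n0 : (0 < n)%N) (m0 : (0 < m)%N)
  (nk : (n <= 2 ^ k * m)%N) (kn : (2 ^ k * m <= 4 * n)%N)
  (X0 : forall j w, (2 * n <= j.+1)%N -> X j w = 0).

Notation E := (Ex P).

Let J j w := jstat f m (shift (2 * (j * m)) (X^~ w)).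

Let rn : R := (Num.sqrt n%:R)^-1.

Let rn_gt0 : 0 < rn.
Proof. by rewrite invr_gt0 sqrtr_gt0 ltr0n. Qed.

Let rn2 : rn ^+ 2 = n%:R^-1.
Proof. by rewrite exprVn sqr_sqrtr. Qed.

Definition clt_stat w := rn * cen P (fun w => jstat f n (X^~ w)) w.

Definition block_sum j w := rn * cen P (J j) w.

Let moments_J p i : moments_le P (jstatC C c r c' k' p) (fun w => jstat f p (shift i (X^~ w))).
Proof. by apply: moments_jstat => // j; exact: CX. Qed.

Let am_J p i : all_moments P (fun w => jstat f p (shift i (X^~ w))).
Proof. exact: amI (moments_J p i). Qed.

Lemma am_jstat_process p : all_moments P (fun w => jstat f p (X^~ w)).
Proof. exact: (am_J p 0). Qed.

Lemma am_clt_stat : all_moments P clt_stat.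
Proof. by apply: amM; [exact: am_cst|apply: am_cen; exact: am_jstat_process]. Qed.

Lemma am_block_sum j : all_moments P (block_sum j).
Proof. by apply: amM; [exact: am_cst|apply: am_cen; exact: am_J]. Qed.

Lemma Ex_block_sum j : E (block_sum j) = 0.
Proof.
rewrite /block_sum ExZ; last by apply: am_cen; exact: am_J.
by rewrite Ex_cen ?mulr0//; exact: am_J.
Qed.

Lemma indep_block_sum j : indep2 P (fun w => \sum_(i < j) block_sum i w) (block_sum j).
Proof.
pose H e (x : nat -> R) := rn * (jstat f m x - e).
have lH e : local (2 * m) (H e).
  split; first by move=> x y xy; rewrite /H (proj1 (local_jstat m cf) x y).
  apply: measurable_funM => //; apply: measurable_funB => //.
  exact: (proj2 (local_jstat m cf)).
pose G x := \sum_(i < j) H (E (J i)) (shift (2 * (i * m)) x).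
have lG : local (2 * (j * m)) G.
  apply: local_sum => i; apply: (@localW _ (2 * (i * m) + 2 * m)).
    by rewrite -mulnDr leq_mul2l -mulSnr leq_mul2r ltn_ord orbT.
  exact: local_shift.
exact: (local_indep 0 Xnu lG (lH (E (J j)))).
Qed.

Let jstat_pad w : jstat f (2 ^ k * m) (X^~ w) =
  jstat f n (X^~ w) + (2 ^ k * m - n)%:R * f 0.
Proof.
rewrite -{1}(subnKC nk) /jstat /jacobi trf_tridiag_split; last first.
  by move=> i im; rewrite X0//; lia.
apply: (f_equal2 (fun u v : R => u + v)) => //.
rewrite -jstat_zero; congr (trf f _); apply: tridiag_ext => i _.
  by rewrite X0//; lia.
by rewrite X0//; lia.
Qed.

Variable s : R.
Hypotheses (s0 : 0 < s) (Cs : jdefectC C c r 2 <= s ^+ 2).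

Let delta := 8 * s / Num.sqrt m%:R.

Let k4 : (2 ^ k)%:R <= 4 * n%:R / m%:R :> R.
Proof. by rewrite ler_pdivlMr ?ltr0n// -!natrM ler_nat. Qed.

(** The normalized statistic is within O(1 / sqrt m) of the block sum, uniformly
    in [n]: its deviation from it is 4 s sqrt (2 ^ k) / sqrt n, and the dyadic
    size 2 ^ k * m is at most 4 n. *)
Lemma block_approximation :
  E (fun w => (clt_stat w - \sum_(j < 2 ^ k) block_sum j w) ^+ 2) <= delta ^+ 2.
Proof.
pose BE w := block_error f m k (shift 0 (X^~ w)).
have aBE : all_moments P BE by apply: am_block_error; exact: am_J.
have aJ j : all_moments P (J j) by exact: am_J.
have aJn := am_jstat_process n.
have aJN := am_jstat_process (2 ^ k * m).
have diffE w : clt_stat w - \sum_(j < 2 ^ k) block_sum j w = rn * cen P BE w.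
  have EBE : E BE = E (fun w => jstat f n (X^~ w)) + (2 ^ k * m - n)%:R * f 0 -
      \sum_(j < 2 ^ k) E (J j).
    have -> : E BE = E (fun w => (jstat f n (X^~ w) + (2 ^ k * m - n)%:R * f 0) -
        \sum_(j < 2 ^ k) J j w).
      by apply: eq_Ex => v; rewrite -jstat_pad.
    rewrite ExB; [|by apply: amD => //; exact: am_cst|exact: am_sum].
    by rewrite ExD ?Ex_cst ?Ex_sum//; exact: am_cst.
  rewrite /clt_stat /block_sum -mulr_sumr -mulrBr /cen EBE sumrB.
  have -> : BE w = jstat f n (X^~ w) + (2 ^ k * m - n)%:R * f 0 - \sum_(j < 2 ^ k) J j w.
    by rewrite -jstat_pad.
  congr (rn * _); ring.
have -> : E (fun w => (clt_stat w - \sum_(j < 2 ^ k) block_sum j w) ^+ 2) =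
    n%:R^-1 * var P BE.
  rewrite /var -ExZ; last by apply: amX; exact: am_cen.
  by apply: eq_Ex => w; rewrite diffE exprMn rn2.
have vBE := var_block_error Xnu cf CX fphi am_J m k 0 s0 Cs.
rewrite -/BE in vBE.
have nr0 : 0 < n%:R :> R by rewrite ltr0n.
have mr0 : 0 < m%:R :> R by rewrite ltr0n.
rewrite mulrC ler_pdivrMr//; apply: le_trans vBE _.
have s2 : 1 <= Num.sqrt 2 :> R by rewrite -{1}[1]sqrtr1 ler_wsqrtr// ler1n.
have sk : 1 <= Num.sqrt 2 ^+ k :> R by rewrite exprn_ege1.
apply: (@le_trans _ _ ((s * (4 * Num.sqrt 2 ^+ k)) ^+ 2)).
  rewrite lerXn2r ?nnegrE ?mulr_ge0 ?(ltW s0)//; try lra.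
  by rewrite ler_pM2l//; lra.
have -> : (s * (4 * Num.sqrt 2 ^+ k)) ^+ 2 = 16 * s ^+ 2 * (2 ^ k)%:R.
  by rewrite !exprMn exprAC sqr_sqrtr// natrX; ring.
have -> : delta ^+ 2 * n%:R = 16 * s ^+ 2 * (4 * n%:R / m%:R).
  by rewrite /delta expr_div_n sqr_sqrtr// exprMn; field; rewrite gt_eqF.
by rewrite ler_wpM2l// mulr_ge0// sqr_ge0.
Qed.

Let var_block_sum j : E (fun w => block_sum j w ^+ 2) = n%:R^-1 * var P (J j).
Proof.
rewrite /var -ExZ; last by apply: amX; apply: am_cen; exact: am_J.
by apply: eq_Ex => w; rewrite exprMn rn2.
Qed.

(** Blocks that lie in the padding are constant. *)
Lemma sum_var_block_sum :
  \sum_(j < 2 ^ k) E (fun w => block_sum j w ^+ 2) =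
  n%:R^-1 * \sum_(j < n | (j * m < n)%N)
    block_variance f (fun l => nu (2 * (j * m) + l)%N) m.
Proof.
have vJ0 j : (n <= j * m)%N -> var P (J j) = 0.
  move=> nj; have Jc : J j = fun=> m%:R * f 0.
    apply/funext => w; rewrite -jstat_zero /J; congr (jstat f m _).
    by apply/funext => l; rewrite /shift X0//; lia.
  by rewrite /var Jc; transitivity (Ex P (fun=> 0 : R)); [apply: eq_Ex => w; rewrite /cen Ex_cst subrr expr0n|exact: Ex_cst].
have -> : \sum_(j < n | (j * m < n)%N) block_variance f (fun l => nu (2 * (j * m) + l)%N) m =
    \sum_(j < n | (j * m < n)%N) var P (J j).
  by apply: eq_bigr => j _; apply/esym; apply: var_block => //; exact: am_J.
rewrite mulr_sumr; under eq_bigr do rewrite var_block_sum.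
rewrite -!mulr_sumr; congr (_ * _).
pose N := maxn n (2 ^ k).
have nN : (n <= N)%N by exact: leq_maxl.
have kN : (2 ^ k <= N)%N by exact: leq_maxr.
rewrite (big_ord_widen_cond N (fun j => (j * m < n)%N) (fun j => var P (J j)) nN).
rewrite (big_ord_widen_cond N xpredT (fun j => var P (J j)) kN).
rewrite big_mkcond [RHS]big_mkcond; apply: eq_bigr => j _ /=.
have [jm|jm] := ltnP (j * m) n; last by rewrite vJ0// andFb; case: ifP.
have -> : (j < n)%N by rewrite (leq_ltn_trans _ jm)// leq_pmulr.
by have -> : (j < 2 ^ k)%N by rewrite -(ltn_pmul2r m0) (leq_trans jm).
Qed.

Let am_sum_block K : all_moments P (fun w => \sum_(j < K) block_sum j w).
Proof. by apply: am_sum => j _; exact: am_block_sum. Qed.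

Lemma Ex_sum_block_sqr : E (fun w => (\sum_(j < 2 ^ k) block_sum j w) ^+ 2) =
  \sum_(j < 2 ^ k) E (fun w => block_sum j w ^+ 2).
Proof.
rewrite -var_centered; last first.
  by rewrite Ex_sum ?big1// => j _; [exact: Ex_block_sum|exact: am_block_sum].
rewrite (var_sum_indep _ am_block_sum indep_block_sum).
by apply: eq_bigr => j _; rewrite var_centered// Ex_block_sum.
Qed.

Let delta_gt0 : 0 < delta.
Proof. by rewrite divr_gt0 ?mulr_gt0// sqrtr_gt0 ltr0n. Qed.

Lemma block_variance_close :
  `|Num.sqrt (E (fun w => clt_stat w ^+ 2)) -
    Num.sqrt (\sum_(j < 2 ^ k) E (fun w => block_sum j w ^+ 2))| <= delta.
Proof.
rewrite -Ex_sum_block_sqr; apply: L2_triangle => //; first exact: am_clt_stat.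
exact: block_approximation.
Qed.

(** Moment bounds for a centred block: they depend on its size [m] but not on
    its position, nor on [n]. *)
Definition cen_jstatC : nat -> R :=
  let CJ := jstatC C c r c' k' m in addC CJ (cstC (CJ 1%N)).

Definition lindebergC : R :=
  cen_jstatC 3 + Num.sqrt (cen_jstatC 2) ^+ 3 * normal_third R.

Let moments_cen_J j : moments_le P cen_jstatC (cen P (J j)).
Proof.
apply: moments_leD; first exact: moments_J.
have mJ := moments_J m (2 * (j * m)).
have C1 : 0 <= jstatC C c r c' k' m 1 := moments_le_ge0 1 mJ.
apply: (@moments_le_norm _ _ _ P _ _ (fun=> jstatC C c r c' k' m 1)).
- exact: measurable_cst.
- move=> _; rewrite normrN [leRHS]ger0_norm//.
  apply: le_trans (norm_Ex (am_J m _)) _; apply: le_trans (moments_le_Ex 1 mJ).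
  by rewrite le_eqVlt; apply/orP; left; apply/eqP; apply: eq_Ex => w; rewrite expr1.
- exact: moments_le_cst.
Qed.

Let normal_third_ge0 : 0 <= normal_third R.
Proof. by apply: Ex_ge0 => z; rewrite exprn_ge0. Qed.

Let lindeberg_term j : E (fun w => `|block_sum j w| ^+ 3) +
  Num.sqrt (E (fun w => block_sum j w ^+ 2)) ^+ 3 * normal_third R <= rn ^+ 3 * lindebergC.
Proof.
have rn3 : 0 <= rn ^+ 3 by rewrite exprn_ge0// ltW.
have acJ : all_moments P (cen P (J j)) := amI (moments_cen_J j).
rewrite mulrDr lerD//.
  apply: (@le_trans _ _ (rn ^+ 3 * E (fun w => `|cen P (J j) w| ^+ 3))).
    rewrite -ExZ; last exact/amX/am_norm.
    rewrite le_eqVlt; apply/orP; left; apply/eqP; apply: eq_Ex => w.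
    by rewrite normrM exprMn (gtr0_norm rn_gt0).
  by rewrite ler_wpM2l// (moments_le_Ex 3 (moments_cen_J j)).
rewrite mulrA -exprMn ler_wpM2r// lerXn2r ?nnegrE ?sqrtr_ge0//.
  by rewrite mulr_ge0 ?sqrtr_ge0// ltW.
have rE : rn = Num.sqrt (rn ^+ 2) by rewrite sqrtr_sqr gtr0_norm.
rewrite [X in _ <= X * _]rE -sqrtrM ?sqr_ge0// ler_wsqrtr//.
rewrite var_block_sum rn2 ler_wpM2l ?invr_ge0//.
apply: le_trans (moments_le_Ex 2 (moments_cen_J j)).
rewrite le_eqVlt; apply/orP; left; apply/eqP; apply: eq_Ex => w.
by rewrite real_normK ?num_real.
Qed.

(** The two errors are of different nature: the first comes from the cuts and is
    small for large [m], uniformly in [n]; the second is that of the replacement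
    argument for about 4 n / m blocks, and is small for large [n] when [m] is
    fixed. *)
Lemma clt_stat_test M h h1 h2 : taylor3 M h h1 h2 ->
  `|E (fun w => h (clt_stat w)) -
    heat (\sum_(j < 2 ^ k) E (fun w => block_sum j w ^+ 2)) h 0| <=
  M * delta + M * (4 / m%:R * lindebergC * rn).
Proof.
move=> hT; have [hM _ _ _] := hT; have M0 := bl_ge0 hM.
have nr0 : 0 < n%:R :> R by rewrite ltr0n.
have mr0 : 0 < m%:R :> R by rewrite ltr0n.
have lind := lindeberg (2 ^ k) hT am_block_sum Ex_block_sum indep_block_sum (fun j => erefl).
apply: le_trans (ler_distD (E (fun w => h (\sum_(j < 2 ^ k) block_sum j w))) _ _) _.
rewrite lerD//.
  have a1 := am_bl P hM (am_measurable am_clt_stat).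
  have a2 := am_bl P hM (am_measurable (am_sum_block (2 ^ k))).
  have ad := amB am_clt_stat (am_sum_block (2 ^ k)).
  rewrite -ExB//; apply: le_trans (norm_Ex (amB a1 a2)) _.
  apply: (@le_trans _ _ (E (fun w => M * `|clt_stat w - \sum_(j < 2 ^ k) block_sum j w|))).
    apply: le_Ex.
    - exact/am_norm/amB.
    - by apply: amM; [exact: am_cst|exact: am_norm].
    - by move=> w; case: hM => _; exact.
  rewrite ExZ; last exact: am_norm.
  by rewrite ler_wpM2l//; apply: Ex_norm_le => //; exact: block_approximation.
apply: le_trans lind _; rewrite ler_wpM2l//.
apply: (@le_trans _ _ (\sum_(j < 2 ^ k) rn ^+ 3 * lindebergC)).
  by apply: ler_sum => j _; exact: lindeberg_term.
rewrite sumr_const card_ord -[leLHS]mulr_natl.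
have L0 : 0 <= lindebergC.
  have h3 : 0 <= rn ^+ 3 * lindebergC.
    apply: le_trans (lindeberg_term 0); rewrite addr_ge0//.
      by apply: Ex_ge0 => w; rewrite exprn_ge0.
    by rewrite mulr_ge0// exprn_ge0// sqrtr_ge0.
  by move: h3; rewrite pmulr_rge0// exprn_gt0.
have -> : 4 / m%:R * lindebergC * rn = (4 * n%:R / m%:R) * (rn ^+ 3 * lindebergC).
  have -> : rn ^+ 3 = n%:R^-1 * rn by rewrite exprSr rn2.
  generalize rn lindebergC => t D; field.
  by apply/andP; split; rewrite gt_eqF.
by rewrite ler_wpM2r// mulr_ge0// exprn_ge0// ltW.
Qed.

End BlockApproximation.

(** * Growth of the statistic *)

Section PolynomialGrowth.
Variable R : realType.

Lemma norm_expr_le_even (x : R) i k : (i <= 2 * k)%N -> `|x| ^+ i <= 1 + x ^+ (2 * k).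
Proof.
move=> ik; have x2 : x ^+ (2 * k) = `|x| ^+ (2 * k).
  by rewrite !exprM real_normK ?num_real.
have [x1|x1] := leP `|x| 1.
  rewrite (@le_trans _ _ 1) ?exprn_ile1// lerDl x2 exprn_ge0//.
by rewrite x2 (le_trans (ler_weXn2l (ltW x1) ik))// lerDr.
Qed.

Lemma poly_growth (Q : {poly R}) x :
  `|Q.[x]| <= coef_sum Q * (1 + x ^+ (2 * size Q)).
Proof.
rewrite horner_coef; apply: le_trans (ler_norm_sum _ _ _) _.
rewrite /coef_sum mulr_suml; apply: ler_sum => i _.
rewrite normrM ler_wpM2l// normrX norm_expr_le_even//.
by rewrite mul2n -addnn (leq_trans (ltnW (ltn_ord i)))// leq_addr.
Qed.

(** The derivative is dominated by c (1 + x ^ r) for an even r, and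
    x + x ^ (r + 1), with r + 1 odd, is increasing with a larger derivative. The
    mean value theorem compares [f] with it. *)
Lemma dominated_increments_derive (f : R -> R) (Q : {poly R}) :
  (forall x, derivable f x 1) -> (forall x, `|derive1 f x| <= Q.[x]) ->
  dominated_increments f
    (fun x => coef_sum Q * (x + x ^+ (2 * size Q).+1)).
Proof.
move=> df fQ x y xy.
set r := (2 * size Q)%N; set c := coef_sum Q.
have c0 : 0 <= c by exact: sumr_ge0.
pose phi (z : R) : R := c * (z + z ^+ r.+1).
have dphi (z : R) : is_derive z 1 phi (c * (1 + r.+1%:R * z ^+ r)).
  have -> : phi = horner (c%:P * ('X + 'X^(r.+1))).
    by apply/funext => t; rewrite /phi !hornerE.
  apply: is_derive_eq (is_derive_poly _ z) _.
  rewrite derivM derivC mul0r add0r derivD derivX derivXn.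
  by rewrite !(hornerE, hornerMn, hornerXn) -mulr_natl.
have df' (z : R) : is_derive z 1 f (derive1 f z) by rewrite derive1E; exact: derivableP.
have bound (z : R) : `|derive1 f z| <= c * (1 + r.+1%:R * z ^+ r).
  apply: le_trans (fQ z) _; apply: le_trans (ler_norm _) _.
  apply: le_trans (poly_growth Q z) _; rewrite -/c ler_wpM2l// lerD2l.
  rewrite -[leLHS]mul1r ler_wpM2r ?ler1n//.
  by rewrite exprM exprn_ge0// sqr_ge0.
have mono (e : R) : e = 1 \/ e = -1 -> e * (f y - f x) <= phi y - phi x.
  move=> e1.
  have dF (z : R) : is_derive z 1 (fun t => phi t - e * f t)
      (c * (1 + r.+1%:R * z ^+ r) - e * derive1 f z).
    apply: is_derive_eq (is_deriveB (dphi z) (is_deriveM (is_derive_cst e z 1) (df' z))) _.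
    by rewrite /cst/= scaler0 addr0.
  have cF : {within `[x, y], continuous (fun t => phi t - e * f t)}.
    apply: continuous_subspaceT => z; apply: differentiable_continuous.
    by apply/derivable1_diffP; case: (dF z).
  have [z _ E] := MVT_segment xy (fun z _ => dF z) cF.
  have : 0 <= (c * (1 + r.+1%:R * z ^+ r) - e * derive1 f z) * (y - x).
    rewrite mulr_ge0 ?subr_ge0//; have := bound z; rewrite ler_norml.
    by case: e1 => ->; lra.
  rewrite -E; lra.
rewrite ler_norml; have := mono 1 (or_introl erefl); have := mono (-1) (or_intror erefl).
by rewrite -/(phi y) -/(phi x); lra.
Qed.

Lemma growth_dominated_increments (f : R -> R) c k : 0 <= c ->
  dominated_increments f (fun x => c * (x + x ^+ (2 * k).+1)) ->
  forall x, `|f x| <= (`|f 0| + 2 * c) * (1 + x ^+ (2 * k.+1)).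
Proof.
move=> c0 fphi x.
have h : `|f x - f 0| <= c * (`|x| + `|x| ^+ (2 * k).+1).
  have phi0 : c * (0 + 0 ^+ (2 * k).+1) = 0 :> R by rewrite expr0n/= addr0 mulr0.
  have [x0|x0] := leP 0 x.
    by have := fphi _ _ x0; rewrite phi0 subr0 (ger0_norm x0).
  have := fphi _ _ (ltW x0); rewrite phi0 sub0r distrC => h.
  apply: le_trans h _; rewrite -mulrN ler_wpM2l// opprD (ltr0_norm x0).
  by rewrite exprNn -signr_odd /= oddM/= expr1 mulN1r.
have h1 := @norm_expr_le_even x 1 k.+1 isT.
have h2 : `|x| ^+ (2 * k).+1 <= 1 + x ^+ (2 * k.+1) by apply: norm_expr_le_even; lia.
rewrite expr1 in h1.
have q1 : 1 <= 1 + x ^+ (2 * k.+1) by rewrite lerDl exprM exprn_ge0// sqr_ge0.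
have -> : f x = f 0 + (f x - f 0) by rewrite addrC subrK.
apply: le_trans (ler_normD _ _) _; rewrite mulrDl lerD//.
  by rewrite ler_peMr.
apply: le_trans h _; rewrite (mulrC 2) -mulrA ler_wpM2l//; lra.
Qed.

End PolynomialGrowth.

Lemma dyadic_size n m : (0 < m)%N -> (m <= n)%N ->
  exists k, (n <= 2 ^ k * m)%N && (2 ^ k * m <= 4 * n)%N.
Proof.
move=> m0 mn.
have ex : exists k, (n <= 2 ^ k * m)%N.
  by exists n; rewrite (leq_trans (ltnW (ltn_expl n (ltnSn 1))))// leq_pmulr.
case: (ex_minnP ex) => -[|k] nk kmin; first by exists 0%N; rewrite nk expn0 mul1n; lia.
exists k.+1; rewrite nk/=; have [|h] := leqP n (2 ^ k * m).
  by move=> /kmin; rewrite ltnn.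
rewrite expnS -mulnA; lia.
Qed.

(** Uniform limits of convergent sequences converge; this lets the block size
    go to infinity after the matrix size. *)
Lemma cvgn_approx (R : realType) (W : nat -> R) :
  (forall e, 0 < e -> exists2 u : nat -> R, cvgn u &
     exists N, forall n, (N <= n)%N -> `|W n - u n| <= e) -> cvgn W.
Proof.
move=> H; apply/cauchy_cvgP/cauchy_exP => e e0.
have e3 : 0 < e / 3 by rewrite divr_gt0.
have [u /cvg_ex[/= l ul] [N hN]] := H _ e3.
have [M _ hM] := (cvgrPdist_le _ _).1 ul _ e3.
exists l; exists (maxn N M) => // n /=; rewrite geq_max => /andP[/hN h1 /hM /= h2].
rewrite /ball/=; apply: le_lt_trans (ler_distD (u n) _ _) _.
rewrite distrC in h1; apply: le_lt_trans (lerD h2 h1) _; lra.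
Qed.

(** * The central limit theorem *)

(** The marginal laws are recovered from the product formula by leaving all
    earlier entries free. *)
Lemma moments_of_law d (T : measurableType d) (R : realType) (P : probability T R)
    (X : nat -> T -> R) nu (C : nat -> R) :
  independent_with_laws P X nu ->
  (forall r j, (\int[nu j]_x (wt r x)%:E <= (C r)%:E)%E) ->
  forall j, moments_le P C (X j).
Proof.
move=> [mX Xnu] nuC j; split; first exact: mX.
move=> r; apply: le_trans (nuC r j).
have law A : measurable A -> distribution P (rv_of (mX j)) A = nu j A.
  move=> mA; have := Xnu j.+1 (fun i => if i == j then A else setT) _.
  rewrite big_ord_recr/= eqxx big1 ?mul1e; last first.
    by move=> i _; rewrite (ltn_eqF (ltn_ord i)); exact: probability_setT.
  move=> <-; last by move=> i; case: ifP.
  rewrite /distribution/= /pushforward; congr (P _); apply/seteqP; split => w /=.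
    by move=> Aw i _; case: eqP => // ->.
  by move=> /(_ j (ltnSn j)); rewrite eqxx.
apply: (@le_trans _ _ (\int[P]_w (wt r (X j w))%:E)%E).
  apply: ge0_le_integral => //.
  - by apply: measurable_abs_expr; exact: mX.
  - apply/measurable_EFinP; apply: measurableT_comp; first exact: measurable_wt.
    exact: mX.
  - move=> w _; rewrite lee_fin /wt lerXn2r ?nnegrE ?addr_ge0 ?sqr_ge0//.
    rewrite -[X in _ <= 1 + X]real_normK ?num_real//.
    by have := sqr_ge0 (`|X j w| - 1); have := normr_ge0 (X j w); nra.
have <- : (\int[distribution P (rv_of (mX j))]_x (wt r x)%:E =
    \int[nu j]_x (wt r x)%:E)%E.
  by apply: eq_measure_integral => A mA _; exact: law.
rewrite ge0_integral_distribution//.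
- by apply/measurable_EFinP; exact: measurable_wt.
- by move=> x; rewrite lee_fin wt_ge0.
Qed.

Lemma inv_sqrt_small (R : realType) (K e : R) : 0 < e ->
  exists N, forall n, (N <= n)%N -> K / Num.sqrt n%:R <= e.
Proof.
move=> e0; exists (Num.truncn ((K / e) ^+ 2)).+1 => n nN.
have n0 : 0 < n%:R :> R by rewrite ltr0n (leq_ltn_trans _ nN).
have sn0 : 0 < Num.sqrt n%:R :> R by rewrite sqrtr_gt0.
rewrite ler_pdivrMr// mulrC -ler_pdivrMr//.
apply: (le_trans (ler_norm _)); rewrite -sqrtr_sqr ler_wsqrtr//.
by apply/ltW/(lt_le_trans (truncnS_gt _)); rewrite ler_nat.
Qed.

Section CentralLimit.
Variables (R : realType) (f : R -> R) (alpha c c' : R) (r k' : nat).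
Hypotheses (alpha0 : 0 < alpha) (cf : continuous f)
  (fphi : dominated_increments f (fun x => c * (x + x ^+ r)))
  (c'0 : 0 <= c') (fk : forall y, `|f y| <= c' * (1 + y ^+ (2 * k'))).

Definition entry_model n d (T : measurableType d) (P : probability T R)
    (X : nat -> T -> R) :=
  independent_with_laws P X (gbe_law alpha n) /\
  forall j w, (2 * n <= j.+1)%N -> X j w = 0.

(** Defined from the laws alone, so that its limit is the same for all
    realizations of the matrices. *)
Definition std_dev n : R :=
  Num.sqrt (n%:R^-1 * block_variance f (gbe_law alpha n) n).

Let C : nat -> R := entryB alpha.

(** The addition of 1 makes this bound on the cost of a cut positive. *)
Let s : R := Num.sqrt (Num.max 0 (jdefectC C c r 2)) + 1.

Let s0 : 0 < s. Proof. by rewrite ltr_wpDl// sqrtr_ge0. Qed.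

Let Cs : jdefectC C c r 2 <= s ^+ 2.
Proof.
apply: (@le_trans _ _ (Num.sqrt (Num.max 0 (jdefectC C c r 2)) ^+ 2)).
  by rewrite sqr_sqrtr le_max lexx ?orbT.
by rewrite lerXn2r ?nnegrE ?sqrtr_ge0 ?(ltW s0)// lerDl.
Qed.

Section OneModel.
Context (n : nat) d (T : measurableType d) (P : probability T R) (X : nat -> T -> R).
Hypotheses (n0 : (0 < n)%N) (XP : entry_model n P X).

Lemma entry_model_moments j : moments_le P C (X j).
Proof.
by case: XP => Xnu _; apply: (moments_of_law Xnu) => ? ?; exact: gbe_law_wt.
Qed.

Let CX := entry_model_moments.

Lemma am_jstat_model p : all_moments P (fun w => jstat f p (X^~ w)).
Proof. exact: (am_jstat_process cf CX fphi c'0 fk p). Qed.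

Lemma am_clt_stat_model : all_moments P (clt_stat P X f n).
Proof. exact: (am_clt_stat cf CX fphi c'0 fk n). Qed.

Lemma Ex_clt_stat_sqr :
  Ex P (fun w => clt_stat P X f n w ^+ 2) = n%:R^-1 * block_variance f (gbe_law alpha n) n.
Proof.
case: XP => Xnu _.
have aJ := am_jstat_model n.
have <- : var P (fun w => jstat f n (X^~ w)) = block_variance f (gbe_law alpha n) n.
  exact: (@var_block _ _ cf _ _ _ _ _ 0 n Xnu aJ).
rewrite /var -ExZ; last by apply: amX; exact: am_cen.
by apply: eq_Ex => w; rewrite /clt_stat exprMn exprVn sqr_sqrtr.
Qed.

Lemma std_devE : std_dev n = Num.sqrt (Ex P (fun w => clt_stat P X f n w ^+ 2)).
Proof. by rewrite Ex_clt_stat_sqr. Qed.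

Lemma std_dev_close m : (0 < m)%N -> (m <= n)%N ->
  `|std_dev n - Num.sqrt (total_variance f alpha m n)| <= 8 * s / Num.sqrt m%:R.
Proof.
move=> m0 mn; have [Xnu X0] := XP; have [k /andP[nk kn]] := dyadic_size m0 mn.
rewrite std_devE /total_variance.
have <- := sum_var_block_sum Xnu cf CX fphi c'0 fk n0 m0 nk kn X0 s0 Cs.
exact: (block_variance_close Xnu cf CX fphi c'0 fk n0 m0 nk kn X0 s0 Cs).
Qed.

Lemma clt_stat_close m M h h1 h2 : (0 < m)%N -> (m <= n)%N -> taylor3 M h h1 h2 ->
  `|Ex P (fun w => h (clt_stat P X f n w)) - heat (total_variance f alpha m n) h 0| <=
  M * (8 * s / Num.sqrt m%:R) +
  M * (4 / m%:R * lindebergC C c r c' k' m / Num.sqrt n%:R).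
Proof.
move=> m0 mn hT; have [Xnu X0] := XP; have [k /andP[nk kn]] := dyadic_size m0 mn.
rewrite /total_variance; have <- := sum_var_block_sum Xnu cf CX fphi c'0 fk n0 m0 nk kn X0 s0 Cs.
exact: (clt_stat_test Xnu cf CX fphi c'0 fk n0 m0 nk kn X0 s0 Cs hT).
Qed.

End OneModel.

Variables (d : nat -> measure_display) (T : forall n, measurableType (d n))
  (P : forall n, probability (T n) R) (X : forall n, nat -> T n -> R).
Arguments P n : clear implicits.
Arguments X n : clear implicits.
Hypothesis XP : forall n, (0 < n)%N -> entry_model n (P n) (X n).

(** For each block size [m] the deviation is within O(1 / sqrt m) of that of the
    blocks, which converges by [total_variance_cvg]. *)
Lemma std_dev_cvg : cvgn std_dev.
Proof.
apply: cvgn_approx => e e0.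
have [m0 hm] := inv_sqrt_small (8 * s) e0.
pose m := m0.+1.
have cm := total_variance_cvg cf c'0 fk alpha0 (ltn0Sn m0).
exists (fun n => Num.sqrt (total_variance f alpha m n)).
  move: cm => /cvg_ex[/= l ml]; apply/cvg_ex; exists (Num.sqrt l).
  by apply: continuous_cvg => //; exact: sqrt_continuous.
exists m => n mn; have n0 : (0 < n)%N by exact: leq_trans mn.
by apply: le_trans (std_dev_close n0 (XP n0) _ mn) _ => //; exact: hm.
Qed.

Lemma std_dev_limit_ge0 : 0 <= limn std_dev.
Proof. by apply: limr_ge; [exact: std_dev_cvg|apply: nearW => n; exact: sqrtr_ge0]. Qed.

(** The block size [m] is chosen first, to make the cost of the cuts small, and
    then the matrix size, to make the replacement error small. *)
Lemma clt_stat_test_cvg (p : {poly R}) :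
  Ex (P n) (fun w => p.[logistic (clt_stat (P n) (X n) f n w)]) @[n --> \oo] -->
  heat (limn std_dev ^+ 2) (fun x => p.[logistic x]) 0.
Proof.
have [M hT] := taylor3_horner_logistic p; have [hM _ _ _] := hT.
have M0 := bl_ge0 hM; have M1 : 0 < M + 1 by rewrite ltr_wpDl.
apply/cvgrPdist_le => e e0.
pose eta := e / (4 * (M + 1)); have eta0 : 0 < eta by rewrite divr_gt0// mulr_gt0.
have [m0 hm] := inv_sqrt_small (8 * s) eta0.
pose m := m0.+1.
have [N1 hN1] := inv_sqrt_small (4 / m%:R * lindebergC C c r c' k' m) eta0.
have [N2 _ hN2] := (cvgrPdist_le _ _).1 std_dev_cvg _ eta0.
exists (maxn m (maxn N1 N2)) => // n /=; rewrite !geq_max => /and3P[mn /hN1 h1 /hN2 h2].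
have n0 : (0 < n)%N by exact: leq_trans mn.
have hd := hm m (leqnSn m0).
have close := clt_stat_close n0 (XP n0) (ltn0Sn m0) mn hT.
have sclose := std_dev_close n0 (XP n0) (ltn0Sn m0) mn.
have lip := heat_lipschitz (limn std_dev ^+ 2) (total_variance f alpha m n) 0 hM.
rewrite sqrtr_sqr (ger0_norm std_dev_limit_ge0) in lip.
have dist : `|limn std_dev - Num.sqrt (total_variance f alpha m n)| <= eta + eta.
  apply: le_trans (ler_distD (std_dev n) _ _) _.
  by apply: lerD; [exact: h2|exact: le_trans sclose hd].
rewrite distrC in close.
apply: le_trans (ler_distD (heat (total_variance f alpha m n) (fun x => p.[logistic x]) 0) _ _) _.
apply: (@le_trans _ _ (M * (eta + eta) + (M * eta + M * eta))).
  apply: lerD; first by apply: le_trans lip _; rewrite ler_wpM2l.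
  by apply: le_trans close _; apply: lerD; rewrite ler_wpM2l.
have -> : M * (eta + eta) + (M * eta + M * eta) = M * (e / (M + 1)).
  by rewrite /eta; field; rewrite gt_eqF.
by rewrite mulrCA ler_piMr ?(ltW e0)// ler_pdivrMr// mul1r lerDl.
Qed.

Lemma clt_stat_cvg (Z : forall n, T n -> R) : (forall n, measurable_fun setT (Z n)) ->
  (forall n, (0 < n)%N -> Z n = clt_stat (P n) (X n) f n) ->
  cvg_in_distribution P Z (gaussian_law (limn std_dev ^+ 2)).
Proof.
move=> mZ ZE.
have [B hB] : exists B, forall n, std_dev n <= B.
  have [B0 [_ hB0]] := cvg_seq_bounded std_dev_cvg.
  exists (B0 + 1) => n; apply: le_trans (ler_norm _) _.
  by apply: (hB0 (B0 + 1)); rewrite ?ltrDl.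
apply: (@cvg_gaussian_criterion _ _ _ _ _ _ (B ^+ 2)) => //; first exact: sqr_ge0.
- move=> n n0; rewrite (ZE n n0).
  have aZ := am_clt_stat_model (XP n0).
  rewrite (Ex_EFin (amX 2 aZ)) lee_fin.
  have v0 : 0 <= Ex (P n) (fun w => clt_stat (P n) (X n) f n w ^+ 2).
    by apply: Ex_ge0 => w; exact: sqr_ge0.
  have := hB n; rewrite (std_devE (XP n0)) => hv.
  rewrite -[leLHS](sqr_sqrtr v0) lerXn2r ?nnegrE ?sqrtr_ge0//.
  exact: le_trans (sqrtr_ge0 _) hv.
- move=> p; apply: cvg_trans (@clt_stat_test_cvg p).
  apply: near_eq_cvg; exists 1%N => // n n0.
  exact: (congr1 (fun z => Ex (P n) (fun w => p.[logistic (z w)])) (esym (ZE n n0))).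
Qed.

End CentralLimit.

Theorem theorem1p1 (R : realType) (alpha : R) (f : R -> R) :
  0 < alpha ->
  (forall x, derivable f x 1) -> continuous (derive1 f) ->
  (exists Q : {poly R}, forall x, `|derive1 f x| <= Q.[x]) ->
  exists sigma2 : R, 0 <= sigma2 /\
    forall (d : nat -> measure_display) (T : forall n, measurableType (d n))
      (P : forall n, probability (T n) R)
      (a b : forall n, nat -> {RV (P n) >-> R}),
      (forall n, (0 < n)%N ->
         gbe_entries n (2 * alpha / n%:R) (a n) (b n)) ->
      (forall n, (0 < n)%N ->
         (P n).-integrable setT (EFin \o linear_statistic n (a n) (b n) f)) /\
      cvg_in_distribution P
        (fun n w => Num.sqrt n%:R *
           (linear_statistic n (a n) (b n) f w -
            fine 'E_(P n)[linear_statistic n (a n) (b n) f]))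
        (gaussian_law sigma2).
Proof.
move=> alpha0 df _ [Q fQ].
have cf : continuous f.
  by move=> x; apply/differentiable_continuous/derivable1_diffP/df.
have fphi := dominated_increments_derive df fQ.
have c0 : 0 <= coef_sum Q by exact: sumr_ge0.
have fk := growth_dominated_increments c0 fphi.
have c'0 : 0 <= `|f 0| + 2 * coef_sum Q by rewrite addr_ge0// mulr_ge0.
have mf : measurable_fun setT f by exact: continuous_measurable_fun.
exists (limn (std_dev f alpha) ^+ 2); split; first exact: sqr_ge0.
move=> d T P a b gbe.
pose X n := entry_process n (a n) (b n).
have XP n : (0 < n)%N -> entry_model alpha n (P n) (X n).
  move=> n0; split; first exact: (entry_process_laws alpha0 (gbe n n0)).
  move=> j w nj; rewrite /X /entry_process /padded.
  have := odd_double_half j; case: (odd j) => /= jE; rewrite ifN// -leqNgt; lia.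
have L n w : linear_statistic n (a n) (b n) f w = n%:R^-1 * jstat f n (X n ^~ w).
  by rewrite (linear_statisticE n (a n) (b n) 0 w mf) addn0 mul0r subr0.
have aJ n (n0 : (0 < n)%N) := am_jstat_model alpha0 cf fphi c'0 fk (XP n n0) n.
have aL n : (0 < n)%N -> all_moments (P n) (linear_statistic n (a n) (b n) f).
  move=> n0; rewrite (_ : linear_statistic _ _ _ _ = fun w => n%:R^-1 * jstat f n (X n ^~ w)).
    by apply: amM; [exact: am_cst|exact: aJ].
  by apply/funext => w; exact: L.
have ZE n : (0 < n)%N -> (fun w => Num.sqrt n%:R * (linear_statistic n (a n) (b n) f w -
    fine 'E_(P n)[linear_statistic n (a n) (b n) f])) = clt_stat (P n) (X n) f n.
  move=> n0; apply/funext => w; rewrite unlock (Ex_EFin (aL n n0))/=.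
  have -> : Ex (P n) (linear_statistic n (a n) (b n) f) =
      n%:R^-1 * Ex (P n) (fun w => jstat f n (X n ^~ w)).
    by rewrite -ExZ; [apply: eq_Ex => v; exact: L|exact: aJ].
  rewrite L -mulrBr mulrA /clt_stat /cen; congr (_ * _).
  have nr0 : 0 < Num.sqrt n%:R :> R by rewrite sqrtr_gt0 ltr0n.
  rewrite -{2}[n%:R](@sqr_sqrtr _ n%:R)// expr2 invfM mulrA mulfV ?mul1r//.
  by rewrite gt_eqF.
split; first by move=> n n0; exact: am_integrable (aL n n0).
apply: (clt_stat_cvg alpha0 cf fphi c'0 fk XP) => //.
case=> [|n]; last by rewrite ZE//; exact: am_measurable (am_clt_stat_model alpha0 cf fphi c'0 fk (XP n.+1 isT)).
rewrite (_ : (fun w => _) = fun=> 0); first exact: measurable_cst.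
by apply/funext => w; rewrite sqrtr0 mul0r.
Qed.
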